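(* Let $N,L\ge1$ and let $\Phi\in\mathbb{R}^{N\times L}$ be a known matrix. Let $y=\Phi x+n$ with $n\sim\mathcal{N}(0,\xi I_N)$, where the noise variance $\xi=\sigma^2\in(0,\infty)$ is an unknown deterministic parameter; given $\gamma=(\gamma_1,\dots,\gamma_L)^T\in(0,\infty)^L$, let $x\sim\mathcal{N}(0,\Upsilon)$, $\Upsilon=\mathrm{diag}(\gamma_1,\dots,\gamma_L)$; and let $n$ be independent of $x$ (and of $\gamma$ if $\gamma$ is random). Consider the two models: (a) $\gamma$ is an unknown deterministic parameter; (b) $\gamma$ is random with distribution $\prod_{i=1}^L\mathcal{IG}\left(\frac{\nu}{2},\frac{\nu}{2\lambda}\right)$, i.e. $\gamma_1,\dots,\gamma_L$ are i.i.d. $\mathcal{IG}\left(\frac{\nu}{2},\frac{\nu}{2\lambda}\right)$, with $\nu,\lambda>0$. Let $\theta=[x^T,\gamma^T,\xi]^T\in\mathbb{R}^{2L+1}$. In each model the hybrid Cramér-Rao bound on the MSE matrix $\mathbf{E}_\xi^\theta$ of $\theta$ is $(\mathbf{H}_\xi^\theta)^{-1}$, i.e. $\mathbf{E}_\xi^\theta\succeq(\mathbf{H}_\xi^\theta)^{-1}$, where the hybrid information matrix is $$\mathbf{H}_\xi^\theta=\begin{bmatrix}\mathbf{H}' & \mathbf{0}_{2L\times1}\\ \mathbf{0}_{1\times 2L} & \frac{N}{2\xi^2}\end{bmatrix},$$ with, in model (a), $$\mathbf{H}'=\begin{bmatrix}\frac{\Phi^T\Phi}{\sigma^2}+\Upsilon^{-1}&\mathbf{0}_{L\times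 L}\\ \mathbf{0}_{L\times L}&\mathrm{diag}(2\gamma_1^2,\dots,2\gamma_L^2)^{-1}\end{bmatrix},$$ and, in model (b), $$\mathbf{H}'=\begin{bmatrix}\frac{\Phi^T\Phi}{\sigma^2}+\lambda I_L&\mathbf{0}_{L\times L}\\ \mathbf{0}_{L\times L}&\frac{\lambda^2(\nu+2)(\nu+7)}{2\nu}I_L\end{bmatrix}.$$
   Context: $A\succeq B$ means $A-B$ is positive semidefinite. The inverse Gamma distribution $\mathcal{IG}\left(\frac{\nu}{2},\frac{\nu}{2\lambda}\right)$ has density $\frac{1}{\Gamma(\nu/2)}\left(\frac{\nu}{2\lambda}\right)^{\nu/2}g^{-\nu/2-1}\exp\left\{-\frac{\nu}{2\lambda g}\right\}$ on $(0,\infty)$. Split $\theta$ into its random part $\theta_r$ and deterministic part $\theta_d$: in (a) $\theta_r=x$, $\theta_d=(\gamma,\xi)$; in (b) $\theta_r=(x,\gamma)$, $\theta_d=\xi$. Let $p(y,\theta_r;\theta_d)$ be the joint density of $(y,\theta_r)$ and $\mathbb{E}_{Y,\Theta_r}$ expectation with respect to it. The hybrid information matrix is $\mathbf{H}_\xi^\theta=-\mathbb{E}_{Y,\Theta_r}[\nabla_\theta\nabla_\theta^T\log p(y,\theta_r;\theta_d)]$, with derivatives in all components of $\theta$. For an estimator $\hat\theta(y)\in\mathbb{R}^{2L+1}$ of $\theta$, a function of the observations $y$, the MSE matrix is $\mathbf{E}_\xi^\theta=\mathbb{E}_{Y,\Theta_r}[(\theta-\hat\theta(y))(\theta-\hat\theta(y))^T]$.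 It is assumed that the MSE matrix exists and that the information matrix is non-singular.
   Formalization: The bound is proved for estimators whose mean error E[θ−θ̂(y)] exists and is the same for all values of the deterministic parameters (unbiased ones included); for arbitrary estimators it fails, e.g. a constant estimator equal to the true ξ has zero error in ξ. *)

(* Defs.v *)
From HB Require Import structures.
From mathcomp Require Import all_boot all_order all_algebra.
From mathcomp Require Import all_classical all_reals all_analysis.

Set Implicit Arguments.
Unset Strict Implicit.
Unset Printing Implicit Defensive.

Import Order.TTheory GRing.Theory Num.Theory.
Import numFieldNormedType.Exports.

Local Open Scope classical_set_scope.
Local Open Scope ring_scope.

Section lebesgue_tuple.
Context {R : realType}.
Local Open Scope ereal_scope.

(* lebesgue_measure, whose domain is measurableTypeR R, as a measure on R with
   its canonical (Borel) measurable structure. *)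
Definition leb1 : set R -> \bar R := @lebesgue_measure R.

HB.instance Definition _ := isMeasure.Build _ R R leb1
  (measure0 (@lebesgue_measure R)) (measure_ge0 (@lebesgue_measure R))
  (@measure_semi_sigma_additive _ _ _ (@lebesgue_measure R)).
HB.instance Definition _ := Measure_isSigmaFinite.Build _ R R leb1
  (@sigma_finiteT _ _ _ (@lebesgue_measure R)).

Definition tcons n (z : R * n.-tuple R) : n.+1.-tuple R :=
  [tuple of z.1 :: z.2].

Lemma measurable_tcons n : measurable_fun setT (@tcons n).
Proof. exact: measurable_cons. Qed.

Definition leb_cons n (mu : {sigma_finite_measure set (n.-tuple R) -> \bar R}) :
    set (n.+1.-tuple R) -> \bar R :=
  pushforward (leb1 \x mu) (@tcons n).

HB.instance Definition _ n mu := Measure.copy (@leb_cons n mu)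
  (measure_function_pushforward__canonical__measure_function_Measure
     [the {measure set _ -> \bar R} of leb1 \x mu] (@measurable_tcons n)).

Lemma leb_cons_sigma_finite n mu : sigma_finite setT (@leb_cons n mu).
Proof.
have [F FT Ffin] : sigma_finite setT (leb1 \x mu).
  have /sigma_finiteP[F [TF ndF Foo]] := sigma_finiteT leb1.
  have /sigma_finiteP[G [TG ndG Goo]] := sigma_finiteT mu.
  exists (fun k => F k `*` G k).
    rewrite -setXTT TF TG predeqE => -[x y]; split.
      move=> [/= [k _ Fkx] [l _ Gly]]; exists (maxn k l) => //; split.
      - by move: x Fkx; exact/subsetPset/ndF/leq_maxl.
      - by move: y Gly; exact/subsetPset/ndG/leq_maxr.
    by move=> [k _ []/= ? ?]; split; exists k.
  move=> k; have [? ?] := Foo k; have [? ?] := Goo k.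
  split; first exact: measurableX.
  by rewrite product_measure1E// lte_mul_pinfty// ge0_fin_numE.
pose g (t : n.+1.-tuple R) : R * n.-tuple R :=
  (thead t, [tuple of behead t]).
have gK : cancel (@tcons n) g.
  by move=> [t u]; rewrite /g /tcons theadE /=; congr pair; exact/val_inj.
have mg : measurable_fun setT g.
  apply/measurable_fun_pairP; split; last exact: measurable_behead.
  exact: (@measurable_tnth _ R _ ord0).
exists (fun k => g @^-1` F k).
  by rewrite -preimage_bigcup -FT preimage_setT.
move=> k; have [mF Fk] := Ffin k; split.
  by rewrite -[X in measurable X]setTI; exact: mg.
rewrite /leb_cons /pushforward -comp_preimage.
suff -> : (g \o @tcons n) = id by rewrite preimage_id.
by apply/funext => z /=; exact: gK.
Qed.

HB.instance Definition _ n mu :=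
  Measure_isSigmaFinite.Build _ _ _ (@leb_cons n mu)
    (@leb_cons_sigma_finite n mu).

(* Lebesgue measure on R^n, with points in n.-tuple R. *)
Fixpoint leb n : {sigma_finite_measure set (n.-tuple R) -> \bar R} :=
  match n with
  | 0 => dirac [tuple]
  | m.+1 => leb_cons (leb m)
  end.

End lebesgue_tuple.

Section random_vectors.
Context {R : realType} {d : measure_display} {Omega : measurableType d}.
Variable P : probability Omega R.
Local Open Scope ereal_scope.

(* f is a density, with respect to mu, of the law of Z under P. *)
Definition has_pdf d' (T : measurableType d') (Z : Omega -> T)
    (mu : {measure set T -> \bar R}) (f : T -> R) :=
  forall A, measurable A -> P (Z @^-1` A) = \int[mu]_(z in A) (f z)%:E.

Definition independent_rv d1 d2 (T1 : measurableType d1)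
    (T2 : measurableType d2) (U : Omega -> T1) (V : Omega -> T2) :=
  forall A B, measurable A -> measurable B ->
    P (U @^-1` A `&` V @^-1` B) = P (U @^-1` A) * P (V @^-1` B).

End random_vectors.

Section densities.
Context {R : realType}.

Definition colv n (u : n.-tuple R) : 'cV[R]_n := \col_i tnth u i.

(* Density of N(m, S), for S symmetric positive definite. *)
Definition gauss_pdf n (m : 'cV[R]_n) (S : 'M[R]_n) (u : 'cV[R]_n) : R :=
  (Num.sqrt ((2 * pi) ^+ n * \det S))^-1 *
  expR (- (((u - m)^T *m invmx S *m (u - m)) ord0 ord0) / 2).

Definition Gamma (a : R) : R :=
  \int[lebesgue_measure]_(t in `]0, +oo[) (t `^ (a - 1) * expR (- t)).

Definition invgamma_pdf (a b g : R) : R :=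
  if 0 < g then (Gamma a)^-1 * b `^ a * g `^ (- a - 1) * expR (- (b / g))
  else 0.

End densities.

Section positive_semidefinite.
Context {R : realType}.

Definition psdmx n (A : 'M[R]_n) : Prop :=
  A^T = A /\ forall v : 'cV[R]_n, 0 <= (v^T *m A *m v) ord0 ord0.

Definition mxge n (A B : 'M[R]_n) : Prop := psdmx (A - B).

End positive_semidefinite.

(* Estimation of a parameter theta, some components of which are random.
   An estimation problem is given by the law P, the observations Y and the
   parameter theta, seen as a function on Omega; the deterministic components of
   theta are constant functions. *)
Section hybrid_information.
Context {R : realType} {d : measure_display} {Omega : measurableType d}.
Variables (P : probability Omega R) (N k : nat).
Variables (Y : Omega -> N.-tuple R) (theta : Omega -> 'cV[R]_k).

Definition hessian (f : 'cV[R]_k -> R) (t : 'cV[R]_k) : 'M[R]_k :=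
  \matrix_(i, j) 'D_(delta_mx i ord0) (fun s => 'D_(delta_mx j ord0) f s) t.

(* p y t is the joint density of the observations and the random components of
   the parameter, as a function of all the components of the parameter. *)
Variable p : 'cV[R]_N -> 'cV[R]_k -> R.

Definition hessian_log_pdf (w : Omega) : 'M[R]_k :=
  hessian (fun t => ln (p (colv (Y w)) t)) (theta w).

Definition information_exists : Prop :=
  forall i j, P.-integrable setT (EFin \o (fun w => hessian_log_pdf w i j)).

Definition information_matrix : 'M[R]_k :=
  \matrix_(i, j) - fine ('E_P[fun w => hessian_log_pdf w i j])%E.

Variable est : N.-tuple R -> 'cV[R]_k.

Definition error (i : 'I_k) (w : Omega) : R :=
  (theta w - est (Y w)) i ord0.

Definition mean_error_exists : Prop :=
  forall i, P.-integrable setT (EFin \o error i).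

(* E[theta] - E[est]: minus the bias of est.  The hybrid bound concerns estimators
   for which this mean does not depend on the deterministic parameters; this
   includes the unbiased ones, for which it is 0. *)
Definition mean_error : 'cV[R]_k := \col_i fine ('E_P[error i])%E.

Definition mse_exists : Prop :=
  forall i j, P.-integrable setT (EFin \o (fun w => error i w * error j w)).

Definition mse_matrix : 'M[R]_k :=
  \matrix_(i, j) fine ('E_P[fun w => (error i w * error j w)%R])%E.

End hybrid_information.

Section linear_model.
Context {R : realType} (N L : nat).

Definition param (x gam : 'cV[R]_L) (xi : R) : 'cV[R]_(L + L + 1) :=
  col_mx (col_mx x gam) (xi%:M : 'cV[R]_1).

Definition param_x (t : 'cV[R]_(L + L + 1)) : 'cV[R]_L := usubmx (usubmx t).
Definition param_gam (t : 'cV[R]_(L + L + 1)) : 'cV[R]_L := dsubmx (usubmx t).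
Definition param_xi (t : 'cV[R]_(L + L + 1)) : R := dsubmx t ord0 ord0.

Definition observation (Phi : 'M[R]_(N, L)) (x : L.-tuple R) (n : N.-tuple R) :
    N.-tuple R :=
  [tuple (Phi *m colv x + colv n) i ord0 | i < N].

Definition positive_vec (gam : 'cV[R]_L) : Prop := forall i, 0 < gam i ord0.

(* p(x | gamma) *)
Definition source_pdf (gam x : 'cV[R]_L) : R :=
  gauss_pdf 0 (diag_mx gam^T) x.

(* p(gamma) *)
Definition hyper_pdf (nu lam : R) (gam : 'cV[R]_L) : R :=
  \prod_(i < L) invgamma_pdf (nu / 2) (nu / (2 * lam)) (gam i ord0).

(* p(y, x; gamma, xi) = p(y | x; xi) p(x; gamma) *)
Definition joint_pdf_det (Phi : 'M[R]_(N, L)) (y : 'cV[R]_N)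
    (t : 'cV[R]_(L + L + 1)) : R :=
  gauss_pdf (Phi *m param_x t) (param_xi t)%:M y *
  source_pdf (param_gam t) (param_x t).

(* p(y, x, gamma; xi) = p(y | x; xi) p(x | gamma) p(gamma) *)
Definition joint_pdf_rand (nu lam : R) (Phi : 'M[R]_(N, L)) (y : 'cV[R]_N)
    (t : 'cV[R]_(L + L + 1)) : R :=
  gauss_pdf (Phi *m param_x t) (param_xi t)%:M y *
  source_pdf (param_gam t) (param_x t) *
  hyper_pdf nu lam (param_gam t).

Context {d : measure_display} {Omega : measurableType d}.
Variable P : probability Omega R.
Variables (x g : Omega -> L.-tuple R) (n : Omega -> N.-tuple R).

Definition noise_law (xi : R) : Prop :=
  has_pdf P n (leb N) (fun u => gauss_pdf 0 xi%:M (colv u)).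

Definition model_det (gam : 'cV[R]_L) (xi : R) : Prop :=
  [/\ noise_law xi,
      has_pdf P x (leb L) (fun u => source_pdf gam (colv u)) &
      independent_rv P n x].

(* The law of (x, gamma) is given by the joint density p(x | gamma) p(gamma). *)
Definition model_rand (nu lam xi : R) : Prop :=
  [/\ noise_law xi,
      has_pdf P (fun w => (x w, g w)) (leb L \x leb L)%E
        (fun z => source_pdf (colv z.2) (colv z.1) * hyper_pdf nu lam (colv z.2)) &
      independent_rv P n (fun w => (x w, g w))].

End linear_model.

(* Main.v *)
(** With s the gradient of log p(y, theta) in theta and e = theta - est(y), the bound
    follows by expanding E[(v.e + u.s)^2] >= 0 at u = H^-1 v, once it is known that
    E[e s^T] = -I and E[s s^T] = H.  These identities are proved one column j at a time.
    For a random component theta_j they are Stein identities: the joint density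
    restricted to a line in direction theta_j is Gaussian (for x_j) or inverse gamma
    (for gamma_j), and one integrates by parts on each line.  For a deterministic
    component they come from differentiating E[e] or E[s] in theta_j under the integral
    sign; this is where the mean error must not depend on the deterministic parameters.
    The same one-dimensional identities give the moments of 1/gamma and the bounds on
    fourth moments which put the scores in L^2. *)

(* The estimator is merely measurable with finite error moments, so it cannot be differentiated.
   Hence the lines in direction x_j or gamma_j are taken with y, not the noise, held fixed: [est y]
   is constant on each of them. The lines are glued by [slice_le], which compares integrals of
   nonnegative functions in \bar R and so yields moment bounds before finiteness is known. Both
   models share one log-density with coefficients c0, c1, c2; a fixed scale is treated as a random
   one whose reference measure is a Dirac mass. For a deterministic parameter, the error or the
   score is frozen at the true value while the law moves; its mean is then affine in the moved
   parameter, and the slope is the wanted entry. In model (b) the factor nu + 7 arises as follows: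
   the information on gamma_j is (c1 + 1) m2 + 2 c2 m3, where mk is the mean of gamma_j^-k, and c2
   m3 = (1/2 - c1) m2; the sum is (2 - c1) m2 with 2 - c1 = (nu + 7) / 2. *)
Require Import Defs.
From HB Require Import structures.
From mathcomp Require Import all_boot all_order all_algebra.
From mathcomp Require Import all_classical all_reals all_analysis.
From mathcomp Require Import measurable_realfun ring lra.

Set Implicit Arguments.
Unset Strict Implicit.
Unset Printing Implicit Defensive.

Import Order.TTheory GRing.Theory Num.Theory.
Import numFieldNormedType.Exports.

Local Open Scope classical_set_scope.
Local Open Scope ring_scope.


(** * Densities and one-dimensional slices of measures *)

Section density.
Context {R : realType} {d : measure_display} {Omega : measurableType d}.
Context {d' : measure_display} {T : measurableType d'}.
Variables (P : probability Omega R) (Z : Omega -> T).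
Variables (mu : {measure set T -> \bar R}) (f : T -> R).
Hypotheses (mZ : measurable_fun setT Z) (mf : measurable_fun setT f).
Hypotheses (f0 : forall z, 0 <= f z) (Zf : has_pdf P Z mu f).
Local Open Scope ereal_scope.

Import HBNNSimple.

(** First of three stages from [has_pdf], which speaks of sets, to integrals: simple functions,
    monotone limits, positive and negative parts. The weight f stays inside the integral, so that no
    measure with density f has to be built. *)
Lemma pdf_integral_nnsfun (h : {nnsfun T >-> R}) :
  \int[P]_w (h (Z w))%:E = \int[mu]_z ((h z)%:E * (f z)%:E).
Proof.
have mind (r : R) : measurable_fun setT ((\1_(h @^-1` [set r]) : T -> R) \o Z).
  by apply: measurableT_comp => //; exact: measurable_indic.
transitivity (\int[P]_w
    (\sum_(r \in range h) (r * \1_(h @^-1` [set r]) (Z w))%:E)).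
  by apply: eq_integral => w _; rewrite {1}fimfunE -fsumEFin.
rewrite ge0_integral_fsum//; last 2 first.
- by move=> r; apply/measurable_EFinP; apply: measurable_funM => //; exact: mind.
- by move=> r w _; rewrite nnfun_muleindic_ge0.
transitivity (\int[mu]_z
    (\sum_(r \in range h) ((r * \1_(h @^-1` [set r]) z)%:E * (f z)%:E))); last first.
  apply: eq_integral => z _; rewrite -ge0_mule_fsuml; last first.
    by move=> r; rewrite nnfun_muleindic_ge0.
  by rewrite fsumEFin// -fimfunE.
rewrite ge0_integral_fsum//; last 2 first.
- move=> r; apply: emeasurable_funM; last exact/measurable_EFinP.
  exact/measurable_EFinP/measurable_funM.
- by move=> r z _; rewrite mule_ge0 ?nnfun_muleindic_ge0 ?lee_fin.
apply: eq_fsbigr => r /[!inE] -[z _ rE].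
have r0 : (0 <= r)%R by rewrite -rE.
under eq_integral do rewrite EFinM.
rewrite ge0_integralZl//; last first.
  by apply/measurable_EFinP; exact: mind.
under [RHS]eq_integral do rewrite EFinM -muleA.
rewrite ge0_integralZl//; last 2 first.
- by apply: emeasurable_funM; exact/measurable_EFinP.
- by move=> u _; rewrite mule_ge0// lee_fin.
congr (_ * _).
have -> : \int[P]_w (\1_(h @^-1` [set r]) (Z w))%:E = P (Z @^-1` (h @^-1` [set r])).
  rewrite -[X in P X](setIT _) -integral_indic//.
  by rewrite -[X in measurable X]setTI; exact: mZ.
rewrite Zf//.
rewrite integral_mkcond; apply: eq_integral => u _.
by rewrite epatch_indic muleC.
Qed.

Lemma pdf_ge0_integral (F : T -> \bar R) : measurable_fun setT F ->
  (forall z, 0 <= F z) -> \int[P]_w F (Z w) = \int[mu]_z (F z * (f z)%:E).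
Proof.
move=> mF F0; pose h := nnsfun_approx measurableT mF.
have FE z : F z = limn (fun n => (h n z)%:E).
  by apply/esym/cvg_lim => //; exact: cvg_nnsfun_approx.
have -> : \int[P]_w F (Z w) = limn (fun n => \int[P]_w (h n (Z w))%:E).
  under eq_integral do rewrite FE.
  apply: monotone_convergence => //.
  - move=> n; apply/measurable_EFinP.
    exact: measurableT_comp.
  - by move=> n w _; rewrite lee_fin.
  - by move=> w _ a b ab; rewrite lee_fin; exact/lefP/nd_nnsfun_approx.
have -> : \int[mu]_z (F z * (f z)%:E) =
    limn (fun n => \int[mu]_z ((h n z)%:E * (f z)%:E)).
  transitivity (\int[mu]_z limn (fun n => (h n z)%:E * (f z)%:E)).
    apply: eq_integral => z _; apply/esym/cvg_lim => //.
    by apply: cvgeZr => //; exact: cvg_nnsfun_approx.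
  apply: monotone_convergence => //.
  - move=> n; apply: emeasurable_funM; exact/measurable_EFinP.
  - by move=> n z _; rewrite mule_ge0 ?lee_fin.
  - move=> z _ a b ab; rewrite lee_wpmul2r ?lee_fin//.
    exact/lefP/nd_nnsfun_approx.
by under eq_fun do rewrite pdf_integral_nnsfun.
Qed.

Lemma pdf_integrable (psi : T -> R) : measurable_fun setT psi ->
  P.-integrable setT (fun w => (psi (Z w))%:E) <->
  mu.-integrable setT (fun z => (psi z * f z)%:E).
Proof.
move=> mpsi.
have mpsiZ : measurable_fun setT (fun w => (psi (Z w))%:E).
  by apply/measurable_EFinP; exact: measurableT_comp.
have mpsif : measurable_fun setT (fun z => (psi z * f z)%:E).
  by apply/measurable_EFinP; exact: measurable_funM.
have mn : measurable_fun setT (fun z => `|(psi z)%:E|).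
  by apply: measurableT_comp => //; exact/measurable_EFinP.
have E : \int[P]_w `|(psi (Z w))%:E| = \int[mu]_z `|(psi z * f z)%:E|.
  rewrite (pdf_ge0_integral mn)//.
  by apply: eq_integral => z _; rewrite EFinM abseM (@gee0_abs _ (f z)%:E)// lee_fin.
split => /integrableP[_ h]; apply/integrableP; split => //.
  by rewrite -E.
by rewrite E.
Qed.

(** Positive and negative parts correspond separately, because multiplication by f >= 0 commutes
    with them; hence the equality holds in \bar R whether or not psi is integrable. *)
Lemma pdf_integral (psi : T -> R) : measurable_fun setT psi ->
  \int[P]_w (psi (Z w))%:E = \int[mu]_z (psi z * f z)%:E.
Proof.
move=> mpsi.
rewrite [LHS]integralE [RHS]integralE.
have mp : measurable_fun setT (fun z => (EFin \o psi)^\+ z).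
  by apply: measurable_funepos; exact/measurable_EFinP.
have mn : measurable_fun setT (fun z => (EFin \o psi)^\- z).
  by apply: measurable_funeneg; exact/measurable_EFinP.
congr (_ - _).
  transitivity (\int[P]_w ((EFin \o psi)^\+ (Z w))); first by apply: eq_integral => w _; rewrite ?funeposE ?funenegE.
  rewrite (pdf_ge0_integral mp)//; apply: eq_integral => z _.
  by rewrite !funeposE /= EFinM maxe_pMl ?lee_fin// mul0e.
transitivity (\int[P]_w ((EFin \o psi)^\- (Z w))); first by apply: eq_integral => w _; rewrite ?funeposE ?funenegE.
rewrite (pdf_ge0_integral mn)//; apply: eq_integral => z _.
by rewrite !funenegE EFinM -mulNe maxe_pMl ?lee_fin// mul0e.
Qed.

End density.

Section slices.
Context {R : realType}.
Local Open Scope ereal_scope.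

(** Stands in for a disintegration of mu along the coordinate moved by [upd]. The inequality form
    serves twice: directly for moment bounds, and in both directions for identities. Restricted to
    nonnegative functions, it passes through products by Tonelli without integrability
    conditions. *)
Definition slice_le d (T : measurableType d) (mu : {measure set T -> \bar R})
    (upd : T -> R -> T) :=
  forall F G : T -> \bar R,
    measurable_fun setT F -> measurable_fun setT G ->
    (forall u, 0 <= F u) -> (forall u, 0 <= G u) ->
    (forall u, \int[leb1]_t F (upd u t) <= \int[leb1]_t G (upd u t)) ->
    \int[mu]_u F u <= \int[mu]_u G u.

Lemma slice_le_eq d (T : measurableType d) (mu : {measure set T -> \bar R})
    (upd : T -> R -> T) (F G : T -> \bar R) : slice_le mu upd ->
  measurable_fun setT F -> measurable_fun setT G ->
  (forall u, 0 <= F u) -> (forall u, 0 <= G u) ->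
  (forall u, \int[leb1]_t F (upd u t) = \int[leb1]_t G (upd u t)) ->
  \int[mu]_u F u = \int[mu]_u G u.
Proof.
move=> sl mF mG F0 G0 FG; apply/eqP; rewrite eq_le.
by rewrite !sl// => u; rewrite FG.
Qed.

Lemma slice_le_prodl d1 d2 (T1 : measurableType d1) (T2 : measurableType d2)
    (m1 : {sigma_finite_measure set T1 -> \bar R})
    (m2 : {sigma_finite_measure set T2 -> \bar R}) (upd : T1 -> R -> T1) :
  slice_le m1 upd ->
  slice_le (m1 \x m2) (fun u t => (upd u.1 t, u.2)).
Proof.
move=> sl F G mF mG F0 G0 FG.
rewrite !fubini_tonelli2//; apply: ge0_le_integral => //.
- by move=> y _; exact: integral_ge0.
- exact: measurable_fun_fubini_tonelli_G.
- exact: measurable_fun_fubini_tonelli_G.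
move=> y _; apply: sl => //.
- exact: measurableT_comp.
- exact: measurableT_comp.
- by move=> x; exact: (FG (x, y)).
Qed.

Lemma slice_le_prodr d1 d2 (T1 : measurableType d1) (T2 : measurableType d2)
    (m1 : {sigma_finite_measure set T1 -> \bar R})
    (m2 : {sigma_finite_measure set T2 -> \bar R}) (upd : T2 -> R -> T2) :
  slice_le m2 upd ->
  slice_le (m1 \x m2) (fun u t => (u.1, upd u.2 t)).
Proof.
move=> sl F G mF mG F0 G0 FG.
rewrite !fubini_tonelli1//; apply: ge0_le_integral => //.
- by move=> y _; exact: integral_ge0.
- exact: measurable_fun_fubini_tonelli_F.
- exact: measurable_fun_fubini_tonelli_F.
move=> x _; apply: sl => //.
- exact: measurableT_comp.
- exact: measurableT_comp.
- by move=> y; exact: (FG (x, y)).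
Qed.

Definition tset n (j : 'I_n) (u : n.-tuple R) (t : R) : n.-tuple R :=
  [tuple if i == j then t else tnth u i | i < n].

Lemma tnth_tset n (j : 'I_n) u t i :
  tnth (tset j u t) i = if i == j then t else tnth u i.
Proof. by rewrite tnth_mktuple. Qed.

Lemma leb_consE n (F : n.+1.-tuple R -> \bar R) :
  measurable_fun setT F -> (forall u, 0 <= F u) ->
  \int[leb n.+1]_u F u = \int[leb1 \x leb n]_z F (tcons z).
Proof.
move=> mF F0.
by rewrite (@ge0_integral_pushforward _ _ _ _ _ _ (@measurable_tcons R n)).
Qed.

Lemma tset_tcons0 n (u : n.-tuple R) s t : tset ord0 (tcons (s, u)) t = tcons (t, u).
Proof.
apply: eq_from_tnth => i; rewrite tnth_tset.
case: (unliftP ord0 i) => [k ->|->]; last by rewrite eqxx !tnth0.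
by rewrite eq_sym (negbTE (neq_lift _ _)) !tnthS.
Qed.

Lemma tset_tconsS n (j : 'I_n) (u : n.-tuple R) s t :
  tset (lift ord0 j) (tcons (s, u)) t = tcons (s, tset j u t).
Proof.
apply: eq_from_tnth => i; rewrite tnth_tset.
case: (unliftP ord0 i) => [k ->|->]; last first.
  by rewrite (negbTE (neq_lift _ _)) !tnth0.
by rewrite (inj_eq lift_inj) !tnthS tnth_tset.
Qed.

(** Induction on n along the construction of [leb]: a line in a tail coordinate is a line in the
    second factor, and a line in the head coordinate is the whole first factor. *)
Lemma slice_le_leb n (j : 'I_n) : slice_le (leb n) (tset j).
Proof.
elim: n j => [[]//|n IH] j F G mF mG F0 G0 FG.
rewrite !leb_consE//.
have mtc := @measurable_tcons R n.
have mFt : measurable_fun setT (F \o @tcons R n) by exact: measurableT_comp.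
have mGt : measurable_fun setT (G \o @tcons R n) by exact: measurableT_comp.
case: (unliftP ord0 j) FG => [k ->|->] FG.
  refine (slice_le_prodr leb1 (IH k) mFt mGt (fun=> F0 _) (fun=> G0 _) _) => -[s u] /=.
  have := FG (tcons (s, u)).
  by under eq_integral do rewrite tset_tconsS;
    under [X in _ <= X -> _]eq_integral do rewrite tset_tconsS.
(* In dimension one every slice is the whole line, so the slice through any one point already gives
   the claim. *)
have sl1 : slice_le (@leb1 R) (fun _ t => t).
  by move=> F1 G1 _ _ _ _ /(_ point).
refine (slice_le_prodl (leb n) sl1 mFt mGt (fun=> F0 _) (fun=> G0 _) _) => -[s u] /=.
have := FG (tcons (s, u)).
by under eq_integral do rewrite tset_tcons0;
  under [X in _ <= X -> _]eq_integral do rewrite tset_tcons0.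
Qed.

End slices.

Section expectation_slices.
Context {R : realType} {d : measure_display} {Omega : measurableType d}.
Context {d' : measure_display} {T : measurableType d'}.
Variables (P : probability Omega R) (Z : Omega -> T).
Variables (mu : {measure set T -> \bar R}) (f : T -> R) (upd : T -> R -> T).
Hypotheses (mZ : measurable_fun setT Z) (mf : measurable_fun setT f).
Hypotheses (f0 : forall z, 0 <= f z) (Zf : has_pdf P Z mu f).
Hypothesis sl : slice_le mu upd.
Local Open Scope ereal_scope.

(** Turns a moment inequality on every line into one between expectations, with phi not known to be
    integrable: integrability of psi then gives that of phi. *)
Lemma expectation_slice_le (phi psi : T -> R) :
  measurable_fun setT phi -> measurable_fun setT psi ->
  (forall z, 0 <= phi z)%R -> (forall z, 0 <= psi z)%R ->
  (forall u, \int[leb1]_t (phi (upd u t) * f (upd u t))%:E <=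
             \int[leb1]_t (psi (upd u t) * f (upd u t))%:E) ->
  \int[P]_w (phi (Z w))%:E <= \int[P]_w (psi (Z w))%:E.
Proof.
move=> mphi mpsi phi0 psi0 h.
rewrite !(pdf_integral mZ mf f0 Zf)//; apply: sl => //.
- exact/measurable_EFinP/measurable_funM.
- exact/measurable_EFinP/measurable_funM.
- by move=> u; rewrite lee_fin mulr_ge0.
- by move=> u; rewrite lee_fin mulr_ge0.
Qed.

(* In \bar R, +oo - +oo = -oo, so that a null slice integral forces the positive
   and negative parts to have equal finite integrals. *)
Lemma expectation_slice0 (psi : T -> R) : measurable_fun setT psi ->
  P.-integrable setT (fun w => (psi (Z w))%:E) ->
  (forall u, \int[leb1]_t (psi (upd u t) * f (upd u t))%:E = 0) ->
  \int[P]_w (psi (Z w))%:E = 0.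
Proof.
move=> mpsi /(pdf_integrable mZ mf f0 Zf mpsi) ipsi h.
rewrite (pdf_integral mZ mf f0 Zf)//.
set F := fun z => (psi z * f z)%:E.
have mF : measurable_fun setT F by exact/measurable_EFinP/measurable_funM.
rewrite integralE.
suff -> : \int[mu]_x F^\+ x = \int[mu]_x F^\- x.
  rewrite subee//; apply: integral_fune_fin_num => //; exact: integrable_funeneg.
apply: (slice_le_eq sl) => //.
- exact: measurable_funepos.
- exact: measurable_funeneg.
move=> u; have := h u; rewrite -/(F _) integralE.
have -> : \int[leb1]_t (fun t => F (upd u t))^\+ t = \int[leb1]_t F^\+ (upd u t).
  by apply: eq_integral => t _; rewrite !funeposE.
have -> : \int[leb1]_t (fun t => F (upd u t))^\- t = \int[leb1]_t F^\- (upd u t).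
  by apply: eq_integral => t _; rewrite !funenegE.
have p0 : 0 <= \int[leb1]_t F^\+ (upd u t) by exact: integral_ge0.
have n0 : 0 <= \int[leb1]_t F^\- (upd u t) by exact: integral_ge0.
move: (\int[leb1]_t F^\+ (upd u t)) (\int[leb1]_t F^\- (upd u t)) p0 n0.
move=> [a| |] [b| |] //= _ _; rewrite -EFinB => -[] /eqP.
by rewrite subr_eq0 => /eqP ->.
Qed.

End expectation_slices.

(** * Translation invariance, and the laws of independent and of shifted vectors *)

Section translation.
Context {R : realType}.
Local Open Scope ereal_scope.

Lemma lebesgue_measure_shift (c : R) (A : set (measurableTypeR R)) : measurable A ->
  pushforward (@lebesgue_measure R) ((+%R)^~ c : _ -> measurableTypeR R) A =
  lebesgue_measure A.
Proof.
move=> mA; apply/esym/lebesgue_measure_unique => //=.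
  exact: measurable_funD.
move=> mc _ [[a b]] _ <-.
rewrite /pushforward /= (_ : _ @^-1` _ = `](a - c)%R, (b - c)%R]%classic); last first.
  by apply/seteqP; split => t /=; rewrite !in_itv/= ltrBlDr lerBrDr.
rewrite !lebesgue_measure_itv/= !lte_fin ltrD2r; case: ifP => // _.
by rewrite -!EFinB opprD opprK addrACA addNr addr0.
Qed.

Lemma leb1_shift (c : R) (F : R -> \bar R) : measurable_fun setT F ->
  (forall t, 0 <= F t) -> \int[leb1]_t F (t + c)%R = \int[leb1]_t F t.
Proof.
move=> mF F0.
have mc : measurable_fun setT ((+%R)^~ c : R -> R) by exact: measurable_funD.
have := @ge0_integral_pushforward _ _ _ _ _ _ mc (@leb1 R) setT F measurableT mF (fun y _ => F0 y).
rewrite preimage_setT => <-.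
apply: eq_measure_integral => A mA _.
exact: lebesgue_measure_shift.
Qed.

Definition tadd n (u v : n.-tuple R) : n.-tuple R :=
  [tuple (tnth u i + tnth v i)%R | i < n].

Definition tsub n (u v : n.-tuple R) : n.-tuple R :=
  [tuple (tnth u i - tnth v i)%R | i < n].

Lemma taddK n (v u : n.-tuple R) : tsub (tadd u v) v = u.
Proof. by apply: eq_from_tnth => i; rewrite !tnth_mktuple addrK. Qed.

Lemma measurable_tadd d (T : measurableType d) n (f g : T -> n.-tuple R) :
  measurable_fun setT f -> measurable_fun setT g ->
  measurable_fun setT (fun x => tadd (f x) (g x)).
Proof.
move=> /measurable_fun_tnthP mf /measurable_fun_tnthP mg.
apply/measurable_fun_tnthP => i.
rewrite (_ : _ \o _ = fun x => (tnth (f x) i + tnth (g x) i)%R).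
  exact: measurable_funD (mf i) (mg i).
by apply/funext => x /=; rewrite tnth_mktuple.
Qed.

Lemma measurable_tsub d (T : measurableType d) n (f g : T -> n.-tuple R) :
  measurable_fun setT f -> measurable_fun setT g ->
  measurable_fun setT (fun x => tsub (f x) (g x)).
Proof.
move=> /measurable_fun_tnthP mf /measurable_fun_tnthP mg.
apply/measurable_fun_tnthP => i.
rewrite (_ : _ \o _ = fun x => (tnth (f x) i - tnth (g x) i)%R).
  exact: measurable_funB (mf i) (mg i).
by apply/funext => x /=; rewrite tnth_mktuple.
Qed.

Lemma tadd_tcons n (c : n.+1.-tuple R) s (u : n.-tuple R) :
  tadd (tcons (s, u)) c = tcons ((s + thead c)%R, tadd u [tuple of behead c]).
Proof.
apply: eq_from_tnth => i; rewrite tnth_mktuple.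
case: (unliftP ord0 i) => [k ->|->].
  rewrite !tnthS tnth_mktuple; congr (_ + _)%R.
  by rewrite !(tnth_nth 0%R) /= nth_behead.
by rewrite !tnth0.
Qed.

Lemma leb_shift n (c : n.-tuple R) (F : n.-tuple R -> \bar R) :
  measurable_fun setT F -> (forall u, 0 <= F u) ->
  \int[leb n]_u F (tadd u c) = \int[leb n]_u F u.
Proof.
elim: n c F => [|n IH] c F mF F0.
  by apply: eq_integral => u _; rewrite (tuple0 (tadd u c)) (tuple0 u).
have mFc : measurable_fun setT (fun u => F (tadd u c)).
  by apply: measurableT_comp => //; exact: measurable_tadd.
rewrite !leb_consE//.
have mtc := @measurable_tcons R n.
rewrite (fubini_tonelli1 (fun z => F (tadd (tcons z) c)))//; last exact: measurableT_comp mFc mtc.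
rewrite (fubini_tonelli1 (fun z => F (tcons z)))//; last exact: measurableT_comp mF mtc.
have mFt : measurable_fun setT (F \o @tcons R n) by exact: measurableT_comp.
rewrite /fubini_F.
transitivity (\int[leb1]_s (fubini_F (leb n) (F \o @tcons R n)) (s + thead c)%R).
  apply: eq_integral => s _; rewrite /fubini_F.
  under eq_integral do rewrite tadd_tcons.
  rewrite (IH [tuple of behead c] (fun u => F (tcons (s + thead c, u)%R)))//.
  exact: (measurableT_comp mFt (pair1_measurable (s + thead c)%R)).
rewrite leb1_shift//; first by apply: measurable_fun_fubini_tonelli_F => // z; exact: F0.
by move=> t; apply: integral_ge0 => u _; exact: F0.
Qed.

End translation.

Section law.
Context {R : realType} {d : measure_display} {Omega : measurableType d}.
Variable P : probability Omega R.
Local Open Scope ereal_scope.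

(** Independence identifies the joint law with the product of the marginal laws, by uniqueness of
    the product measure. Its value on A is computed by sections, which allows the two densities to
    be inserted one after the other. *)
Lemma has_pdf_pair d1 d2 (T1 : measurableType d1) (T2 : measurableType d2)
    (U : {mfun Omega >-> T1}) (V : {mfun Omega >-> T2})
    (m1 : {sigma_finite_measure set T1 -> \bar R})
    (m2 : {sigma_finite_measure set T2 -> \bar R}) (f1 : T1 -> R) (f2 : T2 -> R) :
  measurable_fun setT f1 -> measurable_fun setT f2 ->
  (forall u, 0 <= f1 u)%R -> (forall v, 0 <= f2 v)%R ->
  has_pdf P U m1 f1 -> has_pdf P V m2 f2 -> independent_rv P U V ->
  has_pdf P (fun w => (U w, V w)) (m1 \x m2) (fun z => f1 z.1 * f2 z.2)%R.
Proof.
move=> mf1 mf2 f10 f20 hU hV indep A mA.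
have mUV : measurable_fun setT (fun w => (U w, V w)) by exact: measurable_fun_pair.
pose UV : {mfun Omega >-> (T1 * T2)%type} :=
  HB.pack (fun w => (U w, V w)) (isMeasurableFun.Build _ _ _ _ _ mUV).
have UVE := product_measure_unique (m1 := distribution P U) (m2 := distribution P V)
  (m' := distribution P UV) indep mA.
rewrite [LHS](_ : _ = distribution P UV A)// -UVE.
transitivity (\int[distribution P U]_u (distribution P V \o xsection A) u); first by [].
have mx : measurable_fun setT (fun u => distribution P V (xsection A u)).
  exact: measurable_fun_xsection.
rewrite ge0_integral_pushforward// preimage_setT/=.
rewrite (pdf_ge0_integral _ mf1 f10 hU mx)//.
have mff : measurable_fun setT (fun z : T1 * T2 => ((f1 z.1 * f2 z.2)%:E : \bar R)).
  apply/measurable_EFinP; apply: measurable_funM.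
    exact: (measurableT_comp mf1).
  exact: (measurableT_comp mf2).
rewrite [RHS]integral_mkcond fubini_tonelli1//; last 2 first.
- by apply/(measurable_restrictT _ _).1 => //; exact: measurable_funTS.
- by move=> z; rewrite erestrict_ge0// => ? _; rewrite lee_fin mulr_ge0.
apply: eq_integral => u _; rewrite /fubini_F.
transitivity (\int[m2]_(v in xsection A u) ((f1 u)%:E * (f2 v)%:E)).
  rewrite ge0_integralZl//.
  - by rewrite muleC; congr (_ * _); rewrite -hV//; exact: measurable_xsection.
  - exact: measurable_xsection.
  - by apply/measurable_EFinP; exact: measurable_funTS.
  - by move=> v _; rewrite lee_fin.
  - by rewrite lee_fin.
rewrite [LHS]integral_mkcond; apply: eq_integral => v _.
by rewrite /patch /= mem_xsection EFinM.
Qed.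

(** The change of variables (u, v) to (u + tau v, v) has unit Jacobian: with v fixed it is a
    translation of R^n. The first factor is therefore integrated innermost. It is used to pass from
    the noise to the observation. *)
Lemma has_pdf_shift d2 (T2 : measurableType d2) n (U : Omega -> n.-tuple R)
    (V : Omega -> T2) (m2 : {sigma_finite_measure set T2 -> \bar R})
    (f1 : n.-tuple R -> R) (f2 : T2 -> R) (tau : T2 -> n.-tuple R) :
  measurable_fun setT U -> measurable_fun setT V ->
  measurable_fun setT f1 -> measurable_fun setT f2 -> measurable_fun setT tau ->
  (forall u, 0 <= f1 u)%R -> (forall v, 0 <= f2 v)%R ->
  has_pdf P (fun w => (U w, V w)) (leb n \x m2) (fun z => f1 z.1 * f2 z.2)%R ->
  has_pdf P (fun w => (tadd (U w) (tau (V w)), V w)) (leb n \x m2)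
    (fun z => f1 (tsub z.1 (tau z.2)) * f2 z.2)%R.
Proof.
move=> mU mV mf1 mf2 mtau f10 f20 hUV A mA.
have mUV : measurable_fun setT (fun w => (U w, V w)) by exact: measurable_fun_pair.
pose h (z : n.-tuple R * T2) := (tadd z.1 (tau z.2), z.2).
have mtau2 : measurable_fun setT (fun z : n.-tuple R * T2 => tau z.2).
  exact: (measurableT_comp mtau).
have mh : measurable_fun setT h.
  by apply: measurable_fun_pair => //; exact: measurable_tadd.
have mf1z : measurable_fun setT (fun z : n.-tuple R * T2 => f1 z.1).
  exact: (measurableT_comp mf1).
have mf2z : measurable_fun setT (fun z : n.-tuple R * T2 => f2 z.2).
  exact: (measurableT_comp mf2).
have mf1s : measurable_fun setT (fun z : n.-tuple R * T2 => f1 (tsub z.1 (tau z.2))).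
  by apply: (measurableT_comp mf1); exact: measurable_tsub.
have mhA : measurable (h @^-1` A) by rewrite -[X in measurable X]setTI; exact: mh.
have -> : (fun w => (tadd (U w) (tau (V w)), V w)) @^-1` A =
    (fun w => (U w, V w)) @^-1` (h @^-1` A) by [].
rewrite hUV// integral_mkcond [RHS]integral_mkcond.
have ge (g : n.-tuple R * T2 -> R) B z : (forall z, 0 <= g z)%R ->
    0 <= ((EFin \o g) \_ B) z.
  by move=> g0; rewrite erestrict_ge0// => ? _; rewrite lee_fin.
have me (g : n.-tuple R * T2 -> R) B : measurable B -> measurable_fun setT g ->
    measurable_fun setT ((EFin \o g) \_ B).
  move=> mB mg; apply/(measurable_restrictT _ _).1 => //; apply: measurable_funTS.
  exact/measurable_EFinP.
have m1 := me _ _ mhA (measurable_funM mf1z mf2z).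
have m2' := me _ _ mA (measurable_funM mf1s mf2z).
rewrite [LHS]fubini_tonelli2; [|exact: m1|by move=> z; apply: ge => ?; rewrite mulr_ge0].
rewrite [RHS]fubini_tonelli2; [|exact: m2'|by move=> z; apply: ge => ?; rewrite mulr_ge0].
apply: eq_integral => v _; rewrite /fubini_G.
rewrite -[RHS](leb_shift (tau v)).
- apply: eq_integral => u _; by rewrite /patch /= taddK.
- exact: (measurableT_comp m2' (pair2_measurable v)).
- by move=> u; apply: ge => ?; rewrite mulr_ge0.
Qed.

End law.

(** * Integration by parts on the line *)

Section measurability.
Context {R : realType}.

Lemma measurable_inv : measurable_fun setT (fun t : R => t^-1).
Proof.
(* The factor t also produces the default value 0 of the inverse at t = 0. *)
rewrite (_ : (fun _ => _) = (fun t : R => t * expR (- ln (t ^+ 2)))).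
  by apply: measurable_funM => //; apply: measurableT_comp => //;
    apply: measurableT_comp => //; apply: measurableT_comp => //; exact: measurable_funX.
apply/funext => t; have [->|t0] := eqVneq t 0; first by rewrite invr0 mul0r.
by rewrite expRN lnK ?posrE ?exprn_even_gt0// expr2 invfM mulVKf.
Qed.

Lemma measurable_funV d (T : measurableType d) (f : T -> R) :
  measurable_fun setT f -> measurable_fun setT (fun u => (f u)^-1).
Proof. exact: measurableT_comp measurable_inv. Qed.

End measurability.

(* The two measures live on convertible sigma-algebras with distinct displays, so
   that their integrals are not convertible. *)
Lemma ge0_integral_leb1 (R : realType) (f : R -> \bar R) : measurable_fun setT f ->
  (forall t, 0 <= f t)%E ->
  (\int[leb1]_t f t = \int[@lebesgue_measure R]_t f t)%E.
Proof.
move=> mf f0.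
have mid : measurable_fun [set: measurableTypeR R] (id : measurableTypeR R -> R).
  by move=> _ A mA; rewrite setTI.
have := @ge0_integral_pushforward _ _ _ _ _ _ mid (@lebesgue_measure R) setT f measurableT mf (fun y _ => f0 y).
rewrite preimage_setT => <-.
by apply: eq_measure_integral.
Qed.

Lemma integral_leb1 (R : realType) (f : R -> \bar R) : measurable_fun setT f ->
  (\int[leb1]_t f t = \int[@lebesgue_measure R]_t f t)%E.
Proof.
move=> mf; rewrite [LHS]integralE [RHS]integralE !ge0_integral_leb1//.
- exact: measurable_funeneg.
- exact: measurable_funepos.
Qed.

Section derivation_rules.
Context {R : realType} {V : normedModType R}.
Implicit Types (f g : V -> R) (t v : V) (df dg : R).

(** Reduces a directional derivative on V to an ordinary derivative at 0 in one real variable; the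
    chain rule [is_derive_comp1] and the derivatives of linear maps come from it. *)
Lemma is_derive_line f t v df :
  is_derive (0 : R) 1 (fun h : R => f (h *: v + t)) df <-> is_derive t v f df.
Proof.
have E : (fun h : R => h^-1 *: (((fun h : R => f (h *: v + t)) \o shift 0) (h *: 1) - f (0 *: v + t))) =
    (fun h : R => h^-1 *: ((f \o shift t) (h *: v) - f t)).
  by apply/funext => h; rewrite /= scale0r add0r addr0 -[h%:A]/(h * 1) mulr1.
by split => -[d1 d2]; split; move: d1 d2; rewrite /derivable /derive E.
Qed.

Lemma is_derive_funD f g t v df dg : is_derive t v f df -> is_derive t v g dg ->
  is_derive t v (fun s => f s + g s) (df + dg).
Proof. exact: is_deriveD. Qed.

Lemma is_derive_funB f g t v df dg : is_derive t v f df -> is_derive t v g dg ->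
  is_derive t v (fun s => f s - g s) (df - dg).
Proof. exact: is_deriveB. Qed.

Lemma is_derive_funN f t v df : is_derive t v f df ->
  is_derive t v (fun s => - f s) (- df).
Proof. exact: is_deriveN. Qed.

Lemma is_derive_funM f g t v df dg : is_derive t v f df -> is_derive t v g dg ->
  is_derive t v (fun s => f s * g s) (f t * dg + g t * df).
Proof. exact: is_deriveM. Qed.

Lemma is_derive_funZ (c : R) f t v df : is_derive t v f df ->
  is_derive t v (fun s => c * f s) (c * df).
Proof. exact: is_deriveZ. Qed.

Lemma is_derive_funX f n t v df : is_derive t v f df ->
  is_derive t v (fun s => f s ^+ n) (n%:R * f t ^+ n.-1 * df).
Proof.
move=> Df; rewrite (_ : (fun _ => _) = f ^+ n); first exact: is_deriveX.
by apply/funext => s; rewrite exprfctE.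
Qed.

Lemma is_derive_funV f t v df : f t != 0 -> is_derive t v f df ->
  is_derive t v (fun s => (f s)^-1) (- df / f t ^+ 2).
Proof.
move=> f0 [fd <-]; split; first exact: derivableV.
by rewrite deriveV// /GRing.scale/= !mulNr mulrC.
Qed.

Lemma is_derive_comp1 (h : R -> R) f t v dh df :
  is_derive (f t) 1 h dh -> is_derive t v f df ->
  is_derive t v (fun s => h (f s)) (dh * df).
Proof.
move=> Dh /is_derive_line Df; apply/is_derive_line.
apply: (@is_derive1_comp _ h (fun r => f (r *: v + t))).
by rewrite scale0r add0r.
Qed.

Lemma is_derive_funln f t v df : 0 < f t -> is_derive t v f df ->
  is_derive t v (fun s => ln (f s)) (df / f t).
Proof.
by move=> f0 Df; rewrite mulrC; apply: is_derive_comp1 => //; exact: is_derive1_ln.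
Qed.

Lemma is_derive_funexp f t v df : is_derive t v f df ->
  is_derive t v (fun s => expR (f s)) (expR (f t) * df).
Proof. exact: is_derive_comp1. Qed.

Lemma is_derive_funsum n (f : 'I_n -> V -> R) t v (df : 'I_n -> R) :
  (forall i, is_derive t v (f i) (df i)) ->
  is_derive t v (fun s => \sum_(i < n) f i s) (\sum_(i < n) df i).
Proof.
move=> Df; rewrite (_ : (fun _ => _) = \sum_(i < n) f i); first exact: is_derive_sum.
by apply/funext => s; rewrite fct_sumE.
Qed.

Lemma is_derive_fun_linear f t v : (forall (a : R) u w, f (a *: u + w) = a * f u + f w) ->
  is_derive t v f (f v).
Proof.
move=> lf; apply/is_derive_line.
rewrite (_ : (fun _ => _) = (fun h : R => h * f v + f t)); last first.
  by apply/funext => h; rewrite lf.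
have := is_deriveD (is_deriveM (is_derive_id (0 : R) 1) (is_derive_cst (f v) (0 : R) 1)) (is_derive_cst (f t) (0 : R) 1).
by rewrite scaler0 add0r addr0 /GRing.scale/= mulr1.
Qed.

End derivation_rules.

Lemma is_derive_continuous (R : realType) (f : R -> R) (t df : R) :
  is_derive t 1 f df -> {for t, continuous f}.
Proof. by case=> df1 _; apply/differentiable_continuous/derivable1_diffP. Qed.

Section ftc_limit.
Context {R : realType}.
Local Notation mu := (@lebesgue_measure R).

(** The fundamental theorem of calculus on [[a n, b n]], which exhausts D, then dominated
    convergence with the integrable |f| as bound; the boundary terms are O(1/n). D is the line for
    Gaussian weights and the open half-line for inverse gamma weights, where the endpoints tend to 0
    and to infinity. *)
Lemma integral_derive0 (D : set R) (F f : R -> R) (a b : nat -> R) (M : R) :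
  measurable D -> (forall n, a n < b n) -> (forall n, `[a n, b n] `<=` D) ->
  (forall t, D t -> \forall n \near \oo, t \in `[a n, b n]) ->
  (forall t, D t -> is_derive t 1 F (f t)) -> (forall t, D t -> {for t, continuous f}) ->
  mu.-integrable D (EFin \o f) ->
  (forall n, `|F (a n)| <= M / n.+1%:R) -> (forall n, `|F (b n)| <= M / n.+1%:R) ->
  (\int[mu]_(t in D) (f t)%:E = 0)%E.
Proof.
move=> mD ab abD Dab dF cf iF Fa Fb.
pose g n := fun t => ((f t)%:E * (\1_(`[a n, b n]%classic) t)%:E)%E.
have mf : measurable_fun D (EFin \o f) by case/integrableP : iF.
have intg n : (\int[mu]_(t in D) g n t = (F (b n) - F (a n))%:E)%E.
  transitivity (\int[mu]_(t in `[a n, b n]) (f t)%:E)%E.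
    rewrite integral_mkcond [RHS]integral_mkcond; apply: eq_integral => t _.
    rewrite /g /patch indicE; case: ifPn => [_|].
      by case: ifPn; rewrite ?mule1 ?mule0.
    rewrite notin_setE => nD; rewrite memNset// => tab.
    exact/nD/(abD n).
  rewrite (@continuous_FTC2 _ f F)//.
  - apply: continuous_in_subspaceT => t /[!inE] /abD; exact: cf.
  - have cF t : D t -> {for t, continuous F}.
      by move=> Dt; apply/differentiable_continuous/derivable1_diffP; case: (dF t Dt).
    split.
    + move=> t /subset_itv_oo_cc tab; have [|//] := dF t; exact: (abD n).
    + apply: cvg_at_right_filter; apply: cF; apply: (abD n).
      by rewrite /= in_itv/= lexx ltW.
    + apply: cvg_at_left_filter; apply: cF; apply: (abD n).
      by rewrite /= in_itv/= lexx ltW.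
  - move=> t /subset_itv_oo_cc tab; rewrite derive1E.
    by have /dF[] := abD n t tab.
have mg n : measurable_fun D (g n).
  apply: emeasurable_funM => //; apply/measurable_EFinP.
  exact: measurable_indic.
have lim0 : (fun n => F (b n) - F (a n)) @ \oo --> (0 : R).
  have h0 : (fun n => (M + M) * harmonic n) @ \oo --> (0 : R).
    rewrite -(mulr0 (M + M)); apply: cvgMr; exact: cvg_harmonic.
  apply: norm_cvg0; apply: (squeeze_cvgr _ (cvg_cst 0) h0).
  near=> n; rewrite normr_ge0 /= (le_trans (ler_normB _ _))// mulrDl lerD//.
have : ((fun n => \int[mu]_(t in D) g n t) @ \oo --> \int[mu]_(t in D) (f t)%:E)%E.
  apply: (fun h1 h2 h3 => let: And3 _ _ h := @dominated_convergence _ _ _ mu D mD g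
    (EFin \o f) (abse \o (EFin \o f)) mg mf h1 h2 h3 in h).
  - apply: aeW => t Dt; apply: cvg_near_cst.
    near=> n; rewrite /g indicE mem_set ?mule1//.
    by near: n; exact: Dab.
  - exact: integrable_abse.
  - apply: aeW => t n Dt; rewrite /g abseM -[leRHS]mule1.
    by rewrite lee_wpmul2l// indicE; case: (_ \in _); rewrite /= ?normr1 ?normr0.
under eq_fun do rewrite intg.
move=> /cvg_lim <-//; apply/cvg_lim => //.
by apply: cvg_EFin; [exact: nearW|exact: lim0].
Unshelve. all: by end_near. Qed.

End ftc_limit.

(** * Polynomials against Gaussian weights *)

Section polynomial_functions.
Context {R : realType}.
Local Notation mu := (@lebesgue_measure R).

(** Membership is a closure property of functions, with no degree or coefficients to track:
    derivatives, continuity and growth bounds follow by induction, and the entries of the score on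
    an x_j-line are recognised by their shape. *)
Inductive polyfun : (R -> R) -> Prop :=
| polyfun_cst c : polyfun (fun=> c)
| polyfun_id : polyfun (fun t => t)
| polyfunD f g : polyfun f -> polyfun g -> polyfun (fun t => f t + g t)
| polyfunM f g : polyfun f -> polyfun g -> polyfun (fun t => f t * g t).

Lemma polyfunN f : polyfun f -> polyfun (fun t => - f t).
Proof.
move=> pf; rewrite (_ : (fun _ => _) = (fun t => -1 * f t)).
  by apply: polyfunM => //; exact: polyfun_cst.
by apply/funext => t; rewrite mulN1r.
Qed.

Lemma polyfunB f g : polyfun f -> polyfun g -> polyfun (fun t => f t - g t).
Proof. by move=> pf pg; apply: polyfunD => //; exact: polyfunN. Qed.

Lemma polyfunX f n : polyfun f -> polyfun (fun t => f t ^+ n).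
Proof.
move=> pf; elim: n => [|n IH]; first exact: polyfun_cst.
by under eq_fun do rewrite exprS; exact: polyfunM.
Qed.

Lemma polyfun_sum I (r : seq I) (f : I -> R -> R) : (forall i, polyfun (f i)) ->
  polyfun (fun t => \sum_(i <- r) f i t).
Proof.
move=> pf; elim: r => [|i r IH].
  by under eq_fun do rewrite big_nil; exact: polyfun_cst.
by under eq_fun do rewrite big_cons; exact: polyfunD.
Qed.

Lemma polyfun_derive f : polyfun f ->
  exists2 df, polyfun df & forall t : R, is_derive t 1 f (df t).
Proof.
elim=> [c||g h _ [dg pdg Dg] _ [dh pdh Dh]|g h pg [dg pdg Dg] ph [dh pdh Dh]].
- by exists (fun=> 0) => [|t]; [exact: polyfun_cst|exact: is_derive_cst].
- by exists (fun=> 1) => [|t]; [exact: polyfun_cst|exact: is_derive_id].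
- exists (fun t => dg t + dh t) => [|t]; first exact: polyfunD.
  exact: is_deriveD.
- exists (fun t => g t *: dh t + h t *: dg t) => [|t].
    by apply: polyfunD; apply: polyfunM.
  exact: is_deriveM.
Qed.

Lemma polyfun_continuous f : polyfun f -> continuous f.
Proof.
move=> /polyfun_derive[df _ Df] t.
by apply/differentiable_continuous/derivable1_diffP; case: (Df t).
Qed.

(** Quantifying over every c > 0 inside the induction is what lets a product give half of c to each
    factor. *)
Lemma polyfun_bound f (c : R) : polyfun f -> 0 < c ->
  exists2 C, 0 <= C & forall t, `|f t| <= C * expR (c * t ^+ 2).
Proof.
move=> pf; elim: pf c => [a||g h _ IHg _ IHh|g h _ IHg _ IHh] c c0.
- exists `|a| => // t; rewrite ler_peMr//.
  by rewrite -expR0 ler_expR mulr_ge0 ?sqr_ge0// ltW.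
(* |t| is at most 1 + t^2, and both 1 and c t^2 are at most exp(c t^2). *)
- exists (1 + c^-1) => [|t]; first by rewrite addr_ge0// invr_ge0 ltW.
  have h1 : 1 + c * t ^+ 2 <= expR (c * t ^+ 2) by exact: expR_ge1Dx.
  have h2 : `|t| <= 1 + t ^+ 2.
    rewrite -[t ^+ 2]real_normK ?num_real//.
    have [t1|/ltW t1] := leP `|t| 1; first by rewrite (le_trans t1)// lerDl sqr_ge0.
    by rewrite (@le_trans _ _ (`|t| ^+ 2)) ?lerDr// expr2 ler_peMl.
  rewrite (le_trans h2)// mulrDl mul1r lerD//.
    by rewrite (le_trans _ h1)// lerDl mulr_ge0 ?sqr_ge0// ltW.
  rewrite mulrC ler_pdivlMr// mulrC (le_trans _ h1)// lerDr//.
- have [Cg Cg0 Hg] := IHg c c0; have [Ch Ch0 Hh] := IHh c c0.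
  exists (Cg + Ch) => [|t]; first exact: addr_ge0.
  by rewrite mulrDl (le_trans (ler_normD _ _))// lerD.
- have c2 : 0 < c / 2 by rewrite divr_gt0.
  have [Cg Cg0 Hg] := IHg _ c2; have [Ch Ch0 Hh] := IHh _ c2.
  exists (Cg * Ch) => [|t]; first exact: mulr_ge0.
  rewrite normrM (_ : _ * expR _ = (Cg * expR (c / 2 * t ^+ 2)) * (Ch * expR (c / 2 * t ^+ 2))).
    by rewrite ler_pM.
  by rewrite mulrACA -expRD -mulrDl -splitr.
Qed.

Lemma integrable_expR_sqr (c : R) : 0 < c ->
  mu.-integrable setT (EFin \o (fun t => expR (- (c * t ^+ 2)))).
Proof.
(* The standard deviation for which 1 / (2 s^2) = c: up to its peak value the function is a normal
   density. *)
move=> c0; pose s := Num.sqrt (2 * c)^-1.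
have c20 : 0 < (2 * c)^-1 by rewrite invr_gt0 mulr_gt0.
have s0 : s != 0 by rewrite gt_eqF// sqrtr_gt0.
have := integrableZl measurableT (normal_peak s)^-1 (integrable_normal_pdf 0 s).
apply: eq_integrable => // t _ /=; rewrite normal_pdfE// -EFinM; congr EFin.
rewrite mulKf ?gt_eqF ?normal_peak_gt0// /normal_fun subr0; congr expR.
have -> : (s ^+ 2 *+ 2)^-1 = c.
  by rewrite sqr_sqrtr ?(ltW c20)// -mulr_natl invfM invrK mulKf.
by rewrite mulNr mulrC.
Qed.

Variables (Q dQ : R -> R) (c K : R).
Hypotheses (pQ : polyfun Q) (c0 : 0 < c) (Qc : forall t, c * t ^+ 2 <= Q t + K).

(** Half of the coercivity constant c absorbs the polynomial and the other half remains as Gaussian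
    decay; the offset K goes into the constant. *)
Lemma polyfun_gauss_bound f : polyfun f ->
  exists2 C, 0 <= C & forall t, `|f t * expR (- Q t)| <= C * expR (- (c / 2 * t ^+ 2)).
Proof.
move=> pf; have c2 : 0 < c / 2 by rewrite divr_gt0.
have [C C0 HC] := polyfun_bound pf c2.
exists (C * expR K) => [|t]; first by rewrite mulr_ge0 ?expR_ge0.
rewrite normrM (ger0_norm (expR_ge0 _)).
apply: (@le_trans _ _ (C * expR (c / 2 * t ^+ 2) * expR (K - c * t ^+ 2))).
  by apply: ler_pM => //; rewrite ler_expR; have := Qc t; lra.
rewrite -!mulrA -!expRD; apply: ler_wpM2l => //; rewrite ler_expR.
by rewrite [in X in _ + (_ - X)](splitr c) mulrDl; lra.
Qed.

Lemma measurable_polyfun_gauss f : polyfun f ->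
  measurable_fun [set: R] (fun t => f t * expR (- Q t)).
Proof.
move=> pf; apply: measurable_funM.
  by apply: continuous_measurable_fun; exact: polyfun_continuous.
apply: measurableT_comp => //; apply: measurableT_comp => //.
by apply: continuous_measurable_fun; exact: polyfun_continuous.
Qed.

Lemma polyfun_gauss_integrable f : polyfun f ->
  mu.-integrable setT (EFin \o (fun t => f t * expR (- Q t))).
Proof.
move=> pf; have [C C0 HC] := polyfun_gauss_bound pf.
have c2 : 0 < c / 2 by rewrite divr_gt0.
apply: (le_integrable measurableT _ _ (integrableZl measurableT C (integrable_expR_sqr c2))).
  by apply/measurable_EFinP; exact: measurable_polyfun_gauss.
move=> t _ /=; rewrite lee_fin (le_trans (HC t))// ler_norm//.
Qed.

Hypothesis DQ : forall t : R, is_derive t 1 Q (dQ t).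

(** The integrand is the derivative of phi exp(-Q), which vanishes at both ends. With exp(-Q) a
    density on the line, -dQ is its score, so this is the Stein identity for an unnormalised
    weight. *)
Lemma polyfun_gauss_stein (phi dphi : R -> R) : polyfun phi ->
  (forall t : R, is_derive t 1 phi (dphi t)) ->
  (\int[leb1]_t ((dphi t - phi t * dQ t) * expR (- Q t))%:E = 0)%E.
Proof.
move=> pphi Dphi.
(* A polynomial has a polynomial derivative, and derivatives are unique. *)
have pd (f df : R -> R) : polyfun f -> (forall t : R, is_derive t 1 f (df t)) -> polyfun df.
  move=> /polyfun_derive[df' pdf' Df'] Df; suff -> : df = df' by [].
  apply/funext => t; have [_ <-] := Df t; by have [_ <-] := Df' t.
have pdphi := pd _ _ pphi Dphi; have pdQ := pd _ _ pQ DQ.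
pose r t := dphi t - phi t * dQ t.
have pr : polyfun r by apply: polyfunB => //; exact: polyfunM.
rewrite integral_leb1; last by apply/measurable_EFinP; apply: (measurable_polyfun_gauss pr).
have [C C0 HC] := polyfun_gauss_bound pphi.
pose F t := phi t * expR (- Q t).
have c2 : 0 < c / 2 by rewrite divr_gt0.
(* From exp(u) >= u with u = c t^2 / 2, and t^2 >= |t| when |t| >= 1. *)
have FC n (t : R) : `|t| = n.+1%:R -> `|F t| <= (C * (c / 2)^-1) / n.+1%:R.
  move=> tn; rewrite (le_trans (HC t))// -(mulrA C) ler_wpM2l// -invfM expRN.
  rewrite lef_pV2 ?posrE ?expR_gt0 ?mulr_gt0//.
  apply: le_trans (expR_ge1Dx _); rewrite -real_normK ?num_real// tn.
  rewrite (@le_trans _ _ (c / 2 * n.+1%:R ^+ 2)) ?lerDr//.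
  by rewrite ler_pM2l// expr2 ler_peMl// ler1n.
apply: (@integral_derive0 _ setT F _ (fun n => - n.+1%:R) (fun n => n.+1%:R) (C * (c / 2)^-1)) => //.
- by move=> n; rewrite gtrN.
- move=> t _; near=> n; rewrite in_itv/= -ler_norml.
  by rewrite (@le_trans _ _ n%:R) ?ler_nat//; near: n; exact: nbhs_infty_ger.
- move=> t _; rewrite (_ : _ * _ = phi t *: (expR (- Q t) * - dQ t) + expR (- Q t) *: dphi t); last first.
    by rewrite /GRing.scale/=; ring.
  have DN : is_derive t 1 (fun s => - Q s) (- dQ t) by exact: is_deriveN.
  exact: (@is_deriveM _ _ phi (expR \o (fun s => - Q s)) t 1 _ _ (Dphi t)
    (@is_derive1_comp _ expR (fun s => - Q s) _ _ _ (is_derive_expR _) DN)).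
- move=> t _; have : continuous (fun t => r t * expR (- Q t)); last exact.
  move=> {}t; apply: cvgM; first exact: (polyfun_continuous pr).
  apply: (cvg_comp _ expR); last exact: continuous_expR.
  by apply: cvgN; exact: (polyfun_continuous pQ).
- exact: (polyfun_gauss_integrable pr).
- by move=> n; apply: FC; rewrite normrN normr_nat.
- by move=> n; apply: FC; rewrite normr_nat.
Unshelve. all: by end_near. Qed.

End polynomial_functions.

Section gauss_moment.
Context {R : realType}.
Local Notation mu := (@lebesgue_measure R).

(** The fourth moment of N(0, v) is 3 v^2. The factor exp(kappa) stands for whatever the other
    coordinates contribute on the line, so the weight is not normalised. *)
Lemma gauss_slice_moment4 (v kappa : R) : 0 < v ->
  (\int[leb1]_t (t ^+ 4 * expR (kappa - t ^+ 2 / (2 * v)))%:E <=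
   \int[leb1]_t (3 * v ^+ 2 * expR (kappa - t ^+ 2 / (2 * v)))%:E)%E.
Proof.
move=> v0; pose Q (t : R) := t ^+ 2 / (2 * v) - kappa.
have EQ t : kappa - t ^+ 2 / (2 * v) = - Q t by rewrite opprB.
have pX n : @polyfun R (fun t => t ^+ n) by apply: polyfunX; exact: polyfun_id.
have pQ : polyfun Q.
  by apply: polyfunB; [apply: polyfunM => //|]; exact: polyfun_cst.
(* Solves phi' - phi t / v = t^4 - 3 v^2, so that one application of the Stein identity gives the
   moment. *)
pose phi (t : R) := - v * t ^+ 3 - 3 * v ^+ 2 * t.
have pphi : polyfun phi.
  apply: polyfunB; apply: polyfunM => //; try exact: polyfun_cst.
  exact: polyfun_id.
have Did t := is_derive_id t (1 : R).
have DQ (t : R) : is_derive t 1 Q (t / v).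
  apply: (is_derive_eq (is_derive_funB (is_derive_funM (is_derive_funX 2 (Did t))
    (is_derive_cst (2 * v)^-1 t 1)) (is_derive_cst kappa t 1))).
  by rewrite /=; field; rewrite gt_eqF.
have Dphi (t : R) : is_derive t 1 phi (- v * (3 * t ^+ 2) - 3 * v ^+ 2).
  apply: (is_derive_eq (is_derive_funB
    (is_derive_funM (is_derive_cst (- v) t 1) (is_derive_funX 3 (Did t)))
    (is_derive_funM (is_derive_cst (3 * v ^+ 2) t 1) (Did t)))).
  by rewrite /=; ring.
have pstein : polyfun (fun t => - v * (3 * t ^+ 2) - 3 * v ^+ 2 - phi t * (t / v)).
  apply: polyfunB; last by apply: polyfunM => //; apply: polyfunM; [exact: polyfun_id|exact: polyfun_cst].
  apply: polyfunB; last exact: polyfun_cst.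
  by apply: polyfunM; [exact: polyfun_cst|apply: polyfunM => //; exact: polyfun_cst].
have c0 : 0 < (2 * v)^-1 by rewrite invr_gt0 mulr_gt0.
have Qc t : (2 * v)^-1 * t ^+ 2 <= Q t + kappa by rewrite /Q subrK mulrC.
have mX (f : R -> R) : polyfun f ->
    measurable_fun [set: R] (fun t => f t * expR (kappa - t ^+ 2 / (2 * v))).
  move=> pf; rewrite (_ : (fun _ => _) = (fun t => f t * expR (- Q t))).
    exact: measurable_polyfun_gauss.
  by apply/funext => t; rewrite EQ.
rewrite !integral_leb1; last 2 first.
- by apply/measurable_EFinP; apply: mX; exact: polyfun_cst.
- by apply/measurable_EFinP; apply: mX; exact: pX.
have stein := polyfun_gauss_stein pQ c0 Qc DQ pphi Dphi.
have i4 := polyfun_gauss_integrable pQ c0 Qc (pX 4).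
have i0 := polyfun_gauss_integrable pQ c0 Qc (polyfun_cst (3 * v ^+ 2)).
under eq_integral do rewrite EQ.
under [X in (_ <= X)%E]eq_integral do rewrite EQ.
have /fineK F4 : (\int[mu]_t (t ^+ 4 * expR (- Q t))%:E)%E \is a fin_num.
  exact: integrable_fin_num.
have /fineK F0 : (\int[mu]_t (3 * v ^+ 2 * expR (- Q t))%:E)%E \is a fin_num.
  exact: integrable_fin_num.
have : (\int[mu]_t (t ^+ 4 * expR (- Q t))%:E - \int[mu]_t (3 * v ^+ 2 * expR (- Q t))%:E = 0)%E.
  rewrite -integralB_EFin// -[RHS]stein integral_leb1; last first.
    apply/measurable_EFinP; apply: (measurable_polyfun_gauss pQ); exact: pstein.
  apply: eq_integral => t _.
  by rewrite -EFinB; congr EFin; rewrite /phi; field; rewrite gt_eqF.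
rewrite -F4 -F0 -EFinB => -[] /eqP; rewrite subr_eq0 => /eqP E.
by rewrite lee_fin E.
Qed.

End gauss_moment.

(** * Inverse gamma weights on the half-line *)

Section inverse_gamma_functions.
Context {R : realType}.
Local Notation mu := (@lebesgue_measure R).
Variables (B : R).
Hypothesis B0 : 0 < B.

(** The kernel t^(-alpha) exp(-B / t) for a real exponent alpha. Dividing by t raises alpha by one,
    so rational test functions only shift the exponent. *)
Definition igfun (alpha t : R) : R := expR (- (alpha * ln t) - B / t).

Lemma igfunS alpha t : 0 < t -> igfun (alpha + 1) t = igfun alpha t / t.
Proof.
move=> t0; transitivity (igfun alpha t * expR (- ln t)); last by rewrite expRN lnK.
by rewrite -expRD; congr expR; ring.
Qed.

Lemma igfun_derive alpha (t : R) : 0 < t ->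
  is_derive t 1 (igfun alpha) (B * igfun (alpha + 1 + 1) t - alpha * igfun (alpha + 1) t).
Proof.
move=> t0; have tN0 : t != 0 by rewrite gt_eqF.
have Did := is_derive_id t (1 : R).
have DQ := is_derive_funB
  (is_derive_funN (is_derive_funM (is_derive_cst alpha t 1) (is_derive_funln t0 Did)))
  (is_derive_funM (is_derive_cst B t 1) (is_derive_funV tN0 Did)).
apply: (is_derive_eq (is_derive_funexp DQ)).
by rewrite !igfunS// /igfun /=; field.
Qed.

Lemma igfun_continuous alpha (t : R) : 0 < t -> {for t, continuous (igfun alpha)}.
Proof. by move=> /(igfun_derive alpha)/is_derive_continuous. Qed.

Lemma measurable_igfun alpha : measurable_fun setT (igfun alpha).
Proof.
rewrite /igfun; apply: measurableT_comp => //; apply: measurable_funB.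
  by apply: measurableT_comp => //; exact: measurable_funM.
by apply: measurable_funM => //; exact: measurable_funV.
Qed.

(** A majorant with the decay of t^(-alpha) at infinity; 1 + t in place of t removes the singularity
    at 0. The explicit antiderivative F tends to 0 at infinity because alpha > 1. *)
Lemma integrable_powN (alpha : R) : 1 < alpha ->
  mu.-integrable `[0, +oo[ (EFin \o (fun t => expR (- (alpha * ln (1 + t))))).
Proof.
move=> a1; have a0 : 0 < alpha - 1 by rewrite subr_gt0.
pose F (t : R) := - expR (- ((alpha - 1) * ln (1 + t))) / (alpha - 1).
pose f (t : R) := expR (- (alpha * ln (1 + t))).
have D1 (t : R) : is_derive t 1 (fun s : R => 1 + s) (0 + 1).
  exact: is_derive_funD (is_derive_cst (1 : R) t 1) (is_derive_id t 1).
have DE (c t : R) : 0 <= t -> is_derive t 1 (fun s : R => expR (- (c * ln (1 + s))))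
    (- c * (expR (- (c * ln (1 + t))) / (1 + t))).
  move=> t0; have t1 : 0 < 1 + t by rewrite ltr_pwDl.
  apply: (is_derive_eq (is_derive_funexp (is_derive_funN
    (is_derive_funM (is_derive_cst c t 1) (is_derive_funln t1 (D1 t)))))).
  by rewrite /=; field; rewrite gt_eqF.
have DF (t : R) : 0 <= t -> is_derive t 1 F (f t).
  move=> t0; have t1 : 0 < 1 + t by rewrite ltr_pwDl.
  apply: (is_derive_eq (is_derive_funM (is_derive_funN (DE (alpha - 1) t t0))
    (is_derive_cst (alpha - 1)^-1 t 1))).
  have -> : f t = expR (- ((alpha - 1) * ln (1 + t))) * (1 + t)^-1.
    rewrite -{2}(lnK t1) -expRN -expRD; congr expR; ring.
  by rewrite /=; field; rewrite !gt_eqF.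
have cf (t : R) : 0 <= t -> {for t, continuous f}.
  by move=> /(DE alpha)/is_derive_continuous.
have F0y : F t @[t --> +oo] --> 0.
  have lny : (alpha - 1) * ln (1 + t) @[t --> +oo] --> +oo.
    apply/cvgryPge => A; near=> t; rewrite mulrC -ler_pdivrMr//.
    rewrite -[leLHS]expRK ler_ln ?posrE ?expR_gt0//; last by rewrite addr_gt0.
    rewrite -lerBlDl; near: t; apply: nbhs_pinfty_ge; exact: num_real.
  rewrite [X in _ --> X](_ : 0 = - 0 / (alpha - 1)); last by rewrite oppr0 mul0r.
  apply: cvgM; last exact: cvg_cst.
  apply: (@cvgN _ R^o).
  apply: (cvg_comp _ (fun x => expR (- x)) lny); exact: cvgr_expR.
have E : (\int[mu]_(x in `[0%R, +oo[) (f x)%:E = 0%:E - (F 0)%:E)%E.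
  apply: (@ge0_continuous_FTC2y _ f F 0 0).
  - by move=> x _; exact: expR_ge0.
  - by apply: continuous_in_subspaceT => t; rewrite inE/= in_itv/= andbT => /cf.
  - exact: F0y.
  - by move=> x /ltW/DF[].
  - by apply: cvg_at_right_filter; exact: is_derive_continuous (DF _ (lexx 0)).
  - by move=> t; rewrite in_itv/= andbT => /ltW/DF[_ <-]; rewrite derive1E.
apply/integrableP; split.
  apply/measurable_EFinP; apply: measurable_funTS.
  apply: measurableT_comp => //; apply: measurableT_comp => //.
  apply: measurable_funM => //; apply: measurableT_comp => //.
  exact: measurable_funD.
rewrite (_ : (\int[_]_(x in _) _)%E = (\int[mu]_(x in `[0%R, +oo[) (f x)%:E)%E); last first.
  by apply: eq_integral => t _ /=; rewrite ger0_norm ?expR_ge0.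
by rewrite E ltry.
Unshelve. all: by end_near. Qed.

Lemma igfun_le_powN (alpha : R) : 0 < alpha ->
  exists2 C, 0 <= C & forall t, 0 < t -> igfun alpha t <= C * expR (- (alpha * ln (1 + t))).
Proof.
(* From ln u <= u at u = (B / alpha)(1 + 1/t), scaled so that alpha u = B + B/t: the factor
   exp(-B/t) then pays for the difference between ln(1 + t) and ln t. *)
move=> a0; pose K := B - alpha * ln (B / alpha).
exists (expR K) => [|t t0]; first exact: expR_ge0.
have t1 : 0 < 1 + t by rewrite addr_gt0.
rewrite -expRD /igfun ler_expR.
have Ba : 0 < B / alpha by rewrite divr_gt0.
have y0 : 0 < 1 + t^-1 by rewrite addr_gt0// invr_gt0.
have E : ln (1 + t) = ln t + ln (1 + t^-1).
  by rewrite -lnM ?posrE//; congr ln; field; rewrite gt_eqF.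
have := ln_sublinear (mulr_gt0 Ba y0); rewrite lnM ?posrE// => h.
have : alpha * (ln (B / alpha) + ln (1 + t^-1)) <= alpha * (B / alpha * (1 + t^-1)).
  by rewrite ler_pM2l// ltW.
rewrite E (_ : alpha * (B / alpha * _) = B + B / t); last by field; rewrite !gt_eqF.
by rewrite /K; lra.
Qed.

Lemma integrable_igfun (alpha : R) : 1 < alpha ->
  mu.-integrable `]0, +oo[ (EFin \o igfun alpha).
Proof.
move=> a1; have a0 : 0 < alpha by rewrite (lt_trans ltr01).
have [C C0 HC] := igfun_le_powN a0.
have ip : mu.-integrable `]0, +oo[ (EFin \o (fun t => expR (- (alpha * ln (1 + t))))).
  apply: integrableS (integrable_powN a1) => //.
  by apply: subset_itvr; rewrite bnd_simp.
apply: le_integrable (integrableZl _ C ip) => //.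
  by apply/measurable_EFinP; apply: measurable_funTS; exact: measurable_igfun.
move=> t /=; rewrite in_itv/= andbT => t0; rewrite lee_fin (ger0_norm (expR_ge0 _)).
by rewrite (le_trans (HC t t0))// ler_norm.
Qed.

(** Decay at the endpoints exp(-n) and exp(n), which exhaust the half-line: the factor exp(-B/t)
    wins at 0 and the power t^(-alpha) at infinity. *)
Lemma igfun_bound (alpha : R) : 0 < alpha -> exists2 M, 0 <= M & forall n,
  `|igfun alpha (expR (- n.+1%:R))| <= M / n.+1%:R /\
  `|igfun alpha (expR n.+1%:R)| <= M / n.+1%:R.
Proof.
(* The maximum over s of (alpha + 1) s - B s^2 / 2. Taking alpha + 1 instead of alpha leaves a
   factor exp(-s), hence the rate 1/n; the square comes from exp(s) >= 1 + s^2 / 2. *)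
move=> a0; pose K := (alpha + 1) ^+ 2 / (2 * B).
have expVle (s : R) : 0 < s -> expR (- s) <= s^-1.
  move=> s0; rewrite expRN lef_pV2 ?posrE ?expR_gt0//.
  by apply: le_trans (expR_ge1Dx s); rewrite lerDr.
exists (expR K + alpha^-1); first by rewrite addr_ge0 ?expR_ge0// invr_ge0 ltW.
move=> n; have n0 : 0 < n.+1%:R :> R by rewrite ltr0n.
rewrite !(ger0_norm (expR_ge0 _)) mulrDl; split.
  rewrite ler_wpDr ?mulr_ge0 ?invr_ge0 ?(ltW a0)//.
  apply: (@le_trans _ _ (expR K * expR (- n.+1%:R))); last first.
    by rewrite ler_pM2l ?expR_gt0// expVle.
  rewrite /igfun -expRD ler_expR expRK expRN invrK.
  have := expR_ge1Dxn 1 (ltW n0); rewrite expr2 (_ : 2`! = 2)%N//.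
  set s : R := n.+1%:R; move: (expR s) => es hs.
  have h2 : B * (1 + s * s / 2) <= B * es by rewrite ler_pM2l.
  have h3 : (alpha + 1) * s <= K + B * (s * s / 2).
    rewrite -subr_ge0 (_ : _ - _ = (alpha + 1 - B * s) ^+ 2 / (2 * B)); last first.
      by rewrite /K; field; rewrite gt_eqF.
    by rewrite divr_ge0 ?sqr_ge0// mulr_ge0// ltW.
  rewrite mulrN opprK lerBlDr.
  have -> : alpha * s = (alpha + 1) * s - s by rewrite mulrDl mul1r addrK.
  rewrite lerBlDr -addrA (addrC (B * es)) addrA subrK (le_trans h3)// lerD2l.
  by rewrite (le_trans _ h2)// ler_pM2l// lerDr.
rewrite ler_wpDl ?mulr_ge0 ?expR_ge0 ?invr_ge0//.
apply: (@le_trans _ _ (expR (- (alpha * n.+1%:R)))).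
  by rewrite /igfun ler_expR expRK gerDl oppr_le0 mulr_ge0 ?invr_ge0 ?expR_ge0// ltW.
by rewrite -invfM expVle// mulr_gt0.
Qed.

Lemma igfun_derive_integral0 (alpha : R) : 0 < alpha ->
  (\int[mu]_(t in `]0%R, +oo[) (B * igfun (alpha + 1 + 1) t - alpha * igfun (alpha + 1) t)%:E = 0)%E.
Proof.
move=> a0; have [M M0 HM] := igfun_bound a0.
have cE (c : R) : 1 < c -> mu.-integrable `]0, +oo[ (EFin \o igfun c) by exact: integrable_igfun.
apply: (@integral_derive0 _ _ (igfun alpha) _ (fun n => expR (- n.+1%:R)) (fun n => expR n.+1%:R) M) => //.
- by move=> n; rewrite ltr_expR gtrN.
- by move=> n; apply: subset_itv; rewrite bnd_simp ?expR_gt0.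
- move=> t /=; rewrite in_itv/= andbT => t0; near=> n.
  rewrite in_itv/= -[t in X in X && _](lnK t0) -[t in X in _ && X](lnK t0) !ler_expR -ler_norml.
  by rewrite (@le_trans _ _ n%:R) ?ler_nat//; near: n; exact: nbhs_infty_ger.
- by move=> t /=; rewrite in_itv/= andbT; exact: igfun_derive.
- move=> t /=; rewrite in_itv/= andbT => t0.
  apply: (@continuousB _ R^o); apply: continuousM; try exact: cvg_cst.
    exact: igfun_continuous.
  exact: igfun_continuous.
- rewrite (_ : _ \o _ = (fun t => (B%:E * (igfun (alpha + 1 + 1) t)%:E - alpha%:E * (igfun (alpha + 1) t)%:E)%E))//.
  apply: integrableB => //; apply: integrableZl => //; apply: integrable_igfun; lra.
- by move=> n; case: (HM n).
- by move=> n; case: (HM n).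
Unshelve. all: by end_near. Qed.

End inverse_gamma_functions.

Section inverse_gamma_slices.
Context {R : realType}.
Local Notation mu := (@lebesgue_measure R).
Local Notation D := (`]0%R, +oo[%classic : set R).
Variables (B : R).
Hypothesis B0 : 0 < B.

Let mem_pos (t : R) : (t \in D) = (0 < t).
Proof. by apply/idP/idP; rewrite inE/= in_itv/= andbT. Qed.

Let integrable_diff (alpha : R) : 0 < alpha ->
  mu.-integrable D (EFin \o (fun t => B * igfun B (alpha + 1 + 1) t - alpha * igfun B (alpha + 1) t)).
Proof.
move=> a0.
rewrite (_ : _ \o _ = (fun t => (B%:E * (igfun B (alpha + 1 + 1) t)%:E - alpha%:E * (igfun B (alpha + 1) t)%:E)%E))//.
by apply: integrableB => //; apply: integrableZl => //; apply: integrable_igfun => //; lra.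
Qed.

(** Integrability is carried along with the vanishing integral because additivity of the integral
    requires it; together they are stable under linear combinations. *)
Let null (f : R -> R) := mu.-integrable D (EFin \o f) /\ (\int[mu]_(t in D) (f t)%:E = 0)%E.

Let nullD f g : null f -> null g -> null (fun t => f t + g t).
Proof.
move=> [if1 f0] [ig g0]; split.
  rewrite (_ : _ \o _ = (fun t => (f t)%:E + (g t)%:E)%E)//; exact: integrableD.
by rewrite integralD_EFin// f0 g0 adde0.
Qed.

Let nullZ (c : R) f : null f -> null (fun t => c * f t).
Proof.
move=> [if1 f0]; split.
  rewrite (_ : _ \o _ = (fun t => c%:E * (f t)%:E)%E)//; exact: integrableZl.
by under eq_integral do rewrite EFinM; rewrite integralZl// f0 mule0.
Qed.

(** The inverse gamma density of shape A and rate B up to the factor exp(kappa), extended by 0: the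
    form of the joint density on a line in direction gamma_j. *)
Definition igslice (A kappa t : R) : R :=
  if 0 < t then expR (kappa - (A + 1) * ln t - B / t) else 0.

Lemma measurable_igslice (A kappa : R) : measurable_fun setT (igslice A kappa).
Proof.
rewrite /igslice.
apply: measurable_fun_ifT => //; first exact: measurable_fun_ltr.
apply: measurableT_comp => //; apply: measurable_funB.
  by apply: measurable_funB => //; exact: measurable_funM.
by apply: measurable_funM => //; exact: measurable_funV.
Qed.

(** Errors are affine in gamma_j and score entries contain powers down to gamma_j^-2, whence this
    family of test functions. Each power times the weight is a kernel [igfun] of exponent A to A +
    3, and its derivative integrates to 0. The linear term has exponent A and decays most slowly at
    infinity. *)
Lemma igfun_slice_stein (A kappa cm c0 c1 c2 : R) : 0 < A ->
  (\int[leb1]_t (((cm - c1 / t ^+ 2 - 2 * c2 / t ^+ 3) +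
      (cm * t + c0 + c1 / t + c2 / t ^+ 2) * (B / t ^+ 2 - (A + 1) / t)) *
     igslice A kappa t)%:E = 0)%E.
Proof.
move=> A0; rewrite integral_leb1; last first.
  apply/measurable_EFinP.
  have mX k : measurable_fun [set: R] (fun t => t ^- k).
    by apply: measurable_funV; exact: measurable_funX.
  have mV : measurable_fun [set: R] (fun t => t^-1) by exact: measurable_funV.
  apply: measurable_funM; last exact: measurable_igslice.
    apply: measurable_funD; first by apply: measurable_funB; [apply: measurable_funB => //|]; apply: measurable_funM.
    apply: measurable_funM; last by apply: measurable_funB; apply: measurable_funM.
    apply: measurable_funD; last by apply: measurable_funM.
    apply: measurable_funD; last by apply: measurable_funM.
    by apply: measurable_funD => //; exact: measurable_funM.
pose d (alpha t : R) := B * igfun B (alpha + 1 + 1) t - alpha * igfun B (alpha + 1) t.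
have nd alpha : 0 < alpha -> null (d alpha).
  by move=> a0; split; [exact: integrable_diff|exact: igfun_derive_integral0].
pose f (t : R) := expR kappa * (((cm * d A t + c0 * d (A + 1) t) + c1 * d (A + 1 + 1) t) + c2 * d (A + 1 + 1 + 1) t).
have [_ f0] : null f.
  by apply: nullZ; apply: nullD; [apply: nullD; [apply: nullD|]|]; apply: nullZ; apply: nd; lra.
rewrite -[RHS]f0 [RHS]integral_mkcond; apply: eq_integral => t _.
rewrite /patch mem_pos /igslice; case: ifP => [t0|_]; last by rewrite mulr0.
congr EFin.
have tN0 : t != 0 by rewrite gt_eqF.
have E : expR (kappa - (A + 1) * ln t - B / t) = expR kappa * (igfun B A t / t).
  by rewrite -igfunS// -expRD addrA.
by rewrite E /f /d !igfunS//; field.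
Qed.

(** Integration by parts lowers the exponent of the kernel by one at the cost of a factor alpha / B;
    four steps produce the rising factorial of A. The bound uses b instead of B because B depends on
    x_j and so varies from line to line, while the constant must not. *)
Lemma igfun_slice_moment4 (b A kappa : R) : 0 < A -> 0 < b -> b <= B ->
  (\int[leb1]_t (t ^- 4 * igslice A kappa t)%:E <=
   \int[leb1]_t ((A * (A + 1) * (A + 2) * (A + 3) / b ^+ 4) *
      igslice A kappa t)%:E)%E.
Proof.
move=> A0 b0 bB; rewrite !integral_leb1; last 2 first.
- by apply/measurable_EFinP; apply: measurable_funM => //; exact: measurable_igslice.
- apply/measurable_EFinP; apply: measurable_funM; last exact: measurable_igslice.
  by apply: measurable_funV; exact: measurable_funX.
have I0 alpha : (0 <= \int[mu]_(t in D) (igfun B alpha t)%:E)%E.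
  by apply: integral_ge0 => t _; rewrite lee_fin expR_ge0.
have ii alpha : 1 < alpha -> mu.-integrable D (EFin \o igfun B alpha).
  exact: integrable_igfun.
have step alpha : 0 < alpha ->
    (\int[mu]_(t in D) (igfun B (alpha + 1 + 1) t)%:E <=
     (alpha / b)%:E * \int[mu]_(t in D) (igfun B (alpha + 1) t)%:E)%E.
  move=> a0; have i1 := ii (alpha + 1) ltac:(lra); have i2 := ii (alpha + 1 + 1) ltac:(lra).
  have := igfun_derive_integral0 B0 a0.
  rewrite (_ : (fun t => _) = (fun t => (B%:E * (igfun B (alpha + 1 + 1) t)%:E -
     alpha%:E * (igfun B (alpha + 1) t)%:E)%E)); last exact/funext.
  rewrite integralB//; [|exact: integrableZl|exact: integrableZl].
  rewrite !integralZl//.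
  have F1 : (\int[mu]_(t in D) (igfun B (alpha + 1) t)%:E)%E \is a fin_num by exact: integrable_fin_num.
  have F2 : (\int[mu]_(t in D) (igfun B (alpha + 1 + 1) t)%:E)%E \is a fin_num by exact: integrable_fin_num.
  have := I0 (alpha + 1); move: F1 F2; rewrite /comp => /fineK <- /fineK <-.
  move: (fine _) (fine _) => y x; rewrite !lee_fin => x0 [] /eqP.
  rewrite subr_eq0 => /eqP xy.
  have -> : y = alpha * x / B by rewrite -xy; field; rewrite gt_eqF.
  rewrite mulrAC ler_wpM2r// ler_wpM2l ?(ltW a0)//.
  by rewrite lef_pV2 ?posrE.
have E (t : R) : 0 < t -> expR (kappa - (A + 1) * ln t - B / t) = expR kappa * (igfun B A t / t).
  by move=> t0; rewrite -igfunS// -expRD addrA.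
have Ik (k : nat) : (\int[mu]_t (t ^- k * igslice A kappa t)%:E =
   (expR kappa)%:E * \int[mu]_(t in D) (igfun B (iter k (+%R^~ 1) (A + 1)) t)%:E)%E.
  rewrite -ge0_integralZl//; last 2 first.
  - by apply/measurable_EFinP; apply: measurable_funTS; exact: measurable_igfun.
  - by move=> t _; rewrite lee_fin expR_ge0.
  rewrite [RHS]integral_mkcond; apply: eq_integral => t _.
  rewrite /patch mem_pos /igslice; case: ifP => [t0|_]; last by rewrite mulr0.
  rewrite E// -EFinM; congr EFin; rewrite mulrCA; congr (_ * _).
  elim: k => [|k IH]; first by rewrite expr0 invr1 mul1r /= igfunS.
  by rewrite /= igfunS// -IH exprSr invfM mulrAC mulrC mulrA.
rewrite (Ik 4).
have -> : (\int[mu]_t ((A * (A + 1) * (A + 2) * (A + 3) / b ^+ 4) *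
      igslice A kappa t)%:E =
   ((expR kappa)%:E * ((A * (A + 1) * (A + 2) * (A + 3) / b ^+ 4)%:E * \int[mu]_(t in D) (igfun B (A + 1) t)%:E)))%E.
  have I0k : (\int[mu]_t (igslice A kappa t)%:E =
      (expR kappa)%:E * \int[mu]_(t in D) (igfun B (A + 1) t)%:E)%E.
    by rewrite -(Ik 0); apply: eq_integral => t _; rewrite expr0 invr1 mul1r.
  rewrite muleCA -I0k -ge0_integralZl//.
  - by apply/measurable_EFinP; exact: measurable_igslice.
  - by move=> t _; rewrite lee_fin /igslice; case: ifP => // _; rewrite expR_ge0.
  - rewrite lee_fin divr_ge0 ?exprn_ge0 ?(ltW b0)//.
    by rewrite !mulr_ge0// ?addr_ge0// ltW.
rewrite lee_pmul2l ?lte_fin ?expR_gt0//=.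
have s0 := step A A0.
have s1 := step (A + 1) ltac:(lra).
have s2 := step (A + 1 + 1) ltac:(lra).
have s3 := step (A + 1 + 1 + 1) ltac:(lra).
have p (c : R) : 0 < c -> (0 <= (c / b)%:E)%E.
  by move=> c0; rewrite lee_fin divr_ge0// ltW.
apply: (le_trans s3); apply: le_trans (lee_wpmul2l _ s2) _; first (apply: p; lra).
rewrite muleA; apply: le_trans (lee_wpmul2l _ s1) _; first (apply: mule_ge0; apply: p; lra).
rewrite muleA; apply: le_trans (lee_wpmul2l _ s0) _; first (apply: mule_ge0; [apply: mule_ge0|]; apply: p; lra).
rewrite muleA -!EFinM le_eqVlt; apply/orP; left; apply/eqP; congr (_%:E * _)%E.
by field; rewrite gt_eqF.
Qed.

End inverse_gamma_slices.

(** * Differentiating an expectation in a scale parameter *)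

Section score_of_a_scale_parameter.
Context {R : realType} {d : measure_display} {T : measurableType d}.
Variables (mu : {measure set T -> \bar R}) (g q : T -> R) (m : R).
Hypotheses (q0 : forall u, 0 <= q u) (m0 : 0 <= m).

(** A Gaussian factor of variance t in m dimensions with squared norm q, times everything that does
    not involve t. The noise variance is the case m = N with q the squared residual; the scale
    gamma_j is the case m = 1 with q = x_j^2. *)
Definition scale_kernel (t : R) (u : T) : R :=
  g u * expR (- (m / 2 * ln (2 * pi * t)) - q u / (2 * t)).

Lemma scale_kernel_derive (t : R) u : 0 < t -> is_derive t 1 (scale_kernel^~ u)
  (scale_kernel t u * (q u / (2 * t ^+ 2) - m / (2 * t))).
Proof.
move=> t0; have p0 : 0 < 2 * pi * t :> R by rewrite !mulr_gt0 ?pi_gt0.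
have tN0 : 2 * t != 0 by rewrite mulf_neq0// gt_eqF.
have Dt (c : R) : is_derive t 1 (fun s => c * s) (c * 1).
  exact: is_derive_funZ (is_derive_id t (1 : R)).
have D1 := is_derive_funN (is_derive_funZ (m / 2) (is_derive_funln p0 (Dt (2 * pi)))).
have D2 := is_derive_funZ (q u) (is_derive_funV tN0 (Dt 2)).
apply: (is_derive_eq (is_derive_funZ (g u) (is_derive_funexp (is_derive_funB D1 D2)))).
rewrite /scale_kernel; move: (@pi R) (pi_gt0 R) => p pi0.
by field; rewrite !gt_eqF.
Qed.

(** For t < 2 t0 the exponential is at most the square of exp(-q / (8 t0)). One of these two factors
    absorbs the q brought down by differentiation; the other is the exponential of the kernel at 4
    t0. The dominating function thus belongs to the same family, and its integrability is already
    assumed. *)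
Lemma scale_kernel_derive_bound (t t0 : R) u : 0 < t0 -> t0 / 2 < t -> t < 2 * t0 ->
  `|scale_kernel t u * (q u / (2 * t ^+ 2) - m / (2 * t))| <=
  expR (m / 2 * (ln (2 * pi * (4 * t0)) - ln (2 * pi * (t0 / 2)))) * ((16 + m) / t0) *
  `|scale_kernel (4 * t0) u|.
Proof.
move=> t00 tl tr; have tp : 0 < t by rewrite (lt_trans _ tl)// divr_gt0.
have pi0 := pi_gt0 R.
rewrite /scale_kernel !normrM !(ger0_norm (expR_ge0 _)) -mulrA [leRHS]mulrCA.
rewrite ler_wpM2l//.
pose L (s : R) := ln (2 * pi * s).
have q8 : 0 <= q u / (8 * t0) by rewrite divr_ge0// mulr_ge0// ltW.
have h1 : expR (- (m / 2 * L t) - q u / (2 * t)) <=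
   expR (- (m / 2 * L (t0 / 2))) * (expR (- (q u / (8 * t0))) * expR (- (q u / (8 * t0)))).
  rewrite -!expRD ler_expR; apply: lerD.
    rewrite lerN2 ler_wpM2l ?divr_ge0// ler_ln ?posrE ?mulr_gt0 ?divr_gt0//.
    by rewrite ler_pM2l ?mulr_gt0// ltW.
  rewrite -opprD lerN2 (_ : _ + _ = q u / (4 * t0)); last by field; rewrite gt_eqF.
  rewrite ler_wpM2l// lef_pV2 ?posrE ?mulr_gt0//.
  lra.
(* The lower bound t > t0 / 2 gives q / (2 t^2) <= 2 q / t0^2, rewritten as 16 (q / (8 t0)) / t0 to
   match the exponent reserved for it. *)
have h2 : `|q u / (2 * t ^+ 2) - m / (2 * t)| <= (16 * (q u / (8 * t0)) + m) / t0.
  rewrite (le_trans (ler_normB _ _))// !ger0_norm ?divr_ge0 ?mulr_ge0 ?exprn_ge0 ?(ltW tp)//.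
  rewrite (mulrDl (16 * _) m); apply: lerD.
    rewrite (_ : _ / t0 = q u / (t0 ^+ 2 / 2)); last by field; rewrite gt_eqF.
    rewrite ler_wpM2l// lef_pV2 ?posrE ?divr_gt0 ?mulr_gt0 ?exprn_gt0//.
    rewrite (_ : t0 ^+ 2 / 2 = 2 * (t0 / 2) ^+ 2); last by field.
    by rewrite ler_pM2l// ler_pXn2r ?nnegrE ?divr_ge0 ?(ltW tl) ?(ltW tp) ?(ltW t00).
  rewrite ler_wpM2l// lef_pV2 ?posrE ?mulr_gt0//.
  lra.
have h3 : (16 * (q u / (8 * t0)) + m) / t0 * expR (- (q u / (8 * t0))) <= (16 + m) / t0.
  rewrite mulrAC ler_wpM2r ?invr_ge0 ?(ltW t00)// expRN ler_pdivrMr ?expR_gt0//.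
  have e1 := expR_ge1Dx (q u / (8 * t0)).
  rewrite (mulrDl 16 m) lerD//.
    by rewrite ler_pM2l//; apply: le_trans e1; rewrite lerDr.
  by rewrite ler_peMr//; apply: le_trans e1; rewrite lerDl.
apply: le_trans (ler_pM (expR_ge0 _) (normr_ge0 _) h1 h2) _.
apply: (@le_trans _ _ (expR (- (m / 2 * L (t0 / 2))) * expR (- (q u / (8 * t0))) * ((16 + m) / t0))).
  have -> (x y z : R) : x * (y * y) * z = x * y * (z * y) by ring.
  by rewrite ler_wpM2l ?mulr_ge0 ?expR_ge0.
rewrite [leRHS]mulrAC ler_wpM2r ?divr_ge0 ?addr_ge0 ?(ltW t00)//.
rewrite -!expRD ler_expR -/(L _) -/(L _) (_ : 2 * (4 * t0) = 8 * t0); last by ring.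
by move: (L _) (L _) (q u / _) => a b c; lra.
Qed.

Lemma score_integral (c eps t0 : R) : 0 < t0 ->
  (forall t, 0 < t -> mu.-integrable setT (EFin \o scale_kernel t)) ->
  (forall t, 0 < t -> \int[mu]_u scale_kernel t u = c + eps * t) ->
  \int[mu]_u (scale_kernel t0 u * (q u / (2 * t0 ^+ 2) - m / (2 * t0))) = eps.
Proof.
move=> t00 ik kE; pose I : set R := `]t0 / 2, 2 * t0[%classic.
have It t : I t -> [/\ t0 / 2 < t, t < 2 * t0 & 0 < t].
  rewrite /I /= in_itv/= => /andP[h1 h2]; split => //.
  by rewrite (lt_trans _ h1)// divr_gt0.
have It0 : I t0 by rewrite /I /= in_itv/=; apply/andP; split; lra.
pose C := expR (m / 2 * (ln (2 * pi * (4 * t0)) - ln (2 * pi * (t0 / 2)))) * ((16 + m) / t0).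
have C0 : 0 <= C by rewrite mulr_ge0 ?expR_ge0// divr_ge0 ?addr_ge0// ltW.
have d1 t u : 0 < t -> partial1of2 scale_kernel t u =
    scale_kernel t u * (q u / (2 * t ^+ 2) - m / (2 * t)).
  by move=> tp; rewrite partial1of2E; have [_ ->] := scale_kernel_derive u tp.
have := @differentiation_under_integral _ _ _ mu scale_kernel setT measurableT
  t0 (t0 / 2) (2 * t0) It0 _ _ (fun u => C * `|scale_kernel (4 * t0) u|) _ _ _.
have -> : \int[mu]_u (scale_kernel t0 u * (q u / (2 * t0 ^+ 2) - m / (2 * t0))) =
    \int[mu]_u partial1of2 scale_kernel t0 u.
  by apply: eq_Rintegral => u _; rewrite d1.
move=> <-.
- rewrite derive1E (@near_eq_derive _ _ _ _ (fun t => c + eps * t)).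
    have [_ ->] := is_derive_funD (is_derive_cst c t0 1) (is_derive_funZ eps (is_derive_id t0 (1 : R))).
    by rewrite add0r mulr1.
  near=> t; apply: kE; near: t; exact: lt_nbhsr.
- by move=> t /It[_ _ tp]; exact: ik.
- by move=> t u /It[_ _ tp] _; have [] := scale_kernel_derive u tp.
- by move=> u; rewrite mulr_ge0.
- rewrite (_ : _ \o _ = (fun u => C%:E * (EFin \o (fun u => `|scale_kernel (4 * t0) u|%R)) u)%E)//.
  apply: integrableZl => //; apply: integrable_norm; apply: ik; lra.
- move=> t u /It[tl tr tp] _; rewrite d1//; exact: scale_kernel_derive_bound.
Unshelve. all: by end_near. Qed.

End score_of_a_scale_parameter.

Section score_expectation.
Context {R : realType} {d d' : measure_display}.
Context {Omega : measurableType d} {T : measurableType d'}.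
Variables (P : R -> probability Omega R) (Z : Omega -> T) (mu : {measure set T -> \bar R}).
Variables (f : R -> T -> R) (g q : T -> R) (m : R).
Hypotheses (q0 : forall z, 0 <= q z) (m0 : 0 <= m) (mZ : measurable_fun setT Z).
Hypotheses (mq : measurable_fun setT q) (mf : forall t, 0 < t -> measurable_fun setT (f t)).
Hypothesis f0 : forall t, 0 < t -> forall z, 0 <= f t z.
Hypothesis fE : forall t, 0 < t -> forall z, f t z = scale_kernel g q m t z.
Hypothesis law : forall t, 0 < t -> has_pdf (P t) Z mu (f t).

Lemma score_expectation (phi : T -> R) (c eps t0 : R) :
  measurable_fun setT phi -> 0 < t0 ->
  (forall t, 0 < t -> (P t).-integrable setT (EFin \o (fun w => phi (Z w)))) ->
  (forall t, 0 < t -> \int[P t]_w phi (Z w) = c + eps * t) ->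
  \int[P t0]_w (phi (Z w) * (q (Z w) / (2 * t0 ^+ 2) - m / (2 * t0))) = eps.
Proof.
move=> mphi t00 iphi Iphi; pose h z := phi z * g z.
have kE t z : 0 < t -> phi z * f t z = scale_kernel h q m t z.
  by move=> t1; rewrite fE// /scale_kernel mulrA.
have int t : 0 < t -> forall psi, measurable_fun setT psi ->
    (\int[P t]_w (psi (Z w))%:E = \int[mu]_z (psi z * f t z)%:E)%E.
  by move=> t1; exact: (pdf_integral mZ (mf t1) (f0 t1) (law t1)).
have ik t : 0 < t -> mu.-integrable setT (EFin \o scale_kernel h q m t).
  move=> t1; rewrite (_ : _ \o _ = (fun z => (phi z * f t z)%:E)).
    by apply/(pdf_integrable mZ (mf t1) (f0 t1) (law t1) mphi); exact: iphi.
  by apply/funext => z; rewrite /= kE.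
have Ik t : 0 < t -> \int[mu]_u scale_kernel h q m t u = c + eps * t.
  move=> t1; rewrite -Iphi// /Rintegral int//; congr fine.
  by apply: eq_integral => z _; rewrite kE.
rewrite -[RHS](score_integral q0 m0 t00 ik Ik) /Rintegral.
rewrite (int _ t00 (fun z => phi z * (q z / (2 * t0 ^+ 2) - m / (2 * t0)))); last first.
  by apply: measurable_funM => //; apply: measurable_funB => //; exact: measurable_funM.
by congr fine; apply: eq_integral => z _; rewrite mulrAC kE.
Qed.

End score_expectation.

(** * The log-likelihood and its derivatives *)

Section parameter_indices.
Context {L : nat}.

Definition idx_x (j : 'I_L) : 'I_(L + L + 1) := lshift 1 (lshift L j).
Definition idx_g (j : 'I_L) : 'I_(L + L + 1) := lshift 1 (rshift L j).
Definition idx_xi : 'I_(L + L + 1) := rshift (L + L) ord0.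

Lemma idx_ind (Q : 'I_(L + L + 1) -> Prop) :
  (forall j, Q (idx_x j)) -> (forall j, Q (idx_g j)) -> Q idx_xi -> forall i, Q i.
Proof.
move=> Qx Qg Qxi i; case: (split_ordP i) => k ->; last by rewrite ord1.
by case: (split_ordP k) => j ->; [exact: Qx|exact: Qg].
Qed.

Lemma eq_idx_xx i j : (idx_x i == idx_x j) = (i == j).
Proof. by rewrite /idx_x !(inj_eq (@lshift_inj _ _)). Qed.
Lemma eq_idx_gg i j : (idx_g i == idx_g j) = (i == j).
Proof. by rewrite /idx_g (inj_eq (@lshift_inj _ _)) (inj_eq (@rshift_inj _ _)). Qed.
Lemma eq_idx_xg i j : (idx_x i == idx_g j) = false.
Proof. by rewrite /idx_x /idx_g (inj_eq (@lshift_inj _ _)) eq_lrshift. Qed.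
Lemma eq_idx_gx i j : (idx_g i == idx_x j) = false.
Proof. by rewrite eq_sym eq_idx_xg. Qed.
Lemma eq_idx_xxi i : (idx_x i == idx_xi) = false.
Proof. by rewrite eq_lrshift. Qed.
Lemma eq_idx_xix i : (idx_xi == idx_x i) = false.
Proof. by rewrite eq_rlshift. Qed.
Lemma eq_idx_gxi i : (idx_g i == idx_xi) = false.
Proof. by rewrite eq_lrshift. Qed.
Lemma eq_idx_xig i : (idx_xi == idx_g i) = false.
Proof. by rewrite eq_rlshift. Qed.

Definition eq_idx := (eq_idx_xx, eq_idx_gg, eq_idx_xg, eq_idx_gx, eq_idx_xxi,
  eq_idx_xix, eq_idx_gxi, eq_idx_xig, eqxx).

Context {R : realType}.

Lemma paramE_x (x g : 'cV[R]_L) xi j : param x g xi (idx_x j) ord0 = x j ord0.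
Proof. by rewrite /param /idx_x !col_mxEu. Qed.
Lemma paramE_g (x g : 'cV[R]_L) xi j : param x g xi (idx_g j) ord0 = g j ord0.
Proof. by rewrite /param /idx_g col_mxEu col_mxEd. Qed.
Lemma paramE_xi (x g : 'cV[R]_L) xi : param x g xi idx_xi ord0 = xi.
Proof. by rewrite /param /idx_xi col_mxEd mxE mulr1n. Qed.

Definition paramE := (paramE_x, paramE_g, paramE_xi).

End parameter_indices.

Section log_likelihood.
Context {R : realType} {N L : nat}.
Variables (Phi : 'M[R]_(N, L)) (c0 c1 c2 : R).
Local Notation V := 'cV[R]_(L + L + 1).
Implicit Types (y : 'cV[R]_N) (t v : V).

Local Notation tx t j := (t (idx_x j) ord0).
Local Notation tg t j := (t (idx_g j) ord0).
Local Notation txi t := (t idx_xi ord0).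

Definition resid y t (k : 'I_N) : R := y k ord0 - \sum_i Phi k i * tx t i.

(** The last sum is the Gaussian exponent of x_i given gamma_i, plus the log inverse gamma prior in
    the random model. Fixed scales have c1 = -1/2 and c2 = 0; the prior changes only c0, c1 and
    c2. *)
Definition loglik y t : R :=
  - (N%:R / 2 * ln (2 * pi * txi t)) - (\sum_k resid y t k ^+ 2) / (2 * txi t) +
  \sum_i (c0 + c1 * ln (tg t i) - (c2 + tx t i ^+ 2 / 2) / tg t i).

Definition score y t : V := param
  (\col_j ((\sum_k Phi k j * resid y t k) / txi t - tx t j / tg t j))
  (\col_j (c1 / tg t j + (c2 + tx t j ^+ 2 / 2) / tg t j ^+ 2))
  ((\sum_k resid y t k ^+ 2) / (2 * txi t ^+ 2) - N%:R / (2 * txi t)).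

Definition dresid v (k : 'I_N) : R := \sum_i Phi k i * tx v i.

Definition dscore y t v : V := param
  (\col_j (- (\sum_k Phi k j * dresid v k) / txi t
    - (\sum_k Phi k j * resid y t k) * txi v / txi t ^+ 2
    - tx v j / tg t j + tx t j * tg v j / tg t j ^+ 2))
  (\col_j (- c1 * tg v j / tg t j ^+ 2 + tx t j * tx v j / tg t j ^+ 2
    - (2 * c2 + tx t j ^+ 2) * tg v j / tg t j ^+ 3))
  (N%:R * txi v / (2 * txi t ^+ 2) - (\sum_k resid y t k ^+ 2) * txi v / txi t ^+ 3
    - (\sum_k resid y t k * dresid v k) / txi t ^+ 2).

Definition positive_param t : Prop := (forall j, 0 < tg t j) /\ 0 < txi t.

Lemma positive_param_near t : positive_param t ->
  \forall s \near t, positive_param s.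
Proof.
move=> [g0 xi0]; near=> s; split; last first.
  near: s; have : {for t, continuous (fun s : V => txi s)} by exact: coord_continuous.
  by move/cvgr_gt; apply.
move=> j; move: j; near: s; apply: filter_forall => j.
have : {for t, continuous (fun s : V => tg s j)} by exact: coord_continuous.
by move/cvgr_gt; apply.
Unshelve. all: by end_near. Qed.

Lemma is_derive_coord (i : 'I_(L + L + 1)) t v : is_derive t v (fun s : V => s i ord0) (v i ord0).
Proof.
by apply: (is_derive_fun_linear (f := fun s : V => s i ord0)) => a u w; rewrite !mxE.
Qed.

Lemma is_derive_resid y k t v : is_derive t v (fun s => resid y s k) (- dresid v k).
Proof.
have Ds : is_derive t v (fun s => \sum_i Phi k i * tx s i) (dresid v k).
  by apply: is_derive_funsum => i; exact/is_derive_funZ/is_derive_coord.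
by rewrite -sub0r; exact: is_derive_funB (is_derive_cst (y k ord0) t v) Ds.
Qed.

Lemma is_derive_sqresid y t v : is_derive t v (fun s => \sum_k resid y s k ^+ 2)
  (- (2 * \sum_k resid y t k * dresid v k)).
Proof.
rewrite mulr_sumr -sumrN; apply: is_derive_funsum => k.
apply: (is_derive_eq (is_derive_funX 2 (is_derive_resid y k t v))).
by rewrite expr1 mulrN mulrA.
Qed.

Lemma sum_resid y t v :
  \sum_i (\sum_k Phi k i * resid y t k) * tx v i = \sum_k resid y t k * dresid v k.
Proof.
under eq_bigr do rewrite mulr_suml.
rewrite exchange_big; apply: eq_bigr => k _; rewrite mulr_sumr.
by apply: eq_bigr => i _; rewrite mulrCA mulrA.
Qed.

Lemma is_derive_loglik y t v : positive_param t ->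
  is_derive t v (loglik y) (\sum_i score y t i ord0 * v i ord0).
Proof.
move=> [g0 xi0]; have xi2 : 2 * txi t != 0 by rewrite mulf_neq0// gt_eqF.
have pxi : 0 < 2 * pi * txi t by rewrite !mulr_gt0 ?pi_gt0.
have Dxi := is_derive_coord idx_xi t v.
have D1 : is_derive t v (fun s => - (N%:R / 2 * ln (2 * pi * txi s)))
    (- (N%:R / 2 * (2 * pi * txi v / (2 * pi * txi t)))).
  apply: is_derive_funN; apply: is_derive_funZ.
  have h := is_derive_funln (f := fun s : V => 2 * pi * txi s) pxi (is_derive_funZ (2 * pi) Dxi).
  exact: h.
have D2 := is_derive_funM (is_derive_sqresid y t v)
  (is_derive_funV (f := fun s : V => 2 * txi s) xi2 (is_derive_funZ 2 Dxi)).
have D3 (i : 'I_L) : is_derive t v (fun s => c0 + c1 * ln (tg s i) - (c2 + tx s i ^+ 2 / 2) / tg s i)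
   (score y t (idx_g i) ord0 * tg v i - tx t i / tg t i * tx v i).
  have gN0 : tg t i != 0 by rewrite gt_eqF.
  have Dg := is_derive_coord (idx_g i) t v.
  have Dx := is_derive_coord (idx_x i) t v.
  have Dl := is_derive_funln (f := fun s : V => tg s i) (g0 i) Dg.
  have Di := is_derive_funV (f := fun s : V => tg s i) gN0 Dg.
  have Dq := is_derive_funM (is_derive_funX 2 Dx) (is_derive_cst (2^-1 : R) t v).
  apply: (is_derive_eq (is_derive_funB (is_derive_funD (is_derive_cst c0 t v) (is_derive_funZ c1 Dl))
     (is_derive_funM (is_derive_funD (is_derive_cst c2 t v) Dq) Di))).
  by rewrite /score paramE mxE /=; field.
apply: (is_derive_eq (is_derive_funD (is_derive_funB D1 D2) (is_derive_funsum D3))).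
rewrite sumrB big_split_ord big_ord1 big_split_ord /=.
rewrite -/idx_xi -!/(idx_x _) -!/(idx_g _).
under [X in _ = X + _ + _]eq_bigr do rewrite -/(idx_x _) {1}/score paramE mxE mulrBl.
rewrite sumrB -!/(idx_g _).
have -> : \sum_(i < L) (\sum_k Phi k i * resid y t k) / txi t * tx v i =
    (\sum_k resid y t k * dresid v k) / txi t.
  by rewrite -sum_resid mulr_suml; apply: eq_bigr => i _; rewrite mulrAC.
rewrite {3}/score paramE.
move: (\sum_k resid y t k ^+ 2) (\sum_k resid y t k * dresid v k) (\sum_(i < L) _) (\sum_(i < L) _) => a b c e.
by move: (@pi R) (pi_gt0 R) => p p0; field; rewrite !gt_eqF.
Qed.

Lemma is_derive_score y t v i : positive_param t ->
  is_derive t v (fun s => score y s i ord0) (dscore y t v i ord0).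
Proof.
move=> [g0 xi0]; have xiN0 : txi t != 0 by rewrite gt_eqF.
have Dxi := is_derive_coord idx_xi t v.
have DVxi := is_derive_funV (f := fun s : V => txi s) xiN0 Dxi.
move: i; apply: idx_ind => [j|j|]; rewrite /score /dscore !paramE ?mxE.
- under eq_fun do rewrite paramE mxE.
  have Dx := is_derive_coord (idx_x j) t v.
  have Dg := is_derive_coord (idx_g j) t v.
  have gN0 : tg t j != 0 by rewrite gt_eqF.
  have DVg := is_derive_funV (f := fun s : V => tg s j) gN0 Dg.
  have Dr : is_derive t v (fun s => \sum_k Phi k j * resid y s k)
      (- \sum_k Phi k j * dresid v k).
    rewrite -sumrN; apply: is_derive_funsum => k; rewrite -mulrN.
    exact/is_derive_funZ/is_derive_resid.
  apply: (is_derive_eq (is_derive_funB (is_derive_funM Dr DVxi) (is_derive_funM Dx DVg))).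
  by field; rewrite xiN0 gN0.
- under eq_fun do rewrite paramE mxE.
  have Dx := is_derive_coord (idx_x j) t v.
  have Dg := is_derive_coord (idx_g j) t v.
  have gN0 : tg t j != 0 by rewrite gt_eqF.
  have gN02 : tg t j ^+ 2 != 0 by rewrite expf_neq0.
  have DVg := is_derive_funV (f := fun s : V => tg s j) gN0 Dg.
  have DVg2 := is_derive_funV (f := fun s : V => tg s j ^+ 2) gN02 (is_derive_funX 2 Dg).
  have Dq := is_derive_funD (is_derive_cst c2 t v)
    (is_derive_funM (is_derive_funX 2 Dx) (is_derive_cst (2^-1 : R) t v)).
  apply: (is_derive_eq (is_derive_funD (is_derive_funZ c1 DVg) (is_derive_funM Dq DVg2))).
  by rewrite /=; field.
- under eq_fun do rewrite paramE.
  have xi2 : 2 * txi t != 0 by rewrite mulf_neq0.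
  have xi22 : 2 * txi t ^+ 2 != 0 by rewrite mulf_neq0// expf_neq0.
  have DV1 := is_derive_funV (f := fun s : V => 2 * txi s) xi2 (is_derive_funZ 2 Dxi).
  have DV2 := is_derive_funV (f := fun s : V => 2 * txi s ^+ 2) xi22 (is_derive_funZ 2 (is_derive_funX 2 Dxi)).
  apply: (is_derive_eq (is_derive_funB (is_derive_funM (is_derive_sqresid y t v) DV2)
    (is_derive_funZ N%:R DV1))).
  by rewrite /=; field.
Qed.

End log_likelihood.

Section score_entries.
Context {R : realType} {N L : nat}.
Variables (Phi : 'M[R]_(N, L)) (c1 c2 : R).
Implicit Types (y : 'cV[R]_N) (t v : 'cV[R]_(L + L + 1)).

Lemma scoreE_x y t j : score Phi c1 c2 y t (idx_x j) ord0 =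
  (\sum_k Phi k j * resid Phi y t k) / t idx_xi ord0 - t (idx_x j) ord0 / t (idx_g j) ord0.
Proof. by rewrite /score paramE mxE. Qed.

Lemma scoreE_g y t j : score Phi c1 c2 y t (idx_g j) ord0 =
  c1 / t (idx_g j) ord0 + (c2 + t (idx_x j) ord0 ^+ 2 / 2) / t (idx_g j) ord0 ^+ 2.
Proof. by rewrite /score paramE mxE. Qed.

Lemma scoreE_xi y t : score Phi c1 c2 y t idx_xi ord0 =
  (\sum_k resid Phi y t k ^+ 2) / (2 * t idx_xi ord0 ^+ 2) - N%:R / (2 * t idx_xi ord0).
Proof. by rewrite /score paramE. Qed.

Lemma dscoreE_x y t v j : dscore Phi c1 c2 y t v (idx_x j) ord0 =
  - (\sum_k Phi k j * dresid Phi v k) / t idx_xi ord0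
  - (\sum_k Phi k j * resid Phi y t k) * v idx_xi ord0 / t idx_xi ord0 ^+ 2
  - v (idx_x j) ord0 / t (idx_g j) ord0
  + t (idx_x j) ord0 * v (idx_g j) ord0 / t (idx_g j) ord0 ^+ 2.
Proof. by rewrite /dscore paramE mxE. Qed.

Lemma dscoreE_g y t v j : dscore Phi c1 c2 y t v (idx_g j) ord0 =
  - c1 * v (idx_g j) ord0 / t (idx_g j) ord0 ^+ 2
  + t (idx_x j) ord0 * v (idx_x j) ord0 / t (idx_g j) ord0 ^+ 2
  - (2 * c2 + t (idx_x j) ord0 ^+ 2) * v (idx_g j) ord0 / t (idx_g j) ord0 ^+ 3.
Proof. by rewrite /dscore paramE mxE. Qed.

Lemma dscoreE_xi y t v : dscore Phi c1 c2 y t v idx_xi ord0 =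
  N%:R * v idx_xi ord0 / (2 * t idx_xi ord0 ^+ 2)
  - (\sum_k resid Phi y t k ^+ 2) * v idx_xi ord0 / t idx_xi ord0 ^+ 3
  - (\sum_k resid Phi y t k * dresid Phi v k) / t idx_xi ord0 ^+ 2.
Proof. by rewrite /dscore paramE. Qed.

End score_entries.

(** The function f agrees with [loglik] on positive parameters only. This set is open, so both
    functions have the same derivative near every positive point, which is needed at all s near t
    for the outer derivative. *)
Lemma hessian_loglik (R : realType) (N L : nat) (Phi : 'M[R]_(N, L)) (c0 c1 c2 : R)
    (y : 'cV[R]_N) (f : 'cV[R]_(L + L + 1) -> R) (t : 'cV[R]_(L + L + 1)) :
  (forall s, positive_param s -> f s = loglik Phi c0 c1 c2 y s) -> positive_param t ->
  hessian f t = \matrix_(i, j) dscore Phi c1 c2 y t (delta_mx i ord0) j ord0.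
Proof.
move=> fE tpos; apply/matrixP => i j; rewrite [LHS]mxE [RHS]mxE.
rewrite (@near_eq_derive _ _ _ _ (fun s => score Phi c1 c2 y s j ord0)).
  by have [_ ->] := is_derive_score Phi c1 c2 y (delta_mx i ord0) j tpos.
near=> s; have spos : positive_param s by near: s; exact: positive_param_near.
rewrite (@near_eq_derive _ _ _ _ (loglik Phi c0 c1 c2 y)).
  have [_ ->] := is_derive_loglik Phi c0 c1 c2 y (delta_mx j ord0) spos.
  rewrite (bigD1 j)//= [X in _ * X + _]mxE !eqxx mulr1 big1 ?addr0// => k kj.
  by rewrite [X in _ * X]mxE (negbTE kj) mulr0.
near=> u; apply: fE; near: u; exact: positive_param_near.
Unshelve. all: by end_near. Qed.

Section exponential_form.
Context {R : realType}.

Lemma inv_sqrt_expR (a b : R) : a = expR (2 * b) -> (Num.sqrt a)^-1 = expR (- b).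
Proof.
move=> ->; rewrite expRN (_ : expR (2 * b) = expR b ^+ 2); last by rewrite expRM_natl.
by rewrite sqrtr_sqr ger0_norm ?expR_ge0.
Qed.

Lemma gauss_pdf_scalar n (m u : 'cV[R]_n) (xi : R) : 0 < xi ->
  gauss_pdf m xi%:M u = expR (- (n%:R / 2 * ln (2 * pi * xi))
    - (\sum_k (u k ord0 - m k ord0) ^+ 2) / (2 * xi)).
Proof.
move=> xi0; have p0 : 0 < 2 * pi * xi by rewrite !mulr_gt0 ?pi_gt0.
rewrite /gauss_pdf det_scalar -exprMn invmx_scalar expRD; congr (_ * _).
  apply: inv_sqrt_expR.
  rewrite (_ : 2 * (n%:R / 2 * _) = ln ((2 * pi * xi) ^+ n)); last first.
    by rewrite lnXn// -mulr_natl; move: (ln _) => l; field.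
  by rewrite lnK// posrE exprn_gt0.
congr expR; rewrite mulNr; congr (- _).
rewrite mul_mx_scalar -scalemxAl mxE mxE.
under eq_bigr do rewrite !mxE -expr2.
by field; rewrite gt_eqF.
Qed.

Lemma invmx_diag n (g : 'rV[R]_n) : (forall i, g ord0 i != 0) ->
  invmx (diag_mx g) = diag_mx (\row_i (g ord0 i)^-1).
Proof.
move=> g0; have gg : diag_mx g *m diag_mx (\row_i (g ord0 i)^-1) = 1%:M.
  rewrite mulmx_diag -diag_const_mx; congr diag_mx; apply/rowP => i.
  by rewrite !mxE mulfV.
have [gu _] := mulmx1_unit gg.
by rewrite -[LHS]mulmx1 -gg mulmxA mulVmx// mul1mx.
Qed.

Lemma source_pdfE L (g x : 'cV[R]_L) : positive_vec g ->
  source_pdf g x = expR (\sum_i (- (ln (2 * pi) / 2) + - 2^-1 * ln (g i ord0)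
    - (0 + x i ord0 ^+ 2 / 2) / g i ord0)).
Proof.
move=> g0; have p0 : 0 < 2 * pi :> R by rewrite mulr_gt0 ?pi_gt0.
rewrite (eq_bigr (fun i => - (ln (2 * pi) / 2) - ln (g i ord0) / 2
    - (x i ord0 ^+ 2 / 2) / g i ord0)); last first.
  by move=> i _; rewrite add0r mulNr (mulrC 2^-1).
rewrite /source_pdf /gauss_pdf det_diag sumrB expRD; congr (_ * _).
  under [X in _ = expR X]eq_bigr do rewrite -opprD.
  rewrite sumrN; apply: inv_sqrt_expR.
  rewrite mulr_sumr expR_sum -[L in _ ^+ L]card_ord -prodr_const -big_split /=.
  apply: eq_bigr => i _; rewrite mxE -mulrDl mulrCA divff// mulr1 expRD.
  by rewrite !lnK// posrE.
rewrite invmx_diag; last by move=> i; rewrite mxE gt_eqF.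
congr expR; rewrite mulNr; congr (- _); rewrite subr0 mul_mx_diag mxE mulr_suml.
by apply: eq_bigr => i _; rewrite !mxE; field; rewrite gt_eqF.
Qed.

Lemma invgamma_pdfE (a b g : R) : 0 < Gamma a -> 0 < b -> 0 < g ->
  invgamma_pdf a b g = expR (- ln (Gamma a) + a * ln b - (a + 1) * ln g - b / g).
Proof.
move=> G0 b0 g0; rewrite /invgamma_pdf g0 !expRD (expRN (ln (Gamma a))) lnK// /powR !gt_eqF//.
by congr (_ * _ * expR _ * _); ring.
Qed.

Definition c0_rand (nu lam : R) : R :=
  - (ln (2 * pi) / 2) - ln (Gamma (nu / 2)) + nu / 2 * ln (nu / (2 * lam)).
Definition c1_rand (nu : R) : R := - 2^-1 - (nu / 2 + 1).
Definition c2_rand (nu lam : R) : R := nu / (2 * lam).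

Lemma source_hyper_pdfE L (nu lam : R) (g x : 'cV[R]_L) :
  0 < nu -> 0 < lam -> 0 < Gamma (nu / 2) -> positive_vec g ->
  source_pdf g x * hyper_pdf nu lam g = expR (\sum_i (c0_rand nu lam +
    c1_rand nu * ln (g i ord0) - (c2_rand nu lam + x i ord0 ^+ 2 / 2) / g i ord0)).
Proof.
move=> nu0 lam0 G0 g0; rewrite source_pdfE// /hyper_pdf.
have b0 : 0 < nu / (2 * lam) by rewrite divr_gt0// mulr_gt0.
under [X in _ * X = _]eq_bigr do rewrite invgamma_pdfE//.
rewrite -expR_sum -expRD -big_split /=; congr expR; apply: eq_bigr => i _.
rewrite /c0_rand /c1_rand /c2_rand.
move: (nu / (2 * lam)) b0 => b b0; move: (nu / 2) => a.
move: (ln (2 * pi)) (ln (Gamma a)) (ln b) (ln (g _ _)) => l1 l2 l3 l4.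
by field; rewrite gt_eqF.
Qed.

End exponential_form.

Section joint_densities.
Context {R : realType} {N L : nat}.
Variable Phi : 'M[R]_(N, L).
Implicit Types (y : 'cV[R]_N) (t : 'cV[R]_(L + L + 1)).

Lemma residE y t k : resid Phi y t k = y k ord0 - (Phi *m param_x t) k ord0.
Proof.
by rewrite /resid mxE; congr (_ - _); apply: eq_bigr => i _; rewrite /param_x !mxE.
Qed.

Lemma param_xiE t : param_xi t = t idx_xi ord0.
Proof. by rewrite /param_xi mxE. Qed.

Lemma param_gamE t i : param_gam t i ord0 = t (idx_g i) ord0.
Proof. by rewrite /param_gam !mxE. Qed.

Lemma param_xE t i : param_x t i ord0 = t (idx_x i) ord0.
Proof. by rewrite /param_x !mxE. Qed.

Lemma gauss_pdf_loglik (c0 c1 c2 : R) y t : positive_param t ->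
  gauss_pdf (Phi *m param_x t) (param_xi t)%:M y *
    expR (\sum_i (c0 + c1 * ln (param_gam t i ord0) -
      (c2 + param_x t i ord0 ^+ 2 / 2) / param_gam t i ord0)) =
  expR (loglik Phi c0 c1 c2 y t).
Proof.
move=> [_ xi0]; rewrite param_xiE gauss_pdf_scalar// -expRD /loglik.
have -> : \sum_k resid Phi y t k ^+ 2 = \sum_k (y k ord0 - (Phi *m param_x t) k ord0) ^+ 2.
  by apply: eq_bigr => k _; rewrite residE.
by under [X in expR (_ + X) = _]eq_bigr do rewrite param_gamE param_xE.
Qed.

Lemma joint_pdf_detE y t : positive_param t ->
  joint_pdf_det Phi y t = expR (loglik Phi (- (ln (2 * pi) / 2)) (- 2^-1) 0 y t).
Proof.
move=> tpos; rewrite /joint_pdf_det source_pdfE; first exact: gauss_pdf_loglik.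
by move=> i; rewrite param_gamE; apply: tpos.1.
Qed.

Lemma joint_pdf_randE (nu lam : R) y t : 0 < nu -> 0 < lam -> 0 < Gamma (nu / 2) ->
  positive_param t -> joint_pdf_rand nu lam Phi y t =
  expR (loglik Phi (c0_rand nu lam) (c1_rand nu) (c2_rand nu lam) y t).
Proof.
move=> nu0 lam0 G0 tpos; rewrite /joint_pdf_rand -mulrA source_hyper_pdfE//.
  exact: gauss_pdf_loglik.
by move=> i; rewrite param_gamE; apply: tpos.1.
Qed.

End joint_densities.

(** * Square-integrable scores and the Cramer-Rao inequality *)

Section square_integrable.
Context {R : realType} {d : measure_display} {Omega : measurableType d}.
Variable P : probability Omega R.
Implicit Types f g : Omega -> R.

Definition L2 f := measurable_fun setT f /\
  P.-integrable setT (EFin \o (fun w => f w ^+ 2)).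

Definition L1 f := P.-integrable setT (EFin \o f).

Lemma L1_measurable f : L1 f -> measurable_fun setT f.
Proof. by move=> /integrableP[/measurable_EFinP]. Qed.

Lemma L1_le f g : measurable_fun setT f -> L1 g -> (forall w, `|f w| <= g w) -> L1 f.
Proof.
move=> mf ig fg; apply: le_integrable ig => //; first exact/measurable_EFinP.
by move=> w _; rewrite lee_fin (le_trans (fg w))// ler_norm.
Qed.

Lemma L1_ge0 f : measurable_fun setT f -> (forall w, 0 <= f w) ->
  (\int[P]_w (f w)%:E < +oo)%E -> L1 f.
Proof.
move=> mf f0 foo; apply/integrableP; split; first exact/measurable_EFinP.
by under eq_integral do rewrite /= ger0_norm//.
Qed.

Lemma L1D f g : L1 f -> L1 g -> L1 (fun w => f w + g w).
Proof.
move=> if1 ig; rewrite /L1 (_ : _ \o _ = (fun w => (f w)%:E + (g w)%:E)%E)//.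
exact: integrableD.
Qed.

Lemma L1Z (c : R) f : L1 f -> L1 (fun w => c * f w).
Proof.
move=> if1; rewrite /L1 (_ : _ \o _ = (fun w => c%:E * (f w)%:E)%E)//.
exact: integrableZl.
Qed.

Lemma L1N f : L1 f -> L1 (fun w => - f w).
Proof. by move=> /(L1Z (-1)); under eq_fun do rewrite mulN1r. Qed.

Lemma L1B f g : L1 f -> L1 g -> L1 (fun w => f w - g w).
Proof. by move=> if1 ig; apply: L1D => //; exact: L1N. Qed.

Lemma L1_cst (c : R) : L1 (fun=> c).
Proof. exact: finite_measure_integrable_cst. Qed.

Lemma L1_sum I (r : seq I) (f : I -> Omega -> R) : (forall i, L1 (f i)) ->
  L1 (fun w => \sum_(i <- r) f i w).
Proof.
move=> if1; elim: r => [|i r IH].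
  by under eq_fun do rewrite big_nil; exact: L1_cst.
by under eq_fun do rewrite big_cons; exact: L1D.
Qed.

Lemma L2M_L1 f g : L2 f -> L2 g -> L1 (fun w => f w * g w).
Proof.
move=> [mf if2] [mg ig2]; apply: (L1_le _ (L1D if2 ig2)); first exact: measurable_funM.
move=> w; rewrite normrM -(real_normK (num_real (f w))) -(real_normK (num_real (g w))).
have := sqr_ge0 (`|f w| - `|g w|).
have : 0 <= `|f w| * `|g w| by rewrite mulr_ge0.
by rewrite sqrrB; move: (_ * _) (_ ^+ 2) (_ ^+ 2) => a b c; lra.
Qed.

Lemma L2_cst (c : R) : L2 (fun=> c).
Proof. by split => //; exact: L1_cst. Qed.

Lemma L2_L1 f : L2 f -> L1 f.
Proof. by move=> /L2M_L1/(_ (L2_cst 1)); under eq_fun do rewrite mulr1. Qed.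

Lemma L2Z (c : R) f : L2 f -> L2 (fun w => c * f w).
Proof.
move=> [mf if2]; split; first exact: measurable_funM.
by under eq_fun do rewrite exprMn; exact: L1Z.
Qed.

Lemma L2D f g : L2 f -> L2 g -> L2 (fun w => f w + g w).
Proof.
move=> hf hg; have fg := L2M_L1 hf hg; case: hf hg => mf if2 [mg ig2].
split; first exact: measurable_funD.
rewrite -/(L1 _) (_ : (fun _ => _) = (fun w => f w ^+ 2 + 2 * (f w * g w) + g w ^+ 2)).
  by apply: L1D => //; apply: L1D => //; exact: L1Z.
by apply/funext => w; rewrite sqrrD mulr_natl.
Qed.

Lemma L2N f : L2 f -> L2 (fun w => - f w).
Proof. by move=> /(L2Z (-1)); under eq_fun do rewrite mulN1r. Qed.

Lemma L2B f g : L2 f -> L2 g -> L2 (fun w => f w - g w).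
Proof. by move=> hf hg; apply: L2D => //; exact: L2N. Qed.

Lemma L2_sum I (r : seq I) (f : I -> Omega -> R) : (forall i, L2 (f i)) ->
  L2 (fun w => \sum_(i <- r) f i w).
Proof.
move=> hf; elim: r => [|i r IH].
  by under eq_fun do rewrite big_nil; exact: L2_cst.
by under eq_fun do rewrite big_cons; exact: L2D.
Qed.

(** The measure is finite, so a finite fourth moment gives a finite second one. *)
Lemma L2_sqr f : measurable_fun setT f -> L2 (fun w => f w ^+ 2) -> L2 f.
Proof. by move=> mf /L2_L1. Qed.

Lemma Rintegral_sumE I (r : seq I) (f : I -> Omega -> R) : (forall i, L1 (f i)) ->
  \int[P]_w (\sum_(i <- r) f i w) = \sum_(i <- r) \int[P]_w f i w.
Proof.
move=> if1; elim: r => [|i r IH].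
  under eq_Rintegral do rewrite big_nil.
  by rewrite big_nil Rintegral_cst// mul0r.
under eq_Rintegral do rewrite big_cons.
rewrite big_cons -IH RintegralD//; [exact: if1|exact: L1_sum].
Qed.

Lemma Rintegral_cst1 (c : R) : \int[P]_w c = c.
Proof. by rewrite Rintegral_cst//= probability_setT mulr1. Qed.

End square_integrable.

Section hybrid_cramer_rao.
Context {R : realType} {d : measure_display} {Omega : measurableType d}.
Variable P : probability Omega R.

(* E[(v.e + u.s)^2] >= 0 for u = H^-1 v. *)
Lemma hybrid_cramer_rao k (e s : 'I_k -> Omega -> R) (H M : 'M[R]_k) :
  (forall i, L2 P (e i)) -> (forall i, L2 P (s i)) ->
  (forall i j, \int[P]_w (e i w * s j w) = - (i == j)%:R) ->
  (forall i j, \int[P]_w (s i w * s j w) = H i j) ->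
  (forall i j, \int[P]_w (e i w * e j w) = M i j) ->
  H \in unitmx -> mxge M (invmx H).
Proof.
move=> e2 s2 es ss ee Hu.
have HT : H^T = H.
  by apply/matrixP => i j; rewrite mxE -!ss; apply: eq_Rintegral => w _; rewrite mulrC.
have HiT : (invmx H)^T = invmx H by rewrite trmx_inv HT.
have MT : M^T = M.
  by apply/matrixP => i j; rewrite mxE -!ee; apply: eq_Rintegral => w _; rewrite mulrC.
split; first by rewrite linearB /= HiT MT.
move=> v; pose u := invmx H *m v.
have quad (f g : 'I_k -> Omega -> R) (A : 'M[R]_k) (a b : 'cV[R]_k) :
    (forall i, L2 P (f i)) -> (forall i, L2 P (g i)) ->
    (forall i j, \int[P]_w (f i w * g j w) = A i j) ->
    \int[P]_w ((\sum_i a i ord0 * f i w) * (\sum_j b j ord0 * g j w)) =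
    (a^T *m A *m b) ord0 ord0.
  move=> f2 g2 fg; have fg1 i j := L2M_L1 (f2 i) (g2 j).
  transitivity (\int[P]_w \sum_i \sum_j (a i ord0 * b j ord0) * (f i w * g j w)).
    apply: eq_Rintegral => w _; rewrite mulr_suml; apply: eq_bigr => i _.
    by rewrite mulr_sumr; apply: eq_bigr => j _; ring.
  rewrite Rintegral_sumE; last first.
    by move=> i; apply: L1_sum => j; exact: L1Z.
  under eq_bigr => i _.
    rewrite Rintegral_sumE; last by move=> j; exact: L1Z.
    under eq_bigr => j _.
      rewrite RintegralZl//; last exact: fg1. rewrite fg; over.
    over.
  rewrite exchange_big mxE; apply: eq_bigr => j _; rewrite mxE mulr_suml.
  by apply: eq_bigr => i _; rewrite mxE; ring.
pose ev w := \sum_i v i ord0 * e i w; pose su w := \sum_i u i ord0 * s i w.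
have ev2 : L2 P ev by apply: L2_sum => i; exact: L2Z.
have su2 : L2 P su by apply: L2_sum => i; exact: L2Z.
have : 0 <= \int[P]_w (ev w + su w) ^+ 2.
  by apply: Rintegral_ge0 => w _; exact: sqr_ge0.
have -> : \int[P]_w (ev w + su w) ^+ 2 =
    \int[P]_w (ev w * ev w + 2 * (ev w * su w) + su w * su w).
  by apply: eq_Rintegral => w _; ring.
have i1 := L2M_L1 ev2 ev2; have i2 := L2M_L1 ev2 su2; have i3 := L2M_L1 su2 su2.
rewrite RintegralD//; last by apply: L1D => //; exact: L1Z.
rewrite RintegralD//; last exact: L1Z.
rewrite RintegralZl// (quad e e M)// (quad e s (- 1%:M))//; last first.
  by move=> i j; rewrite es !mxE.
rewrite (quad s s H)//.
have uE : u^T *m H = v^T by rewrite trmx_mul HiT -mulmxA mulVmx// mulmx1.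
have subE (A B : 'M[R]_1) : (A - B) ord0 ord0 = A ord0 ord0 - B ord0 ord0.
  by rewrite [LHS]mxE; congr (_ + _); rewrite mxE.
have oppE (A : 'M[R]_1) : (- A) ord0 ord0 = - A ord0 ord0 by rewrite mxE.
rewrite uE mulmxN mulmx1 mulNmx oppE mulmxBr mulmxBl subE -[in X in _ -> 0 <= _ - X]mulmxA -/u.
by move: ((v^T *m M *m v) ord0 ord0) ((v^T *m u) ord0 ord0) => a b; lra.
Qed.

End hybrid_cramer_rao.

(** * The joint density of observations, sources and scales *)

Section hybrid_density.
Context {R : realType} {N L : nat}.
Local Notation T := (N.-tuple R * (L.-tuple R * L.-tuple R))%type.
Variables (c0 c1 c2 : R).
Implicit Types (Phi : 'M[R]_(N, L)) (xi : R) (z : T).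

Definition noise_pdf xi (u : N.-tuple R) : R :=
  expR (- (N%:R / 2 * ln (2 * pi * xi)) - (\sum_k tnth u k ^+ 2) / (2 * xi)).

Definition positive_tuple (g : L.-tuple R) : bool := [forall i, 0 < tnth g i].

Definition prior_exponent (v : L.-tuple R * L.-tuple R) : R :=
  \sum_i (c0 + c1 * ln (tnth v.2 i) - (c2 + tnth v.1 i ^+ 2 / 2) / tnth v.2 i).

(** Density of (x, gamma) with respect to the reference measure of the model. The cut-off to 0 is
    needed where some gamma_i <= 0, since there the exponent is built from default values of the
    logarithm and has no meaning. *)
Definition prior_pdf (v : L.-tuple R * L.-tuple R) : R :=
  if positive_tuple v.2 then expR (prior_exponent v) else 0.

Definition signal Phi (x : L.-tuple R) : N.-tuple R :=
  [tuple (Phi *m colv x) i ord0 | i < N].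

Definition theta_of xi z : 'cV[R]_(L + L + 1) := param (colv z.2.1) (colv z.2.2) xi.

(** Phi is an explicit argument because Phi = 0 turns this into the density of (n, (x, gamma)), from
    which the moments of noise and sources are obtained. *)
Definition hyb_pdf Phi xi z : R :=
  noise_pdf xi (tsub z.1 (signal Phi z.2.1)) * prior_pdf z.2.

Lemma tnth_tsub_signal Phi xi z k :
  tnth (tsub z.1 (signal Phi z.2.1)) k = resid Phi (colv z.1) (theta_of xi z) k.
Proof.
rewrite !tnth_mktuple /resid !mxE; congr (_ - _).
by apply: eq_bigr => i _; rewrite paramE.
Qed.

Lemma hyb_pdfE Phi xi z : hyb_pdf Phi xi z =
  if positive_tuple z.2.2 then expR (loglik Phi c0 c1 c2 (colv z.1) (theta_of xi z)) else 0.
Proof.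
rewrite /hyb_pdf /prior_pdf; case: ifP => _; last by rewrite mulr0.
rewrite -expRD /loglik paramE /prior_exponent.
under eq_bigr do rewrite (tnth_tsub_signal _ xi).
rewrite [X in _ = expR (_ + X)](eq_bigr (fun i => c0 + c1 * ln (tnth z.2.2 i) -
  (c2 + tnth z.2.1 i ^+ 2 / 2) / tnth z.2.2 i))// => i _.
by rewrite !paramE !mxE.
Qed.

Lemma positive_theta xi z : 0 < xi -> positive_tuple z.2.2 -> positive_param (theta_of xi z).
Proof.
move=> xi0 /forallP g0; split; last by rewrite paramE.
by move=> j; rewrite paramE mxE.
Qed.

Lemma noise_pdf_ge0 xi u : 0 <= noise_pdf xi u.
Proof. exact: expR_ge0. Qed.

Lemma prior_pdf_ge0 v : 0 <= prior_pdf v.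
Proof. by rewrite /prior_pdf; case: ifP => // _; exact: expR_ge0. Qed.

Lemma hyb_pdf_ge0 Phi xi z : 0 <= hyb_pdf Phi xi z.
Proof. by rewrite mulr_ge0 ?noise_pdf_ge0 ?prior_pdf_ge0. Qed.

Lemma measurable_tnthf d (S : measurableType d) n (f : S -> n.-tuple R) i :
  measurable_fun setT f -> measurable_fun setT (fun s => tnth (f s) i).
Proof. by move=> /measurable_fun_tnthP mf; exact: mf. Qed.

Lemma measurable_obs_coord k : measurable_fun setT (fun z => tnth z.1 k).
Proof. by apply: measurable_tnthf; exact: measurable_fst. Qed.

Lemma measurable_source_coord j : measurable_fun setT (fun z => tnth z.2.1 j).
Proof. by apply: measurable_tnthf; exact: measurableT_comp. Qed.

Lemma measurable_scale_coord j : measurable_fun setT (fun z => tnth z.2.2 j).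
Proof. by apply: measurable_tnthf; exact: measurableT_comp. Qed.

Lemma measurable_noise_pdf xi : measurable_fun setT (noise_pdf xi).
Proof.
apply: measurableT_comp => //; apply: measurable_funB => //.
apply: measurable_funM => //; apply: measurable_sum => k.
by apply: measurable_funX; exact: measurable_tnth.
Qed.

Lemma measurable_positive_tuple d (S : measurableType d) (f : S -> L.-tuple R) :
  measurable_fun setT f -> measurable_fun setT (fun s => positive_tuple (f s)).
Proof.
move=> mf; rewrite (_ : (fun _ => _) = (fun s => \big[andb/true]_i (0 < tnth (f s) i))); last first.
  by apply/funext => s; rewrite /positive_tuple big_andE.
elim: (index_enum _) => [|i r IH]; first by under eq_fun do rewrite big_nil; exact: measurable_cst.
under eq_fun do rewrite big_cons; apply: measurable_and => //.
by apply: measurable_fun_ltr => //; exact: measurable_tnthf.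
Qed.

Lemma measurable_prior_pdf : measurable_fun setT prior_pdf.
Proof.
apply: measurable_fun_ifT => //; first exact: measurable_positive_tuple.
apply: measurableT_comp => //; apply: measurable_sum => i.
have m1 : measurable_fun setT (fun v : L.-tuple R * L.-tuple R => tnth v.1 i).
  exact: measurable_tnthf.
have m2 : measurable_fun setT (fun v : L.-tuple R * L.-tuple R => tnth v.2 i).
  exact: measurable_tnthf.
apply: measurable_funB.
  apply: measurable_funD => //; apply: measurable_funM => //.
  by apply: measurableT_comp.
apply: measurable_funM; last exact: measurable_funV.
apply: measurable_funD => //; apply: measurable_funM => //; exact: measurable_funX.
Qed.

Lemma measurable_signal Phi d (S : measurableType d) (f : S -> L.-tuple R) :
  measurable_fun setT f -> measurable_fun setT (fun s => signal Phi (f s)).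
Proof.
move=> mf; apply/measurable_fun_tnthP => k.
rewrite (_ : _ \o _ = (fun s => \sum_i Phi k i * tnth (f s) i)).
  by apply: measurable_sum => i; apply: measurable_funM => //; exact: measurable_tnthf.
by apply/funext => s /=; rewrite tnth_mktuple mxE; apply: eq_bigr => i _; rewrite mxE.
Qed.

Lemma measurable_hyb_pdf Phi xi : measurable_fun setT (hyb_pdf Phi xi).
Proof.
apply: measurable_funM; last exact: (measurableT_comp measurable_prior_pdf).
apply: (measurableT_comp (measurable_noise_pdf xi)); apply: measurable_tsub => //.
apply: measurable_signal; exact: (measurableT_comp (@measurable_fst _ _ _ _)).
Qed.

End hybrid_density.

Lemma observationE (R : realType) N L (Phi : 'M[R]_(N, L)) x n :
  observation Phi x n = tadd n (signal Phi x).
Proof. by apply: eq_from_tnth => k; rewrite !tnth_mktuple !mxE addrC. Qed.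

Section slices_in_a_source_coordinate.
Context {R : realType} {N L : nat}.
Local Notation T := (N.-tuple R * (L.-tuple R * L.-tuple R))%type.
Variables (c0 c1 c2 : R) (Phi : 'M[R]_(N, L)) (xi : R).
Hypothesis xi0 : 0 < xi.
Implicit Types (z : T) (t : R).

Definition upd_x (j : 'I_L) z t : T := (z.1, (tset j z.2.1 t, z.2.2)).

Lemma is_derive_slice (V : normedModType R) (f : V -> R) (c : R -> V) (v : V) t df :
  (forall h, c (h + t) = h *: v + c t) -> is_derive (c t) v f df ->
  is_derive t 1 (fun s => f (c s)) df.
Proof.
move=> cE Df; apply/is_derive_line; move/is_derive_line: Df.
by rewrite (_ : (fun h => f (h *: v + _)) = (fun h : R => f (c (h *: (1 : R) + t))))// funeqE => h; rewrite -[h%:A]/(h * 1) mulr1 cE.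
Qed.

Lemma theta_upd_x j z t h :
  theta_of xi (upd_x j z (h + t)) = h *: delta_mx (idx_x j) ord0 + theta_of xi (upd_x j z t).
Proof.
apply/colP => i.
have -> : (h *: delta_mx (idx_x j) ord0 + theta_of xi (upd_x j z t)) i ord0 =
    h * (i == idx_x j)%:R + theta_of xi (upd_x j z t) i ord0.
  by rewrite [LHS]mxE; congr (_ + _); rewrite mxE mxE eqxx andbT.
move: i; apply: idx_ind => [i|i|]; rewrite !paramE ?eq_idx ?mxE ?mulr0 ?add0r//.
by rewrite /= !tnth_tset; case: (i == j); rewrite ?mulr1 ?mulr0 ?add0r.
Qed.

Lemma polyfun_tset n (j : 'I_n) (u : n.-tuple R) i : polyfun (fun t => tnth (tset j u t) i).
Proof.
under eq_fun do rewrite tnth_tset; case: (i == j); first exact: polyfun_id.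
exact: polyfun_cst.
Qed.

Lemma polyfun_theta_x j z i : polyfun (fun t => theta_of xi (upd_x j z t) i ord0).
Proof.
move: i; apply: idx_ind => [i|i|]; under eq_fun do rewrite paramE ?mxE.
- exact: polyfun_tset.
- exact: (polyfun_cst (tnth z.2.2 i)).
- exact: polyfun_cst.
Qed.

Lemma polyfun_resid_x y j z k : polyfun (fun t => resid Phi y (theta_of xi (upd_x j z t)) k).
Proof.
apply: polyfunB; first exact: polyfun_cst.
by apply: polyfun_sum => i; apply: polyfunM; [exact: polyfun_cst|exact: polyfun_theta_x].
Qed.

Lemma polyfun_sqresid_x y j z :
  polyfun (fun t => \sum_k resid Phi y (theta_of xi (upd_x j z t)) k ^+ 2).
Proof. by apply: polyfun_sum => k; apply: polyfunX; exact: polyfun_resid_x. Qed.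

Lemma theta_upd_x_g j z t i : theta_of xi (upd_x j z t) (idx_g i) ord0 = tnth z.2.2 i.
Proof. by rewrite paramE mxE. Qed.

Lemma theta_upd_x_xi j z t : theta_of xi (upd_x j z t) idx_xi ord0 = xi.
Proof. by rewrite paramE. Qed.

Lemma polyfun_score_x y j z i :
  polyfun (fun t => score Phi c1 c2 y (theta_of xi (upd_x j z t)) i ord0).
Proof.
move: i; apply: idx_ind => [i|i|].
- under eq_fun do rewrite scoreE_x theta_upd_x_g theta_upd_x_xi.
  apply: polyfunB; apply: polyfunM; try exact: polyfun_cst.
    apply: polyfun_sum => k; apply: polyfunM; first exact: polyfun_cst.
    exact: polyfun_resid_x.
  exact: polyfun_theta_x.
- under eq_fun do rewrite scoreE_g theta_upd_x_g.
  apply: polyfunD; first exact: polyfun_cst.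
  apply: polyfunM; last exact: polyfun_cst.
  apply: polyfunD; first exact: polyfun_cst.
  apply: polyfunM; last exact: polyfun_cst.
  by apply: polyfunX; exact: polyfun_theta_x.
- under eq_fun do rewrite scoreE_xi theta_upd_x_xi.
  apply: polyfunB; last exact: polyfun_cst.
  apply: polyfunM; last exact: polyfun_cst.
  exact: polyfun_sqresid_x.
Qed.

(** Moving x_j leaves gamma unchanged: either the density vanishes on the whole line, or minus its
    logarithm is a polynomial in x_j that dominates a positive multiple of x_j^2. *)
Lemma slice_stein_x j (phi dphi : T -> R) z :
  (positive_tuple z.2.2 -> polyfun (fun t => phi (upd_x j z t))) ->
  (positive_tuple z.2.2 -> forall t : R, is_derive t 1 (fun t => phi (upd_x j z t)) (dphi (upd_x j z t))) ->
  (\int[leb1]_t ((dphi (upd_x j z t) + phi (upd_x j z t) *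
      score Phi c1 c2 (colv z.1) (theta_of xi (upd_x j z t)) (idx_x j) ord0) *
    hyb_pdf c0 c1 c2 Phi xi (upd_x j z t))%:E = 0)%E.
Proof.
under eq_integral do rewrite hyb_pdfE /=.
case: (boolP (positive_tuple z.2.2)) => [zpos|_ _ _]; last first.
  by apply: integral0_eq => t _; rewrite mulr0.
move=> /(_ isT) pphi /(_ isT) Dphi.
have tpos t : positive_param (theta_of xi (upd_x j z t)) by exact: positive_theta.
pose Q t := - loglik Phi c0 c1 c2 (colv z.1) (theta_of xi (upd_x j z t)).
pose dQ t := - score Phi c1 c2 (colv z.1) (theta_of xi (upd_x j z t)) (idx_x j) ord0.
have g0 i : 0 < tnth z.2.2 i by move/forallP: zpos; apply.
have DQ t : is_derive t 1 Q (dQ t).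
  apply: is_derive_funN.
  apply: (is_derive_slice (v := delta_mx (idx_x j) ord0) (f := loglik Phi c0 c1 c2 (colv z.1))
    (c := fun t => theta_of xi (upd_x j z t))) => [h|]; first exact: theta_upd_x.
  apply: (is_derive_eq (is_derive_loglik Phi c0 c1 c2 (colv z.1) _ (tpos t))).
  rewrite (bigD1 (idx_x j))//= [X in _ * X + _]mxE !eqxx mulr1 big1 ?addr0// => k kj.
  by rewrite [X in _ * X]mxE (negbTE kj) mulr0.
pose q t := (\sum_k resid Phi (colv z.1) (theta_of xi (upd_x j z t)) k ^+ 2) / (2 * xi) +
   \sum_i tnth (tset j z.2.1 t) i ^+ 2 / (2 * tnth z.2.2 i).
pose K := - (N%:R / 2 * ln (2 * pi * xi)) + \sum_i (c0 + c1 * ln (tnth z.2.2 i) - c2 / tnth z.2.2 i).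
have QE t : Q t = q t - K.
  rewrite /Q /loglik /q /K theta_upd_x_xi.
  have -> : \sum_i (c0 + c1 * ln (theta_of xi (upd_x j z t) (idx_g i) ord0) -
      (c2 + theta_of xi (upd_x j z t) (idx_x i) ord0 ^+ 2 / 2) / theta_of xi (upd_x j z t) (idx_g i) ord0) =
    \sum_i (c0 + c1 * ln (tnth z.2.2 i) - c2 / tnth z.2.2 i) - \sum_i tnth (tset j z.2.1 t) i ^+ 2 / (2 * tnth z.2.2 i).
    rewrite -sumrB; apply: eq_bigr => i _; rewrite !paramE !mxE /=.
    by field; rewrite gt_eqF.
  by move: (\sum_k _) (\sum_i _) (\sum_i _) (N%:R / 2 * _) => a b e f; ring.
have pQ : polyfun Q.
  rewrite (_ : Q = fun t => q t - K); last exact/funext.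
  apply: polyfunB; last exact: polyfun_cst.
  apply: polyfunD.
    by apply: polyfunM; [exact: polyfun_sqresid_x|exact: polyfun_cst].
  apply: polyfun_sum => i; apply: polyfunM; last exact: polyfun_cst.
  by apply: polyfunX; exact: polyfun_tset.
have v0 : 0 < (2 * tnth z.2.2 j)^-1 by rewrite invr_gt0 mulr_gt0.
(* Coercivity is drawn from the prior of x_j alone; the residual term is only used as nonnegative,
   since it does not depend on x_j when column j of Phi is zero. *)
have Qc t : (2 * tnth z.2.2 j)^-1 * t ^+ 2 <= Q t + K.
  rewrite QE subrK /q (bigD1 j)//= tnth_tset eqxx mulrC addrCA lerDl addr_ge0//.
    by rewrite divr_ge0 ?mulr_ge0 ?(ltW xi0)// sumr_ge0// => k _; exact: sqr_ge0.
  by apply: sumr_ge0 => i _; rewrite divr_ge0 ?sqr_ge0// mulr_ge0// ltW.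
have H : (\int[leb1]_t ((dphi (upd_x j z t) - phi (upd_x j z t) * dQ t) * expR (- Q t))%:E = 0)%E.
  exact: (polyfun_gauss_stein pQ v0 Qc DQ pphi Dphi).
rewrite -[RHS]H; apply: eq_integral => t _; congr EFin.
by rewrite /dQ mulrN opprK /Q opprK.
Qed.

End slices_in_a_source_coordinate.

Section slices_of_the_noise_and_prior.
Context {R : realType} {N L : nat}.
Local Notation T := (N.-tuple R * (L.-tuple R * L.-tuple R))%type.
Variables (c0 c1 c2 : R) (xi : R).
Hypothesis xi0 : 0 < xi.
Implicit Types (z : T) (t : R).

Definition upd_y (k : 'I_N) z t : T := (tset k z.1 t, z.2).

Lemma signal0 (x : L.-tuple R) (y : N.-tuple R) : tsub y (signal 0 x) = y.
Proof. by apply: eq_from_tnth => k; rewrite !tnth_mktuple mul0mx mxE subr0. Qed.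

Lemma hyb_pdf0E z : hyb_pdf c0 c1 c2 0 xi z = noise_pdf xi z.1 * prior_pdf c0 c1 c2 z.2.
Proof. by rewrite /hyb_pdf signal0. Qed.

Lemma sum_tset n (j : 'I_n) (u : n.-tuple R) t (F : 'I_n -> R -> R) :
  \sum_i F i (tnth (tset j u t) i) = F j t + \sum_(i | i != j) F i (tnth u i).
Proof.
rewrite (bigD1 j)//= tnth_tset eqxx; congr (_ + _); apply: eq_bigr => i ij.
by rewrite tnth_tset (negbTE ij).
Qed.

Lemma noise_pdf_slice k (u : N.-tuple R) : exists kappa, forall t,
  noise_pdf xi (tset k u t) = expR (kappa - t ^+ 2 / (2 * xi)).
Proof.
exists (- (N%:R / 2 * ln (2 * pi * xi)) - (\sum_(i | i != k) tnth u i ^+ 2) / (2 * xi)) => t.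
rewrite /noise_pdf (sum_tset k u t (fun _ s => s ^+ 2)); congr expR.
by move: (N%:R / 2 * _) (\sum_(i | _) _) => a b; rewrite mulrDl; ring.
Qed.

Lemma prior_pdf_slice_x j (v : L.-tuple R * L.-tuple R) : positive_tuple v.2 ->
  exists kappa, forall t, prior_pdf c0 c1 c2 (tset j v.1 t, v.2) =
    expR (kappa - t ^+ 2 / (2 * tnth v.2 j)).
Proof.
move=> vpos; have g0 : 0 < tnth v.2 j by move/forallP: vpos; apply.
exists (c0 + c1 * ln (tnth v.2 j) - c2 / tnth v.2 j +
  \sum_(i | i != j) (c0 + c1 * ln (tnth v.2 i) - (c2 + tnth v.1 i ^+ 2 / 2) / tnth v.2 i)) => t.
rewrite /prior_pdf /= vpos /prior_exponent /=; congr expR.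
rewrite (sum_tset j v.1 t (fun i s => c0 + c1 * ln (tnth v.2 i) - (c2 + s ^+ 2 / 2) / tnth v.2 i)).
move: (\sum_(i | _) _) (ln _) => a b.
by field; rewrite gt_eqF.
Qed.

Lemma slice_stein_y k (phi dphi : T -> R) z :
  polyfun (fun t => phi (upd_y k z t)) ->
  (forall t : R, is_derive t 1 (fun t => phi (upd_y k z t)) (dphi (upd_y k z t))) ->
  (\int[leb1]_t ((dphi (upd_y k z t) - phi (upd_y k z t) * (tnth (upd_y k z t).1 k / xi)) *
    hyb_pdf c0 c1 c2 0 xi (upd_y k z t))%:E = 0)%E.
Proof.
move=> pphi Dphi; have [kappa nE] := noise_pdf_slice k z.1.
pose Q t := t ^+ 2 / (2 * xi) - kappa.
have pQ : polyfun Q.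
  apply: polyfunB; last exact: polyfun_cst.
  by apply: polyfunM; [apply: polyfunX; exact: polyfun_id|exact: polyfun_cst].
have DQ (t : R) : is_derive t 1 Q (t / xi).
  apply: (is_derive_eq (is_derive_funB (is_derive_funM (is_derive_funX 2 (is_derive_id t (1 : R)))
    (is_derive_cst (2 * xi)^-1 t 1)) (is_derive_cst kappa t 1))).
  by rewrite /=; field; rewrite gt_eqF.
have v0 : 0 < (2 * xi)^-1 by rewrite invr_gt0 mulr_gt0.
have Qc t : (2 * xi)^-1 * t ^+ 2 <= Q t + kappa by rewrite /Q subrK mulrC.
(* The prior is constant on a line in direction y_k, so it is moved into the test function. *)
pose C := prior_pdf c0 c1 c2 z.2.
have pphiC : polyfun (fun t => C * phi (upd_y k z t)).
  by apply: polyfunM => //; exact: polyfun_cst.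
rewrite -[RHS](polyfun_gauss_stein pQ v0 Qc DQ pphiC (fun t => is_derive_funZ C (Dphi t))).
apply: eq_integral => t _; congr EFin.
rewrite hyb_pdf0E /= nE tnth_tset eqxx /Q opprB -/C.
by ring.
Qed.

(** A positive C is absorbed into kappa as ln C; C = 0 occurs where the prior or the weight vanishes
    and is treated apart. *)
Lemma gauss_slice_moment4_scaled (v kappa C : R) : 0 < v -> 0 <= C ->
  (\int[leb1]_t (t ^+ 4 * (C * expR (kappa - t ^+ 2 / (2 * v))))%:E <=
   \int[leb1]_t (3 * v ^+ 2 * (C * expR (kappa - t ^+ 2 / (2 * v))))%:E)%E.
Proof.
move=> v0; rewrite le_eqVlt => /predU1P[<-|C0].
  by under eq_integral do rewrite mul0r mulr0; under [leRHS]eq_integral do rewrite mul0r mulr0.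
have E t : C * expR (kappa - t ^+ 2 / (2 * v)) = expR ((ln C + kappa) - t ^+ 2 / (2 * v)).
  by rewrite -addrA [RHS]expRD lnK ?posrE.
under eq_integral do rewrite E; under [leRHS]eq_integral do rewrite E.
exact: gauss_slice_moment4.
Qed.

End slices_of_the_noise_and_prior.

(* mu2 stands for the reference measure of (x, gamma): the product of leb L with
   a Dirac mass if gamma is deterministic, with leb L if it is random. *)
Record hybrid_model (R : realType) (N L : nat) (d : measure_display)
    (Omega : measurableType d) (c0 c1 c2 xi : R)
    (mu2 : {sigma_finite_measure set (L.-tuple R * L.-tuple R)%type -> \bar R})
    (P : probability Omega R) (n : Omega -> N.-tuple R) (x g : Omega -> L.-tuple R) : Prop := {
  hybrid_measurable_n : measurable_fun setT n;
  hybrid_measurable_x : measurable_fun setT x;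
  hybrid_measurable_g : measurable_fun setT g;
  hybrid_slice : forall j, slice_le mu2 (fun v t => (tset j v.1 t, v.2));
  hybrid_xi_gt0 : 0 < xi;
  hybrid_positive : forall w, positive_tuple (g w);
  hybrid_law : has_pdf P (fun w => (n w, (x w, g w))) (leb N \x mu2)%E
    (fun z => noise_pdf xi z.1 * prior_pdf c0 c1 c2 z.2) }.

Section hybrid_model.
Context {R : realType} {N L : nat} {d : measure_display} {Omega : measurableType d}.
Local Notation T := (N.-tuple R * (L.-tuple R * L.-tuple R))%type.
Variables (c0 c1 c2 xi : R).
Variable mu2 : {sigma_finite_measure set (L.-tuple R * L.-tuple R)%type -> \bar R}.
Variables (P : probability Omega R) (n : Omega -> N.-tuple R) (x g : Omega -> L.-tuple R).
Hypothesis model : hybrid_model c0 c1 c2 xi mu2 P n x g.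

Let mn := hybrid_measurable_n model.
Let mx := hybrid_measurable_x model.
Let mg := hybrid_measurable_g model.
Let xi0 := hybrid_xi_gt0 model.
Let gpos := hybrid_positive model.
Let law := hybrid_law model.

Let m0 : measurable_fun setT (fun w => (n w, (x w, g w))).
Proof. by apply: measurable_fun_pair => //; exact: measurable_fun_pair. Qed.

Let mf : measurable_fun setT (fun z : T => noise_pdf xi z.1 * prior_pdf c0 c1 c2 z.2).
Proof.
apply: measurable_funM; first exact: (measurableT_comp (measurable_noise_pdf xi)).
exact: (measurableT_comp (measurable_prior_pdf c0 c1 c2)).
Qed.

Let f0 (z : T) : 0 <= noise_pdf xi z.1 * prior_pdf c0 c1 c2 z.2.
Proof. by rewrite mulr_ge0 ?noise_pdf_ge0 ?prior_pdf_ge0. Qed.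

Definition sample (Phi : 'M[R]_(N, L)) w : T := (observation Phi (x w) (n w), (x w, g w)).

Lemma measurable_sample Phi : measurable_fun setT (sample Phi).
Proof.
apply: measurable_fun_pair; last exact: measurable_fun_pair.
rewrite (_ : (fun _ => _) = (fun w => tadd (n w) (signal Phi (x w)))).
  by apply: measurable_tadd => //; exact: measurable_signal.
by apply/funext => w; rewrite observationE.
Qed.

Lemma sample_law Phi : has_pdf P (sample Phi) (leb N \x mu2)%E (hyb_pdf c0 c1 c2 Phi xi).
Proof.
rewrite (_ : sample Phi = (fun w => (tadd (n w) (signal Phi (x w, g w).1), (x w, g w)))); last first.
  by apply/funext => w; rewrite /sample observationE.
apply: (has_pdf_shift (tau := fun v => signal Phi v.1)) => //.
- exact: measurable_fun_pair.
- exact: measurable_noise_pdf.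
- exact: measurable_prior_pdf.
- by apply: measurable_signal; exact: measurable_fst.
- by move=> u; exact: noise_pdf_ge0.
- by move=> u; exact: prior_pdf_ge0.
Qed.

Lemma slice_le_x j : slice_le (leb N \x mu2)%E (@upd_x R N L j).
Proof. exact: (slice_le_prodr (leb N) (@hybrid_slice _ _ _ _ _ _ _ _ _ _ _ _ _ _ model j)). Qed.

Lemma slice_le_y k : slice_le (leb N \x mu2)%E (@upd_y R N L k).
Proof. exact: (slice_le_prodl mu2 (@slice_le_leb R N k)). Qed.

Lemma stein_x Phi j (phi dphi : T -> R) :
  measurable_fun setT (fun z => dphi z + phi z * score Phi c1 c2 (colv z.1) (theta_of xi z) (idx_x j) ord0) ->
  (forall z, positive_tuple z.2.2 -> polyfun (fun t => phi (upd_x j z t))) ->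
  (forall z (t : R), positive_tuple z.2.2 ->
    is_derive t 1 (fun t => phi (upd_x j z t)) (dphi (upd_x j z t))) ->
  L1 P (fun w => dphi (sample Phi w)) ->
  L1 P (fun w => phi (sample Phi w) *
    score Phi c1 c2 (colv (sample Phi w).1) (theta_of xi (sample Phi w)) (idx_x j) ord0) ->
  \int[P]_w (phi (sample Phi w) *
    score Phi c1 c2 (colv (sample Phi w).1) (theta_of xi (sample Phi w)) (idx_x j) ord0) =
  - \int[P]_w dphi (sample Phi w).
Proof.
move=> m pphi Dphi i1 i2; apply/eqP; rewrite -addr_eq0 addrC -RintegralD//; apply/eqP.
rewrite /Rintegral (expectation_slice0 (measurable_sample Phi)
  (measurable_hyb_pdf c0 c1 c2 Phi xi) (hyb_pdf_ge0 c0 c1 c2 Phi xi) (sample_law Phi)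
  (slice_le_x (j := j)) m)//; first exact: L1D.
by move=> z; apply: slice_stein_x => // [zpos|zpos t]; [exact: pphi|exact: Dphi].
Qed.

Lemma stein_y k (phi dphi : T -> R) :
  measurable_fun setT (fun z => dphi z - phi z * (tnth z.1 k / xi)) ->
  (forall z, polyfun (fun t => phi (upd_y k z t))) ->
  (forall z (t : R), is_derive t 1 (fun t => phi (upd_y k z t)) (dphi (upd_y k z t))) ->
  L1 P (fun w => dphi (n w, (x w, g w))) ->
  L1 P (fun w => phi (n w, (x w, g w)) * tnth (n w) k) ->
  \int[P]_w (phi (n w, (x w, g w)) * tnth (n w) k) =
  xi * \int[P]_w dphi (n w, (x w, g w)).
Proof.
move=> m pphi Dphi i1 i2.
have law0 : has_pdf P (fun w => (n w, (x w, g w))) (leb N \x mu2)%E (hyb_pdf c0 c1 c2 0 xi).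
  by rewrite (_ : hyb_pdf _ _ _ _ _ = (fun z => noise_pdf xi z.1 * prior_pdf c0 c1 c2 z.2))//;
    apply/funext => z; exact: hyb_pdf0E.
have i2' : L1 P (fun w => phi (n w, (x w, g w)) * (tnth (n w) k / xi)).
  rewrite (_ : (fun _ => _) = (fun w => xi^-1 * (phi (n w, (x w, g w)) * tnth (n w) k))).
    exact: L1Z.
  by apply/funext => w; rewrite mulrA mulrC.
have : \int[P]_w (dphi (n w, (x w, g w)) - phi (n w, (x w, g w)) * (tnth (n w) k / xi)) = 0.
  rewrite /Rintegral (expectation_slice0 m0 (measurable_hyb_pdf c0 c1 c2 0 xi)
    (hyb_pdf_ge0 c0 c1 c2 0 xi) law0 (@slice_le_y k) m)//; first exact: L1B.
  by move=> z; exact: slice_stein_y.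
rewrite RintegralB// => /eqP; rewrite subr_eq0 => /eqP ->.
rewrite (_ : \int[P]_w (phi (n w, (x w, g w)) * (tnth (n w) k / xi)) =
    \int[P]_w (xi^-1 * (phi (n w, (x w, g w)) * tnth (n w) k))); last first.
  by apply: eq_Rintegral => w _; rewrite mulrA mulrC.
by rewrite RintegralZl// mulVKf// gt_eqF.
Qed.

(** The score in xi is quadratic in the noise, so its square-integrability rests on fourth moments
    of the noise. *)
Lemma L2_noise_sqr k : L2 P (fun w => tnth (n w) k ^+ 2).
Proof.
have mnk : measurable_fun setT (fun w => tnth (n w) k) by exact: measurable_tnthf.
split; first exact: measurable_funX.
rewrite -/(L1 P _) (_ : (fun _ => _) = (fun w => tnth (n w) k ^+ 4)); last first.
  by apply/funext => w; rewrite -exprM.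
apply: L1_ge0; [exact: measurable_funX|by move=> w; rewrite exprn_even_ge0|].
have m4 : measurable_fun setT (fun z : T => tnth z.1 k ^+ 4).
  by apply: measurable_funX; exact: measurable_obs_coord.
have := expectation_slice_le m0 mf f0 law (@slice_le_y k) (phi := fun z => tnth z.1 k ^+ 4)
  (psi := fun=> 3 * xi ^+ 2) m4 (@measurable_cst _ _ _ _ _ _).
move=> h; apply: le_lt_trans (h _ _ _) _.
- by move=> z; rewrite exprn_even_ge0.
- by move=> z; rewrite mulr_ge0 ?sqr_ge0.
- move=> z /=; have [kappa nE] := noise_pdf_slice xi k z.1.
  under eq_integral do rewrite tnth_tset eqxx nE (mulrC (expR _)).
  under [leRHS]eq_integral do rewrite nE (mulrC (expR _)).
  by apply: gauss_slice_moment4_scaled => //; exact: prior_pdf_ge0.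
- by have /integrable_lty -> : L1 P (fun=> 3 * xi ^+ 2) by exact: L1_cst.
Qed.

(** Given gamma, the fourth moment of x_j is 3 gamma_j^2. The weight psi is constant on an x_j-line,
    so one lemma covers all products of powers of x_j and gamma_j that enter the score. *)
Lemma L1_source4 j (psi : R -> R) : measurable_fun setT psi -> (forall r, 0 <= psi r) ->
  L1 P (fun w => tnth (g w) j ^+ 2 * psi (tnth (g w) j)) ->
  L1 P (fun w => tnth (x w) j ^+ 4 * psi (tnth (g w) j)).
Proof.
move=> mpsi psi0 ig.
have mxj : measurable_fun setT (fun w => tnth (x w) j) by exact: measurable_tnthf.
have mgj : measurable_fun setT (fun w => tnth (g w) j) by exact: measurable_tnthf.
apply: L1_ge0.
- by apply: measurable_funM; [exact: measurable_funX|exact: measurableT_comp].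
- by move=> w; rewrite mulr_ge0// exprn_even_ge0.
have mzx := @measurable_source_coord R N L j; have mzg := @measurable_scale_coord R N L j.
have m4 : measurable_fun setT (fun z : T => tnth z.2.1 j ^+ 4 * psi (tnth z.2.2 j)).
  by apply: measurable_funM; [exact: measurable_funX|exact: measurableT_comp].
have m2 : measurable_fun setT (fun z : T => 3 * (tnth z.2.2 j ^+ 2 * psi (tnth z.2.2 j))).
  apply: measurable_funM => //.
  by apply: measurable_funM; [exact: measurable_funX|exact: measurableT_comp].
apply: le_lt_trans (expectation_slice_le m0 mf f0 law (@slice_le_x j) m4 m2 _ _ _) _.
- by move=> z; rewrite mulr_ge0// exprn_even_ge0.
- by move=> z; rewrite mulr_ge0// mulr_ge0 ?sqr_ge0.
- move=> z /=; case: (boolP (positive_tuple z.2.2)) => zpos; last first.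
    rewrite /prior_pdf /= (negbTE zpos).
    by under eq_integral do rewrite !mulr0; under [leRHS]eq_integral do rewrite !mulr0.
  have [kappa pE] := prior_pdf_slice_x c0 c1 c2 j zpos.
  have gj : 0 < tnth z.2.2 j by move/forallP: zpos; apply.
  pose C := psi (tnth z.2.2 j) * noise_pdf xi z.1.
  have C0 : 0 <= C by rewrite mulr_ge0// noise_pdf_ge0.
  have assoc (a b c e : R) : a * b * (c * e) = a * (b * c * e) by rewrite !mulrA.
  have assoc3 (a b c e f : R) : a * (b * c) * (e * f) = a * b * (c * e * f) by rewrite !mulrA.
  under eq_integral do rewrite tnth_tset eqxx pE assoc.
  under [leRHS]eq_integral do rewrite pE assoc3.
  exact: gauss_slice_moment4_scaled.
- have /integrable_lty -> // : L1 P (fun w => 3 * (tnth (g w) j ^+ 2 * psi (tnth (g w) j))).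
  exact: L1Z.
Qed.

End hybrid_model.

Section score_measurability.
Context {R : realType} {N L : nat}.
Local Notation T := (N.-tuple R * (L.-tuple R * L.-tuple R))%type.
Variables (c1 c2 xi : R) (Phi : 'M[R]_(N, L)).

Lemma measurable_theta_of i : measurable_fun setT (fun z : T => theta_of xi z i ord0).
Proof.
move: i; apply: idx_ind => [k|k|]; under eq_fun do rewrite paramE ?mxE.
- exact: measurable_source_coord.
- exact: measurable_scale_coord.
- exact: measurable_cst.
Qed.

Lemma measurable_resid k :
  measurable_fun setT (fun z : T => resid Phi (colv z.1) (theta_of xi z) k).
Proof.
apply: measurable_funB.
  by under eq_fun do rewrite mxE; exact: measurable_obs_coord.
by apply: measurable_sum => l; apply: measurable_funM => //; exact: measurable_theta_of.
Qed.

Let mt := measurable_theta_of.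
Let mr := measurable_resid.

Let mtV k p : measurable_fun setT (fun z : T => theta_of xi z k ord0 ^- p).
Proof. by apply: measurable_funV; apply: measurable_funX; exact: mt. Qed.

Let ms k : measurable_fun setT (fun z : T => \sum_i Phi i k * resid Phi (colv z.1) (theta_of xi z) i).
Proof. by apply: measurable_sum => l; apply: measurable_funM => //; exact: mr. Qed.

Lemma measurable_score i :
  measurable_fun setT (fun z : T => score Phi c1 c2 (colv z.1) (theta_of xi z) i ord0).
Proof.
move: i; apply: idx_ind => [k|k|].
- under eq_fun do rewrite scoreE_x paramE.
  apply: measurable_funB; first by apply: measurable_funM => //; exact: ms.
  apply: measurable_funM; first exact: mt.
  apply: measurable_funV; exact: mt.
- under eq_fun do rewrite scoreE_g.
  apply: measurable_funD; first by apply: measurable_funM => //; apply: measurable_funV; exact: mt.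
  apply: measurable_funM => //; apply: measurable_funD => //; apply: measurable_funM => //.
  apply: measurable_funX; exact: mt.
- under eq_fun do rewrite scoreE_xi paramE.
  apply: measurable_funB => //; apply: measurable_funM => //.
  by apply: measurable_sum => l; exact: measurable_funX.
Qed.

Lemma measurable_dscore v i :
  measurable_fun setT (fun z : T => dscore Phi c1 c2 (colv z.1) (theta_of xi z) v i ord0).
Proof.
move: i; apply: idx_ind => [k|k|].
- under eq_fun do rewrite dscoreE_x paramE.
  apply: measurable_funD; last by apply: measurable_funM => //; exact: measurable_funM.
  apply: measurable_funB; last by apply: measurable_funM => //; apply: measurable_funV; exact: mt.
  apply: measurable_funB => //.
  by apply: measurable_funM => //; exact: measurable_funM.
- under eq_fun do rewrite dscoreE_g.
  apply: measurable_funB; last first.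
    apply: measurable_funM => //; apply: measurable_funM => //.
    by apply: measurable_funD => //; apply: measurable_funX; exact: mt.
  apply: measurable_funD; first exact: measurable_funM.
  by apply: measurable_funM => //; exact: measurable_funM.
- under eq_fun do rewrite dscoreE_xi paramE.
  apply: measurable_funB; last first.
    by apply: measurable_funM => //; apply: measurable_sum => l; apply: measurable_funM => //; exact: mr.
  apply: measurable_funB => //; apply: measurable_funM => //; apply: measurable_funM => //.
  by apply: measurable_sum => l; exact: measurable_funX.
Qed.

End score_measurability.

(** * Moments of the noise and of the sources *)

Section score_moments.
Context {R : realType} {N L : nat} {d : measure_display} {Omega : measurableType d}.
Local Notation T := (N.-tuple R * (L.-tuple R * L.-tuple R))%type.
Variables (c0 c1 c2 xi : R).
Variable mu2 : {sigma_finite_measure set (L.-tuple R * L.-tuple R)%type -> \bar R}.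
Variables (P : probability Omega R) (n : Omega -> N.-tuple R) (x g : Omega -> L.-tuple R).
Hypothesis model : hybrid_model c0 c1 c2 xi mu2 P n x g.
(** Puts the term c2 / gamma_j^2 of the score in L2. It is immediate for fixed scales and is
    [L1_invg4] for random ones. *)
Hypothesis g4 : forall j, L1 P (fun w => tnth (g w) j ^- 4).

Let mn := hybrid_measurable_n model.
Let mx := hybrid_measurable_x model.
Let mg := hybrid_measurable_g model.
Let xi0 := hybrid_xi_gt0 model.
Let gpos := hybrid_positive model.
Let gj0 w j : 0 < tnth (g w) j.
Proof. by move/forallP: (gpos w); apply. Qed.
Let gjN0 w j : tnth (g w) j != 0.
Proof. by rewrite gt_eqF. Qed.

Lemma L2_noise k : L2 P (fun w => tnth (n w) k).
Proof. by apply: L2_sqr (L2_noise_sqr model k); exact: measurable_tnthf. Qed.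

Lemma L2_invg2 j : L2 P (fun w => tnth (g w) j ^- 2).
Proof.
split; first by apply: measurable_funV; apply: measurable_funX; exact: measurable_tnthf.
rewrite -/(L1 P _) (_ : (fun _ => _) = (fun w => tnth (g w) j ^- 4)); first exact: g4.
by apply/funext => w; rewrite exprVn -exprM.
Qed.

Lemma L2_invg j : L2 P (fun w => (tnth (g w) j)^-1).
Proof.
apply: L2_sqr; first by apply: measurable_funV; exact: measurable_tnthf.
rewrite (_ : (fun _ => _) = (fun w => tnth (g w) j ^- 2)); first exact: L2_invg2.
by apply/funext => w; rewrite exprVn.
Qed.

Lemma L2_source_sqr j (r : R -> R) : measurable_fun setT r ->
  L1 P (fun w => tnth (g w) j ^+ 2 * r (tnth (g w) j) ^+ 2) ->
  L2 P (fun w => tnth (x w) j ^+ 2 * r (tnth (g w) j)).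
Proof.
move=> mr ir; split.
  apply: measurable_funM; first by apply: measurable_funX; exact: measurable_tnthf.
  by apply: measurableT_comp => //; exact: measurable_tnthf.
rewrite -/(L1 P _) (_ : (fun _ => _) = (fun w => tnth (x w) j ^+ 4 * r (tnth (g w) j) ^+ 2)).
  apply: (L1_source4 model (psi := fun s => r s ^+ 2)) => //; first exact: measurable_funX.
  by move=> s; exact: sqr_ge0.
by apply/funext => w; rewrite exprMn -exprM.
Qed.

Lemma L2_source2 j : L2 P (fun w => tnth (x w) j ^+ 2 * (tnth (g w) j)^-1).
Proof.
apply: (L2_source_sqr (r := fun s => s^-1)); first exact: measurable_inv.
rewrite (_ : (fun _ => _) = (fun=> 1)); first exact: L1_cst.
by apply/funext => w; rewrite -exprMn mulfV// expr1n.
Qed.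

Lemma L2_source2V j : L2 P (fun w => tnth (x w) j ^+ 2 * tnth (g w) j ^- 2).
Proof.
apply: (L2_source_sqr (r := fun s => s ^- 2)); first by apply: measurable_funV; exact: measurable_funX.
rewrite (_ : (fun _ => _) = (fun w => tnth (g w) j ^- 2)); first exact: L2_L1 (L2_invg2 j).
by apply/funext => w; rewrite [X in _ * X]expr2 mulVKf// expf_neq0.
Qed.

Lemma L2_source1 j : L2 P (fun w => tnth (x w) j / tnth (g w) j).
Proof.
apply: L2_sqr.
  by apply: measurable_funM; [|apply: measurable_funV]; exact: measurable_tnthf.
rewrite (_ : (fun _ => _) = (fun w => tnth (x w) j ^+ 2 * tnth (g w) j ^- 2)); first exact: L2_source2V.
by apply/funext => w; rewrite exprMn exprVn.
Qed.

Lemma noise_mean k : \int[P]_w tnth (n w) k = 0.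
Proof.
have m1 : measurable_fun setT (fun z : T => 0 - 1 * (tnth z.1 k / xi)).
  apply: measurable_funB => //; apply: measurable_funM => //; apply: measurable_funM => //.
  exact: measurable_obs_coord.
have := stein_y model (k := k) (phi := fun=> 1) (dphi := fun=> 0) m1.
under eq_Rintegral do rewrite mul1r.
rewrite Rintegral_cst1 mulr0; apply.
- by move=> z; exact: polyfun_cst.
- exact: L1_cst.
- by under eq_fun do rewrite mul1r; exact: L2_L1 (L2_noise k).
Qed.

Lemma noise_variance k : \int[P]_w tnth (n w) k ^+ 2 = xi.
Proof.
have mk := @measurable_obs_coord R N L k.
have m1 : measurable_fun setT (fun z : T => 1 - tnth z.1 k * (tnth z.1 k / xi)).
  by apply: measurable_funB => //; apply: measurable_funM => //; exact: measurable_funM.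
have := stein_y model (k := k) (phi := fun z => tnth z.1 k) (dphi := fun=> 1) m1.
rewrite Rintegral_cst1 mulr1; apply.
- by move=> z; exact: polyfun_tset.
- move=> z t; under eq_fun do rewrite /= tnth_tset eqxx; exact: is_derive_id.
- exact: L1_cst.
- exact: L2M_L1 (L2_noise k) (L2_noise k).
Qed.

(** With Phi = 0 the score in x_j reduces to -x_j / gamma_j, and the Stein identity becomes a
    statement about the law of (x, gamma) alone. *)
Lemma source_stein j (phi dphi : R -> R -> R) :
  measurable_fun setT (fun z : T => phi (tnth z.2.1 j) (tnth z.2.2 j)) ->
  measurable_fun setT (fun z : T => dphi (tnth z.2.1 j) (tnth z.2.2 j)) ->
  (forall s, polyfun (phi^~ s)) ->
  (forall s t : R, is_derive t 1 (phi^~ s) (dphi t s)) ->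
  L1 P (fun w => dphi (tnth (x w) j) (tnth (g w) j)) ->
  L1 P (fun w => phi (tnth (x w) j) (tnth (g w) j) * (tnth (x w) j / tnth (g w) j)) ->
  \int[P]_w (phi (tnth (x w) j) (tnth (g w) j) * (tnth (x w) j / tnth (g w) j)) =
  \int[P]_w dphi (tnth (x w) j) (tnth (g w) j).
Proof.
move=> mphi mdphi pphi Dphi i1 i2.
pose f (z : T) := phi (tnth z.2.1 j) (tnth z.2.2 j).
pose df (z : T) := dphi (tnth z.2.1 j) (tnth z.2.2 j).
have scE w : score 0 c1 c2 (colv (sample n x g 0 w).1) (theta_of xi (sample n x g 0 w)) (idx_x j) ord0 =
    - (tnth (x w) j / tnth (g w) j).
  by rewrite scoreE_x big1 ?mul0r ?sub0r ?paramE ?mxE// => k _; rewrite mxE mul0r.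
have fE : (fun w => f (sample n x g 0 w) * score 0 c1 c2 (colv (sample n x g 0 w).1)
      (theta_of xi (sample n x g 0 w)) (idx_x j) ord0) =
    (fun w => -1 * (phi (tnth (x w) j) (tnth (g w) j) * (tnth (x w) j / tnth (g w) j))).
  by apply/funext => w; rewrite scE mulrN mulN1r.
have := stein_x model (Phi := 0) (j := j) (phi := f) (dphi := df).
rewrite fE RintegralZl// mulN1r => h.
apply: oppr_inj; apply: h.
- by apply: measurable_funD => //; apply: measurable_funM => //; exact: measurable_score.
- move=> z _; rewrite /f /=; under eq_fun do rewrite tnth_tset eqxx; exact: pphi.
- by move=> z t _; rewrite /f /df /= tnth_tset eqxx; under eq_fun do rewrite tnth_tset eqxx; exact: Dphi.
- exact: i1.
- exact: L1Z.
Qed.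

(** The conditional variance of x_j is gamma_j; the test function is x_j r(gamma_j). *)
Lemma source_second_moment j (r : R -> R) : measurable_fun setT r ->
  L1 P (fun w => r (tnth (g w) j)) ->
  L1 P (fun w => tnth (x w) j ^+ 2 * (r (tnth (g w) j) / tnth (g w) j)) ->
  \int[P]_w (tnth (x w) j ^+ 2 * (r (tnth (g w) j) / tnth (g w) j)) =
  \int[P]_w r (tnth (g w) j).
Proof.
move=> mr i1 i2.
have E : (fun w => tnth (x w) j * r (tnth (g w) j) * (tnth (x w) j / tnth (g w) j)) =
   (fun w => tnth (x w) j ^+ 2 * (r (tnth (g w) j) / tnth (g w) j)).
  by apply/funext => w; ring.
have mzx := @measurable_source_coord R N L j.
have mzg : measurable_fun setT (fun z : T => r (tnth z.2.2 j)).
  by apply: measurableT_comp => //; exact: measurable_scale_coord.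
rewrite -E; apply: (source_stein (phi := fun t s => t * r s) (dphi := fun t s => r s)) => //.
- exact: measurable_funM.
- by move=> s; apply: polyfunM; [exact: polyfun_id|exact: polyfun_cst].
- move=> s t; apply: (is_derive_eq (is_derive_funM (is_derive_id t (1 : R)) (is_derive_cst (r s) t 1))).
  by rewrite mulr0 add0r mulr1.
- by rewrite E.
Qed.

Lemma source_first_moment j : \int[P]_w (tnth (x w) j * tnth (g w) j ^- 2) = 0.
Proof.
have mzx := @measurable_source_coord R N L j.
have mzg : measurable_fun setT (fun z : T => (tnth z.2.2 j)^-1).
  by apply: measurable_funV; exact: measurable_scale_coord.
transitivity (\int[P]_w ((tnth (g w) j)^-1 * (tnth (x w) j / tnth (g w) j))).
  by apply: eq_Rintegral => w _; field.
rewrite -[RHS](Rintegral_cst1 P 0).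
apply: (source_stein (phi := fun t s => s^-1) (dphi := fun t s => 0)) => //.
- by move=> s; exact: polyfun_cst.
- by move=> s t; exact: is_derive_cst.
- exact: L1_cst.
- exact: L2M_L1 (L2_invg j) (L2_source1 j).
Qed.

End score_moments.

(** * Mean Hessian of the log-likelihood, and the columns in direction x *)

Section information.
Context {R : realType} {N L : nat} {d : measure_display} {Omega : measurableType d}.
Local Notation T := (N.-tuple R * (L.-tuple R * L.-tuple R))%type.
Variables (Phi : 'M[R]_(N, L)) (c0 c1 c2 xi : R).
Variable mu2 : {sigma_finite_measure set (L.-tuple R * L.-tuple R)%type -> \bar R}.
Variables (P : probability Omega R) (n : Omega -> N.-tuple R) (x g : Omega -> L.-tuple R).

Definition sc (i : 'I_(L + L + 1)) (w : Omega) : R :=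
  score Phi c1 c2 (colv (observation Phi (x w) (n w)))
    (param (colv (x w)) (colv (g w)) xi) i ord0.

Definition dsc (v : 'cV[R]_(L + L + 1)) (i : 'I_(L + L + 1)) (w : Omega) : R :=
  dscore Phi c1 c2 (colv (observation Phi (x w) (n w)))
    (param (colv (x w)) (colv (g w)) xi) v i ord0.

Lemma resid_observation w k : resid Phi (colv (observation Phi (x w) (n w)))
  (param (colv (x w)) (colv (g w)) xi) k = tnth (n w) k.
Proof.
rewrite /resid mxE tnth_mktuple [X in X - _]mxE mxE addrAC mxE -[RHS]add0r; congr (_ + _).
by apply/eqP; rewrite subr_eq0; apply/eqP/eq_bigr => i _; rewrite paramE.
Qed.

Lemma scE_x j w : sc (idx_x j) w =
  xi^-1 * (\sum_k Phi k j * tnth (n w) k) - tnth (x w) j / tnth (g w) j.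
Proof.
rewrite /sc scoreE_x !paramE !mxE mulrC.
by under eq_bigr do rewrite resid_observation.
Qed.

Lemma scE_g j w : sc (idx_g j) w = c1 * (tnth (g w) j)^-1 +
  (c2 * tnth (g w) j ^- 2 + 2^-1 * (tnth (x w) j ^+ 2 * tnth (g w) j ^- 2)).
Proof.
by rewrite /sc scoreE_g !paramE !mxE mulrDl [X in _ = _ + (_ + X)]mulrCA [X in _ = _ + (_ + X)]mulrA.
Qed.

Lemma scE_xi w : sc idx_xi w =
  (2 * xi ^+ 2)^-1 * (\sum_k tnth (n w) k ^+ 2) - N%:R / (2 * xi).
Proof.
rewrite /sc scoreE_xi !paramE mulrC.
by under eq_bigr do rewrite resid_observation.
Qed.

Lemma dscE_x v j w : dsc v (idx_x j) w =
  - ((\sum_k Phi k j * dresid Phi v k) / xi)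
  - v idx_xi ord0 / xi ^+ 2 * (\sum_k Phi k j * tnth (n w) k)
  - v (idx_x j) ord0 * (tnth (g w) j)^-1
  + v (idx_g j) ord0 * (tnth (x w) j * tnth (g w) j ^- 2).
Proof.
rewrite /dsc dscoreE_x !paramE !mxE mulNr.
under [X in _ - X * _ / _ - _ + _ = _]eq_bigr do rewrite resid_observation.
by move: (\sum_k _) (\sum_k _) => a b; ring.
Qed.

Lemma dscE_g v j w : dsc v (idx_g j) w =
  - c1 * v (idx_g j) ord0 * tnth (g w) j ^- 2
  + v (idx_x j) ord0 * (tnth (x w) j * tnth (g w) j ^- 2)
  - (2 * c2 * v (idx_g j) ord0 * tnth (g w) j ^- 3
     + v (idx_g j) ord0 * (tnth (x w) j ^+ 2 * tnth (g w) j ^- 3)).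
Proof.
rewrite /dsc dscoreE_g !paramE !mxE.
by move: (_ ^- 2) (_ ^- 3) => a b; ring.
Qed.

Lemma dscE_xi v w : dsc v idx_xi w =
  N%:R * v idx_xi ord0 / (2 * xi ^+ 2)
  - v idx_xi ord0 / xi ^+ 3 * (\sum_k tnth (n w) k ^+ 2)
  - xi ^- 2 * (\sum_k dresid Phi v k * tnth (n w) k).
Proof.
rewrite /dsc dscoreE_xi !paramE.
rewrite (eq_bigr (fun k => tnth (n w) k ^+ 2)); last by move=> k _; rewrite resid_observation.
rewrite [X in _ - X / _ = _](eq_bigr (fun k => dresid Phi v k * tnth (n w) k)); last first.
  by move=> k _; rewrite resid_observation mulrC.
by move: (\sum_k _) (\sum_k _) => a b; ring.
Qed.

Hypothesis model : hybrid_model c0 c1 c2 xi mu2 P n x g.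
Hypothesis g4 : forall j, L1 P (fun w => tnth (g w) j ^- 4).

Let xi0 := hybrid_xi_gt0 model.
Let gpos := hybrid_positive model.
Let gj0 w j : 0 < tnth (g w) j.
Proof. by move/forallP: (gpos w); apply. Qed.
Let gjN0 w j : tnth (g w) j != 0.
Proof. by rewrite gt_eqF. Qed.

Let L2n := L2_noise model.
Let L2g1 := L2_invg model g4.
Let L2g2 := L2_invg2 model g4.
Let L2xg := L2_source1 model g4.
Let L2x2g2 := L2_source2V model g4.

Lemma L2_sc i : L2 P (sc i).
Proof.
move: i; apply: idx_ind => [j|j|].
- rewrite (funext (scE_x j)).
  by apply: L2B => //; apply: L2Z; apply: L2_sum => k; exact: L2Z.
- rewrite (funext (scE_g j)).
  by apply: L2D; [exact: L2Z|apply: L2D; exact: L2Z].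
- rewrite (funext scE_xi).
  apply: L2B; last exact: L2_cst.
  by apply: L2Z; apply: L2_sum => k; exact: (L2_noise_sqr model).
Qed.

Let L1n k : L1 P (fun w => tnth (n w) k). Proof. exact: L2_L1. Qed.
Let L1n2 k : L1 P (fun w => tnth (n w) k ^+ 2).
Proof. exact: L2_L1 (L2_noise_sqr model k). Qed.
Let L1g1 j : L1 P (fun w => (tnth (g w) j)^-1). Proof. exact: L2_L1. Qed.
Let L1g2 j : L1 P (fun w => tnth (g w) j ^- 2). Proof. exact: L2_L1. Qed.

Lemma L1_invg3 j : L1 P (fun w => tnth (g w) j ^- 3).
Proof.
rewrite (_ : (fun _ => _) = (fun w => (tnth (g w) j)^-1 * tnth (g w) j ^- 2)).
  exact: L2M_L1.
by apply/funext => w; rewrite -invfM -exprS.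
Qed.

Let L1xg2 j : L1 P (fun w => tnth (x w) j * tnth (g w) j ^- 2).
Proof.
rewrite (_ : (fun _ => _) = (fun w => (tnth (x w) j / tnth (g w) j) * (tnth (g w) j)^-1)).
  exact: L2M_L1.
by apply/funext => w; rewrite -mulrA -invfM.
Qed.

Let L1x2g3 j : L1 P (fun w => tnth (x w) j ^+ 2 * tnth (g w) j ^- 3).
Proof.
rewrite (_ : (fun _ => _) = (fun w => (tnth (x w) j ^+ 2 * tnth (g w) j ^- 2) * (tnth (g w) j)^-1)).
  exact: L2M_L1.
by apply/funext => w; rewrite -mulrA -invfM -exprSr.
Qed.

Lemma source_moment3 j :
  \int[P]_w (tnth (x w) j ^+ 2 * tnth (g w) j ^- 3) = \int[P]_w tnth (g w) j ^- 2.
Proof.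
have E : (fun w => tnth (x w) j ^+ 2 * (tnth (g w) j ^- 2 / tnth (g w) j)) =
    (fun w => tnth (x w) j ^+ 2 * tnth (g w) j ^- 3).
  by apply/funext => w; rewrite -invfM -exprSr.
rewrite -E (source_second_moment model (r := fun s => s ^- 2))//.
- by apply: measurable_funV; exact: measurable_funX.
- by rewrite E.
Qed.

Let L1sum (a : 'I_N -> R) (f : 'I_N -> Omega -> R) : (forall k, L1 P (f k)) ->
  L1 P (fun w => \sum_k a k * f k w).
Proof. by move=> fk; apply: L1_sum => k; exact: L1Z. Qed.

Let Isum (a : 'I_N -> R) : \int[P]_w (\sum_k a k * tnth (n w) k) = 0.
Proof.
rewrite Rintegral_sumE; last by move=> k; exact: L1Z.
rewrite big1// => k _; rewrite RintegralZl//; last exact: L1n.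
by rewrite (noise_mean model) mulr0.
Qed.

Lemma noise_power : \int[P]_w (\sum_k tnth (n w) k ^+ 2) = N%:R * xi.
Proof.
rewrite Rintegral_sumE//; under eq_bigr do rewrite (noise_variance model).
by rewrite sumr_const card_ord mulr_natl.
Qed.

Lemma L1_dsc v i : L1 P (dsc v i).
Proof.
move: i; apply: idx_ind => [j|j|].
- rewrite (funext (dscE_x v j)).
  apply: L1D; last exact: L1Z.
  apply: L1B; last exact: L1Z.
  by apply: L1B; [exact: L1_cst|apply: L1Z; exact: L1sum].
- rewrite (funext (dscE_g v j)).
  apply: L1B; first by apply: L1D; exact: L1Z.
  by apply: L1D; apply: L1Z => //; exact: L1_invg3.
- rewrite (funext (dscE_xi v)).
  apply: L1B; last by apply: L1Z; exact: L1sum.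
  by apply: L1B; [exact: L1_cst|apply: L1Z; exact: L1_sum].
Qed.

Lemma mean_dsc_x v j : \int[P]_w dsc v (idx_x j) w =
  - ((\sum_k Phi k j * dresid Phi v k) / xi) - v (idx_x j) ord0 * \int[P]_w (tnth (g w) j)^-1.
Proof.
under eq_Rintegral do rewrite dscE_x.
have i1 := L1_cst P (- ((\sum_k Phi k j * dresid Phi v k) / xi)).
have i2 := L1Z (v idx_xi ord0 / xi ^+ 2) (L1sum (Phi^~ j) L1n).
have i3 := L1Z (v (idx_x j) ord0) (L1g1 j).
have i4 := L1Z (v (idx_g j) ord0) (L1xg2 j).
rewrite RintegralD//; last exact: L1B (L1B i1 i2) i3.
rewrite RintegralB//; last exact: L1B i1 i2.
rewrite RintegralB// !RintegralZl//; [|exact: L1xg2|exact: L1g1|exact: (L1sum (Phi^~ j) L1n)].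
by rewrite Rintegral_cst1 (Isum (Phi^~ j)) (source_first_moment model g4) !mulr0 subr0 addr0.
Qed.

(** The terms linear in x_j have mean zero, and the mean of x_j^2 / gamma_j^3 is that of 1 /
    gamma_j^2, which turns c1 into c1 + 1. *)
Lemma mean_dsc_g v j : \int[P]_w dsc v (idx_g j) w = - (v (idx_g j) ord0 *
  ((c1 + 1) * (\int[P]_w tnth (g w) j ^- 2) + 2 * c2 * \int[P]_w tnth (g w) j ^- 3)).
Proof.
under eq_Rintegral do rewrite dscE_g.
have i1 := L1Z (- c1 * v (idx_g j) ord0) (L1g2 j).
have i2 := L1Z (v (idx_x j) ord0) (L1xg2 j).
have i3 := L1Z (2 * c2 * v (idx_g j) ord0) (L1_invg3 j).
have i4 := L1Z (v (idx_g j) ord0) (L1x2g3 j).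
rewrite RintegralB//; [|exact: L1D i1 i2|exact: L1D i3 i4].
rewrite !RintegralD// !RintegralZl//; try first [exact: L1g2|exact: L1xg2|exact: L1_invg3|exact: L1x2g3].
by rewrite source_moment3 (source_first_moment model g4); ring.
Qed.

Lemma mean_dsc_xi v : \int[P]_w dsc v idx_xi w = - (v idx_xi ord0 * (N%:R / (2 * xi ^+ 2))).
Proof.
under eq_Rintegral do rewrite dscE_xi.
have i1 := L1_cst P (N%:R * v idx_xi ord0 / (2 * xi ^+ 2)).
have i2 := L1Z (v idx_xi ord0 / xi ^+ 3) (L1_sum (index_enum 'I_N) L1n2).
have i3 := L1Z (xi ^- 2) (L1sum (dresid Phi v) L1n).
rewrite RintegralB//; last exact: L1B i1 i2.
rewrite RintegralB// !RintegralZl//; try first [exact: L1_cst|exact: (L1sum (dresid Phi v) L1n)|exact: (L1_sum (index_enum 'I_N) L1n2)].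
rewrite Rintegral_cst1 (Isum (dresid Phi v)) noise_power mulr0 subr0.
by field; rewrite gt_eqF.
Qed.

Lemma mean_sc_xi : \int[P]_w sc idx_xi w = 0.
Proof.
under eq_Rintegral do rewrite scE_xi.
have i1 := L1_sum (index_enum 'I_N) L1n2.
rewrite RintegralB//; [|exact: L1Z|exact: L1_cst].
rewrite RintegralZl// Rintegral_cst1 noise_power.
by field; rewrite gt_eqF.
Qed.

(** The test function is the score entry itself, a polynomial in x_j on each line, so the identity
    equates the covariance of the scores with minus the mean Hessian. *)
Lemma score_stein_x i j : \int[P]_w (sc i w * sc (idx_x j) w) =
  - \int[P]_w dsc (delta_mx (idx_x j) ord0) i w.
Proof.
apply: (stein_x model (Phi := Phi) (j := j)
  (phi := fun z => score Phi c1 c2 (colv z.1) (theta_of xi z) i ord0)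
  (dphi := fun z => dscore Phi c1 c2 (colv z.1) (theta_of xi z) (delta_mx (idx_x j) ord0) i ord0)).
- apply: measurable_funD; first exact: measurable_dscore.
  by apply: measurable_funM; exact: measurable_score.
- by move=> z _; exact: (polyfun_score_x c1 c2 Phi xi (colv z.1) j z i).
- move=> z t zpos.
  apply: (is_derive_slice (v := delta_mx (idx_x j) ord0)
    (f := fun th => score Phi c1 c2 (colv z.1) th i ord0)
    (c := fun t => theta_of xi (upd_x j z t))) => [h|]; first exact: theta_upd_x.
  by apply: is_derive_score; exact: positive_theta.
- exact: L1_dsc.
- exact: L2M_L1 (L2_sc i) (L2_sc (idx_x j)).
Qed.

(** On an x_j-line y is fixed, so the estimate is constant and the error is x_j plus a constant, or
    constant altogether. This is why densities are written in the coordinates (y, (x, gamma)) and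
    not in terms of the noise. *)
Lemma error_stein_x (est : N.-tuple R -> 'cV[R]_(L + L + 1)) i j :
  (forall i, measurable_fun setT (fun u => est u i ord0)) ->
  L1 P (fun w => (param (colv (x w)) (colv (g w)) xi i ord0 -
    est (observation Phi (x w) (n w)) i ord0) * sc (idx_x j) w) ->
  \int[P]_w ((param (colv (x w)) (colv (g w)) xi i ord0 -
    est (observation Phi (x w) (n w)) i ord0) * sc (idx_x j) w) = - (i == idx_x j)%:R.
Proof.
move=> mest i1; rewrite -[(i == _)%:R](Rintegral_cst1 P).
apply: (stein_x model (Phi := Phi) (j := j)
  (phi := fun z => theta_of xi z i ord0 - est z.1 i ord0) (dphi := fun=> (i == idx_x j)%:R)).
- apply: measurable_funD => //; apply: measurable_funM; last exact: measurable_score.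
  apply: measurable_funB; first exact: measurable_theta_of.
  by apply: (measurableT_comp (mest i)); exact: measurable_fst.
- move=> z _; apply: polyfunB; first exact: polyfun_theta_x.
  exact: (polyfun_cst (est z.1 i ord0)).
- move=> z t zpos; rewrite -[X in is_derive _ _ _ X]subr0.
  apply: is_derive_funB; last exact: (is_derive_cst (est z.1 i ord0) t 1).
  apply: (is_derive_slice (v := delta_mx (idx_x j) ord0)
    (f := fun th : 'cV[R]_(L + L + 1) => th i ord0)
    (c := fun t => theta_of xi (upd_x j z t))) => [h|]; first exact: theta_upd_x.
  by apply: (is_derive_eq (is_derive_coord i _ _)); rewrite mxE eqxx andbT.
- exact: L1_cst.
- exact: i1.
Qed.

End information.

(** * The column in direction xi *)

Section score_of_the_noise_variance.
Context {R : realType} {N L : nat} {d : measure_display} {Omega : measurableType d}.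
Local Notation T := (N.-tuple R * (L.-tuple R * L.-tuple R))%type.
Variables (Phi : 'M[R]_(N, L)) (c0 c1 c2 : R).
Variable mu2 : {sigma_finite_measure set (L.-tuple R * L.-tuple R)%type -> \bar R}.
Variables (P : R -> probability Omega R) (n : Omega -> N.-tuple R) (x g : Omega -> L.-tuple R).
Hypothesis model : forall xi, 0 < xi -> hybrid_model c0 c1 c2 xi mu2 (P xi) n x g.
Variable xi : R.
Hypothesis xi0 : 0 < xi.

Local Notation scx := (sc Phi c1 c2 xi n x g idx_xi).
Local Notation err est t i w := (param (colv (x w)) (colv (g w)) t i ord0 -
  est (observation Phi (x w) (n w)) i ord0).

(** [score_expectation] with m = N and q the squared residual. The sample map does not involve xi;
    only the law does, so the slope of the mean of phi is its covariance with the score. *)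
Lemma score_xi_integral (phi : T -> R) (a eps : R) :
  measurable_fun setT phi ->
  (forall xi', 0 < xi' -> L1 (P xi') (fun w => phi (sample n x g Phi w))) ->
  (forall xi', 0 < xi' -> \int[P xi']_w phi (sample n x g Phi w) = a + eps * xi') ->
  \int[P xi]_w (phi (sample n x g Phi w) * scx w) = eps.
Proof.
move=> mphi iphi Iphi.
pose q (z : T) := \sum_k tnth (tsub z.1 (signal Phi z.2.1)) k ^+ 2.
have q0 z : 0 <= q z by apply: sumr_ge0 => k _; exact: sqr_ge0.
have mq : measurable_fun setT q.
  apply: measurable_sum => k; apply: measurable_funX; apply: measurable_tnthf.
  by apply: measurable_tsub => //; apply: measurable_signal; exact: measurableT_comp.
have fE t : 0 < t -> forall z, hyb_pdf c0 c1 c2 Phi t z =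
    scale_kernel (fun z => prior_pdf c0 c1 c2 z.2) q N%:R t z.
  by move=> _ z; rewrite /hyb_pdf mulrC.
rewrite -[RHS](score_expectation q0 (ler0n _ _) (measurable_sample (model xi0) Phi) mq
  (fun t _ => measurable_hyb_pdf c0 c1 c2 Phi t) (fun t _ => hyb_pdf_ge0 c0 c1 c2 Phi t)
  fE (fun t t0 => sample_law (model t0) Phi) mphi xi0 iphi Iphi).
apply: eq_Rintegral => w _; congr (_ * _); rewrite /sc scoreE_xi paramE.
congr (_ / _ - _); apply: eq_bigr => k _.
by rewrite (tnth_tsub_signal Phi xi (sample n x g Phi w)).
Qed.

(** The score frozen at xi has mean N xi' / (2 xi^2) - N / (2 xi) under the law with variance xi';
    the slope in xi' is the information. *)
Lemma score_xi_variance :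
  \int[P xi]_w (scx w * scx w) =
  N%:R / (2 * xi ^+ 2).
Proof.
pose phi (z : T) := score Phi c1 c2 (colv z.1) (theta_of xi z) idx_xi ord0.
apply: (score_xi_integral (phi := phi) (a := - (N%:R / (2 * xi)))).
- exact: measurable_score.
- move=> xi' h0; rewrite (_ : (fun w => phi (sample n x g Phi w)) = (fun w => (2 * xi ^+ 2)^-1 * (\sum_k tnth (n w) k ^+ 2) - N%:R / (2 * xi))); last first.
    by apply/funext => w; rewrite -(scE_xi Phi c1 c2 xi n x g).
  apply: L1B; last exact: L1_cst.
  by apply: L1Z; apply: L1_sum => k; exact: L2_L1 (L2_noise_sqr (model h0) k).
- move=> xi' h0.
  transitivity (\int[P xi']_w ((2 * xi ^+ 2)^-1 * (\sum_k tnth (n w) k ^+ 2) - N%:R / (2 * xi))).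
    by apply: eq_Rintegral => w _; rewrite -(scE_xi Phi c1 c2 xi n x g).
  have i1 : L1 (P xi') (fun w => \sum_k tnth (n w) k ^+ 2).
    by apply: L1_sum => k; exact: L2_L1 (L2_noise_sqr (model h0) k).
  rewrite RintegralB//; [|exact: L1Z|exact: L1_cst].
  rewrite RintegralZl// Rintegral_cst1 (noise_power (model h0)).
  by field; rewrite gt_eqF.
Qed.

(** The error frozen at xi exceeds the true error under xi' by xi - xi' in the component xi and by 0
    elsewhere. Since the true error has the same mean b for all xi', the slope is -1 or 0. *)
Lemma error_score_xi (est : N.-tuple R -> 'cV[R]_(L + L + 1)) (b : 'I_(L + L + 1) -> R) i :
  (forall i, measurable_fun setT (fun u => est u i ord0)) ->
  (forall xi', 0 < xi' -> L1 (P xi') (fun w => err est xi' i w)) ->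
  (forall xi', 0 < xi' -> \int[P xi']_w (err est xi' i w) = b i) ->
  \int[P xi]_w ((err est xi i w) * scx w) = - (i == idx_xi)%:R.
Proof.
move=> mest ie Ie.
have thE xi' w : param (colv (x w)) (colv (g w)) xi i ord0 =
    param (colv (x w)) (colv (g w)) xi' i ord0 + (i == idx_xi)%:R * (xi - xi').
  by move: i {ie Ie}; apply: idx_ind => [k|k|]; rewrite !paramE !eq_idx ?mul0r ?addr0// mul1r subrKC.
have E xi' : (fun w => err est xi i w) =
    (fun w => err est xi' i w + (i == idx_xi)%:R * (xi - xi')).
  by apply/funext => w; rewrite (thE xi'); ring.
apply: (score_xi_integral (phi := fun z => theta_of xi z i ord0 - est z.1 i ord0)
   (a := b i + (i == idx_xi)%:R * xi)).
- apply: measurable_funB; first exact: measurable_theta_of.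
  by apply: (measurableT_comp (mest i)); exact: measurable_fst.
- move=> xi' h0; have := L1D (ie xi' h0) (L1_cst (P xi') ((i == idx_xi)%:R * (xi - xi'))).
  by rewrite -E.
- move=> xi' h0.
  transitivity (\int[P xi']_w (err est xi' i w + (i == idx_xi)%:R * (xi - xi'))).
    by apply: eq_Rintegral => w _; have /(congr1 (@^~ w)) := E xi'.
  rewrite RintegralD//; [|exact: ie|exact: L1_cst].
  by rewrite Ie// Rintegral_cst1; ring.
Qed.

End score_of_the_noise_variance.

(** * Information matrix and bound common to both models *)

Section bound.
Context {R : realType} {N L : nat} {d : measure_display} {Omega : measurableType d}.
Variables (Phi : 'M[R]_(N, L)) (c0 c1 c2 : R).
Variable mu2 : {sigma_finite_measure set (L.-tuple R * L.-tuple R)%type -> \bar R}.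
Variables (P : R -> probability Omega R) (n : Omega -> N.-tuple R) (x g : Omega -> L.-tuple R).
Hypothesis model : forall xi, 0 < xi -> hybrid_model c0 c1 c2 xi mu2 (P xi) n x g.
Variable xi : R.
Hypothesis xi0 : 0 < xi.
Hypothesis g4 : forall j, L1 (P xi) (fun w => tnth (g w) j ^- 4).
Variable p : 'cV[R]_N -> 'cV[R]_(L + L + 1) -> R.
Hypothesis pE : forall y t, positive_param t -> p y t = expR (loglik Phi c0 c1 c2 y t).

Let y w := observation Phi (x w) (n w).
Let theta t w := param (colv (x w)) (colv (g w)) t.
Local Notation sc := (sc Phi c1 c2 xi n x g).
Local Notation dsc := (dsc Phi c1 c2 xi n x g).
Local Notation H := (information_matrix (P xi) y (theta xi) p).

Lemma hessian_log_pdfE w i j :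
  hessian_log_pdf y (theta xi) p w i j = dsc (delta_mx i ord0) j w.
Proof.
have tpos : positive_param (theta xi w).
  exact: (positive_theta (z := (y w, (x w, g w))) xi0 (hybrid_positive (model xi0) w)).
rewrite /hessian_log_pdf (hessian_loglik (Phi := Phi) (c0 := c0) (c1 := c1) (c2 := c2)
  (y := colv (y w)) _ tpos); first by rewrite mxE.
by move=> s spos; rewrite pE// expRK.
Qed.

Lemma hybrid_information_exists : information_exists (P xi) y (theta xi) p.
Proof.
move=> i j; have := L1_dsc Phi (model xi0) g4 (delta_mx i ord0) j.
by rewrite /L1; congr (_.-integrable _ _); apply/funext => w /=; rewrite hessian_log_pdfE.
Qed.

Lemma information_matrix_entry i j : H i j = - \int[P xi]_w dsc (delta_mx i ord0) j w.
Proof.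
rewrite mxE /Rintegral unlock; congr (- fine _).
by apply: eq_integral => w _; rewrite hessian_log_pdfE.
Qed.

Lemma hybrid_informationE : H = block_mx
  (block_mx (xi^-1 *: (Phi^T *m Phi) + diag_mx (\row_j \int[P xi]_w (tnth (g w) j)^-1)) 0 0
    (diag_mx (\row_j ((c1 + 1) * (\int[P xi]_w tnth (g w) j ^- 2)
      + 2 * c2 * \int[P xi]_w tnth (g w) j ^- 3)))) 0 0 (N%:R / (2 * xi ^+ 2))%:M.
Proof.
have dE (i k : 'I_(L + L + 1)) : (delta_mx i ord0 : 'cV[R]_(L + L + 1)) k ord0 = (k == i)%:R.
  by rewrite mxE eqxx andbT.
have dr0 i k : (forall l, (i == idx_x l) = false) -> dresid Phi (delta_mx i ord0) k = 0.
  by move=> il; apply: big1 => l _; rewrite dE eq_sym il mulr0.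
have drx i k : dresid Phi (delta_mx (idx_x i) ord0) k = Phi k i.
  rewrite /dresid (bigD1 i)//= dE eqxx mulr1 big1 ?addr0// => l li.
  by rewrite dE eq_idx (negbTE li) mulr0.
apply/matrixP => i j; rewrite information_matrix_entry; move: i j.
apply: idx_ind => [i|i|]; apply: idx_ind => [j|j|].
- rewrite (mean_dsc_x Phi (model xi0) g4) dE eq_idx opprD !opprK.
  rewrite [RHS]block_mxEul [RHS]block_mxEul !mxE; congr (_ + _).
    rewrite mulrC; congr (_ * _); apply: eq_bigr => k _.
    by rewrite drx mxE mulrC.
  by rewrite eq_sym mulr_natl; case: eqP => [->|].
- rewrite (mean_dsc_g Phi (model xi0) g4) dE eq_idx mul0r oppr0 oppr0.
  by rewrite [RHS]block_mxEul [RHS]block_mxEur mxE.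
- rewrite (mean_dsc_xi Phi (model xi0)) dE eq_idx mul0r oppr0 oppr0.
  by rewrite [RHS]block_mxEur mxE.
- rewrite (mean_dsc_x Phi (model xi0) g4) dE eq_idx mul0r subr0 opprK.
  rewrite [RHS]block_mxEul [RHS]block_mxEdl mxE big1 ?mul0r// => k _.
  by rewrite dr0 ?mulr0// => l; rewrite eq_idx.
- rewrite (mean_dsc_g Phi (model xi0) g4) dE eq_idx opprK.
  rewrite [RHS]block_mxEul [RHS]block_mxEdr !mxE.
  by rewrite eq_sym mulr_natl; case: eqP => [->|].
- rewrite (mean_dsc_xi Phi (model xi0)) dE eq_idx mul0r oppr0 oppr0.
  by rewrite [RHS]block_mxEur mxE.
- rewrite (mean_dsc_x Phi (model xi0) g4) dE eq_idx mul0r subr0 opprK.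
  rewrite [RHS]block_mxEdl mxE big1 ?mul0r// => k _.
  by rewrite dr0 ?mulr0// => l; rewrite eq_idx.
- rewrite (mean_dsc_g Phi (model xi0) g4) dE eq_idx mul0r oppr0 oppr0.
  by rewrite [RHS]block_mxEdl mxE.
- rewrite (mean_dsc_xi Phi (model xi0)) dE eq_idx mul1r opprK.
  by rewrite [RHS]block_mxEdr mxE eqxx.
Qed.

Lemma hybrid_information_sym i j : H i j = H j i.
Proof.
rewrite -[in RHS](trmxK H) [RHS]mxE; congr (_ _ _); rewrite hybrid_informationE.
by rewrite !tr_block_mx !trmx0 linearD linearZ /= trmx_mul trmxK !tr_diag_mx tr_scalar_mx.
Qed.

(** The two identities for the gamma columns stay hypotheses, since this is where the models part:
    differentiation in gamma_j when it is deterministic, a Stein identity when it is random. *)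
Lemma hybrid_bound (est : N.-tuple R -> 'cV[R]_(L + L + 1)) (b : 'cV[R]_(L + L + 1)) :
  (forall i, measurable_fun setT (fun u => est u i ord0)) ->
  (forall xi', 0 < xi' -> mean_error_exists (P xi') y (theta xi') est /\
    mean_error (P xi') y (theta xi') est = b) ->
  mse_exists (P xi) y (theta xi) est ->
  (forall i j, \int[P xi]_w (sc i w * sc (idx_g j) w) = H i (idx_g j)) ->
  (forall i j, \int[P xi]_w (error y (theta xi) est i w * sc (idx_g j) w) = - (i == idx_g j)%:R) ->
  H \in unitmx ->
  mxge (mse_matrix (P xi) y (theta xi) est) (invmx H).
Proof.
move=> mest me mse scg eg Hu.
have merr i : measurable_fun setT (error y (theta xi) est i).
  rewrite (_ : error _ _ _ _ = (fun w => theta_of xi (sample n x g Phi w) i ord0 - est (sample n x g Phi w).1 i ord0)).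
    apply: measurable_funB.
      exact: (measurableT_comp (measurable_theta_of xi i) (measurable_sample (model xi0) Phi)).
    apply: (measurableT_comp (mest i)).
    exact: (measurableT_comp (@measurable_fst _ _ _ _) (measurable_sample (model xi0) Phi)).
  by apply/funext => w; rewrite /error mxE [X in _ + X]mxE.
have e2 i : L2 (P xi) (error y (theta xi) est i).
  by split; [exact: merr|exact: mse].
have s2 i : L2 (P xi) (sc i) by exact: L2_sc (model xi0) g4 i.
have errE xi' i : error y (theta xi') est i = (fun w => param (colv (x w)) (colv (g w)) xi' i ord0 -
    est (observation Phi (x w) (n w)) i ord0).
  by apply/funext => w; rewrite /error mxE [X in _ + X]mxE.
apply: (hybrid_cramer_rao e2 s2) => //.
- move=> i j; move: j; apply: idx_ind => [j|j|]; last 2 first.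
  + exact: eg.
  + rewrite errE; apply: (error_score_xi (P := P) (b := fun i => b i ord0) model xi0 mest) => xi' h0.
      by have [/(_ i) + _] := me _ h0; rewrite errE.
    have [_ <-] := me _ h0.
    by rewrite mxE unlock errE.
  + have := L2M_L1 (e2 i) (s2 (idx_x j)); rewrite errE => i1.
    exact: (error_stein_x (model xi0) mest).
- have col_x i j : \int[P xi]_w (sc i w * sc (idx_x j) w) = H i (idx_x j).
    by rewrite (score_stein_x Phi (model xi0) g4) hybrid_information_sym information_matrix_entry.
  move=> i j; move: j i; apply: idx_ind => [j|j|] i; [exact: col_x|exact: scg|].
  (* In the xi column only the corner is new; the other entries are transposes of entries in the x
     and gamma columns. *)
  move: i; apply: idx_ind => [i|i|].
  + by rewrite hybrid_information_sym -col_x; apply: eq_Rintegral => w _; rewrite mulrC.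
  + by rewrite hybrid_information_sym -scg; apply: eq_Rintegral => w _; rewrite mulrC.
  + by rewrite (score_xi_variance Phi model xi0) hybrid_informationE [RHS]block_mxEdr mxE eqxx.
- by move=> i j; rewrite mxE unlock.
Qed.

End bound.

(** * Deterministic scales *)

Section product_of_sigma_finite_measures.
Context {R : realType} {d1 d2 : measure_display}.
Context {T1 : measurableType d1} {T2 : measurableType d2}.
Variables (m1 : {sigma_finite_measure set T1 -> \bar R}).
Variables (m2 : {sigma_finite_measure set T2 -> \bar R}).

(** A named copy of the product, carrying its sigma-finiteness so that it can be a factor of a
    further product. *)
Definition prod_sigma_finite : set (T1 * T2) -> \bar R := (m1 \x m2)%E.

HB.instance Definition _ := Measure.copy prod_sigma_finite (m1 \x m2)%E.

Lemma prod_sigma_finiteT : sigma_finite setT prod_sigma_finite.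
Proof.
have /sigma_finiteP[F [TF ndF Foo]] := sigma_finiteT m1.
have /sigma_finiteP[G [TG ndG Goo]] := sigma_finiteT m2.
exists (fun k => F k `*` G k).
  rewrite -setXTT TF TG predeqE => -[x y]; split.
    move=> [/= [k _ Fkx] [l _ Gly]]; exists (maxn k l) => //; split.
    - by move: x Fkx; exact/subsetPset/ndF/leq_maxl.
    - by move: y Gly; exact/subsetPset/ndG/leq_maxr.
  by move=> [k _ []/= ? ?]; split; exists k.
move=> k; have [? ?] := Foo k; have [? ?] := Goo k.
split; first exact: measurableX.
by rewrite [X in (X < _)%E]product_measure1E// lte_mul_pinfty// ge0_fin_numE.
Qed.

HB.instance Definition _ :=
  Measure_isSigmaFinite.Build _ _ _ prod_sigma_finite prod_sigma_finiteT.

End product_of_sigma_finite_measures.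

Section law_with_fixed_component.
Context {R : realType} {d : measure_display} {Omega : measurableType d}.
Context {d1 d2 : measure_display} {T1 : measurableType d1} {T2 : measurableType d2}.
Variables (P : probability Omega R) (X : {mfun Omega >-> T1}).
Variables (m1 : {sigma_finite_measure set T1 -> \bar R}) (b : T2) (f : T1 * T2 -> R).
Local Open Scope ereal_scope.

(** Integration against the Dirac mass only sees the section of f at b, so a constant component can
    be adjoined to a vector with a density. *)
Lemma has_pdf_cst : measurable_fun setT f -> (forall z, 0 <= f z)%R ->
  has_pdf P X m1 (fun u => f (u, b)) ->
  has_pdf P (fun w => (X w, b)) (prod_sigma_finite m1 (dirac b)) f.
Proof.
move=> mf f0 hX A mA.
have mfA : measurable_fun setT ((EFin \o f) \_ A).
  by apply/(measurable_restrictT _ _).1 => //; apply: measurable_funTS; exact/measurable_EFinP.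
have -> : (fun w => (X w, b)) @^-1` A = X @^-1` (ysection A b).
  by apply/seteqP; split => w /=; rewrite /ysection /= inE.
rewrite hX; last exact: measurable_ysection.
rewrite [LHS]integral_mkcond [RHS]integral_mkcond.
rewrite [RHS](_ : _ = \int[m1 \x dirac b]_z ((EFin \o f) \_ A) z)//.
rewrite fubini_tonelli1//; last first.
  by move=> z; rewrite erestrict_ge0// => ? _; rewrite lee_fin.
apply: eq_integral => u _; rewrite /fubini_F integral_dirac//.
  by rewrite diracT mul1e /patch mem_ysection.
exact: measurableT_comp.
Qed.

End law_with_fixed_component.

Section deterministic_scale.
Context {R : realType} {N L : nat}.
Implicit Types (g : L.-tuple R) (xi : R).

Lemma colv_surj (gam : 'cV[R]_L) : exists g : L.-tuple R, gam = colv g.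
Proof.
by exists [tuple gam i ord0 | i < L]; apply/colP => i; rewrite mxE tnth_mktuple.
Qed.

Lemma positive_colv g : positive_vec (colv g) <-> positive_tuple g.
Proof.
by split=> [g0|/forallP g0 i]; [apply/forallP => i; have := g0 i|]; rewrite mxE.
Qed.

Lemma noise_pdf_signal (Phi : 'M[R]_(N, L)) xi u v : 0 < xi ->
  noise_pdf xi (tsub u (signal Phi v)) = gauss_pdf (Phi *m colv v) xi%:M (colv u).
Proof.
move=> xi0; rewrite gauss_pdf_scalar//; congr expR; congr (_ - _ / _).
by apply: eq_bigr => k _; rewrite !tnth_mktuple [colv u _ _]mxE.
Qed.

Lemma noise_law_pdf d (Omega : measurableType d) (P : probability Omega R)
    (n : Omega -> N.-tuple R) xi : 0 < xi ->
  noise_law P n xi -> has_pdf P n (leb N) (noise_pdf xi).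
Proof.
move=> xi0; rewrite /noise_law; congr (has_pdf _ _ _ _); apply/funext => u.
rewrite gauss_pdf_scalar//; congr expR; congr (_ - _ / _).
by apply: eq_bigr => k _; rewrite !mxE subr0.
Qed.

Local Notation cdet := (- (ln (2 * pi) / 2)).

Lemma prior_pdf_det g (u : L.-tuple R) : positive_tuple g ->
  prior_pdf cdet (- 2^-1) 0 (u, g) = source_pdf (colv g) (colv u).
Proof.
move=> g0; rewrite /prior_pdf g0 source_pdfE//; last exact/positive_colv.
by congr expR; apply: eq_bigr => i _; rewrite !mxE.
Qed.

Lemma hybrid_det d (Omega : measurableType d) (P : probability Omega R)
    (x : {mfun Omega >-> L.-tuple R}) (n : {mfun Omega >-> N.-tuple R}) g xi :
  positive_tuple g -> 0 < xi -> model_det P x n (colv g) xi ->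
  hybrid_model cdet (- 2^-1) 0 xi (prod_sigma_finite (leb L) (dirac g))
    P n x (fun=> g).
Proof.
move=> g0 xi0 [hn hx nx]; split => //.
  by move=> j; exact: (slice_le_prodl (dirac g) (@slice_le_leb R L j)).
have mxg : measurable_fun setT (fun w => (x w, g)) by exact: measurable_fun_pair.
pose V : {mfun Omega >-> (L.-tuple R * L.-tuple R)%type} :=
  HB.pack (fun w => (x w, g)) (isMeasurableFun.Build _ _ _ _ _ mxg).
apply: (@has_pdf_pair _ _ _ _ _ _ _ _ n V (leb N) (prod_sigma_finite (leb L) (dirac g))).
- exact: measurable_noise_pdf.
- exact: measurable_prior_pdf.
- by move=> u; exact: noise_pdf_ge0.
- by move=> u; exact: prior_pdf_ge0.
- exact: noise_law_pdf.
- apply: has_pdf_cst; [exact: measurable_prior_pdf|by move=> u; exact: prior_pdf_ge0|].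
  by rewrite (funext (fun u => prior_pdf_det u g0)).
- move=> A B mA mB; rewrite (_ : V @^-1` B = x @^-1` ysection B g).
    by apply: nx => //; exact: measurable_ysection.
  by apply/seteqP; split => w /=; rewrite /ysection /= inE.
Qed.

Lemma measurable_source_pdf g : positive_tuple g ->
  measurable_fun setT (fun u : L.-tuple R => source_pdf (colv g) (colv u)).
Proof.
move=> g0; rewrite -(funext (fun u => prior_pdf_det u g0)).
by apply: (measurableT_comp (measurable_prior_pdf _ _ _)); exact: measurable_fun_pair.
Qed.

(** Density of (y, x) alone. Differentiation in gamma requires one reference measure for all gamma,
    whereas the Dirac factors of the hybrid description at different gamma are mutually singular. *)
Definition joint_det (Phi : 'M[R]_(N, L)) xi g (z : N.-tuple R * L.-tuple R) : R :=
  noise_pdf xi (tsub z.1 (signal Phi z.2)) * source_pdf (colv g) (colv z.2).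

Lemma joint_detE Phi xi g z : 0 < xi ->
  joint_pdf_det Phi (colv z.1) (param (colv z.2) (colv g) xi) = joint_det Phi xi g z.
Proof.
move=> xi0; rewrite /joint_det noise_pdf_signal// /joint_pdf_det.
by rewrite /param_x /param_gam /param_xi !col_mxKu !col_mxKd mxE eqxx.
Qed.

Lemma joint_det_ge0 Phi xi g z : positive_tuple g -> 0 <= joint_det Phi xi g z.
Proof.
by move=> g0; rewrite mulr_ge0 ?noise_pdf_ge0// -prior_pdf_det// prior_pdf_ge0.
Qed.

Lemma measurable_joint_det Phi xi g : positive_tuple g ->
  measurable_fun setT (joint_det Phi xi g).
Proof.
move=> g0; apply: measurable_funM.
  apply: (measurableT_comp (measurable_noise_pdf xi)); apply: measurable_tsub => //.
  exact: measurable_signal.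
exact: (measurableT_comp (measurable_source_pdf g0)).
Qed.

Lemma joint_det_law d (Omega : measurableType d) (P : probability Omega R)
    (x : {mfun Omega >-> L.-tuple R}) (n : {mfun Omega >-> N.-tuple R}) Phi g xi :
  positive_tuple g -> 0 < xi -> model_det P x n (colv g) xi ->
  has_pdf P (fun w => (observation Phi (x w) (n w), x w)) (leb N \x leb L)%E
    (joint_det Phi xi g).
Proof.
move=> g0 xi0 [hn hx nx].
rewrite (_ : (fun w => _) = (fun w => (tadd (n w) (signal Phi (x w)), x w))); last first.
  by apply/funext => w; rewrite observationE.
have s0 (u : L.-tuple R) : 0 <= source_pdf (colv g) (colv u).
  by rewrite -prior_pdf_det// prior_pdf_ge0.
have ms := measurable_source_pdf g0.
have mn := measurable_noise_pdf (N := N) xi.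
have n0 u := noise_pdf_ge0 (N := N) xi u.
have mS := measurable_signal Phi (@measurable_id _ _ setT).
apply: (has_pdf_shift (tau := signal Phi) _ _ mn ms mS n0 s0) => //.
exact: (has_pdf_pair mn ms n0 s0 (noise_law_pdf xi0 hn) hx nx).
Qed.

End deterministic_scale.

Section score_of_a_deterministic_scale.
Context {R : realType} {N L : nat} {d : measure_display} {Omega : measurableType d}.
Variables (Phi : 'M[R]_(N, L)) (P : 'cV[R]_L -> R -> probability Omega R).
Variables (x : {mfun Omega >-> L.-tuple R}) (n : {mfun Omega >-> N.-tuple R}).
Hypothesis mod : forall gam xi, positive_vec gam -> 0 < xi ->
  model_det (P gam xi) x n gam xi.
Variables (g : L.-tuple R) (xi : R).
Hypotheses (gpos : positive_tuple g) (xi0 : 0 < xi).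

Local Notation cdet := (- (ln (2 * pi) / 2)).
Local Notation S := (N.-tuple R * L.-tuple R)%type.
Local Notation y w := (observation Phi (x w) (n w)).
Local Notation scg := (sc Phi (- 2^-1) 0 xi n x (fun=> g)).
Local Notation Pset j t := (P (colv (tset j g t)) xi).

Let gj0 j : 0 < tnth g j. Proof. by move/forallP: gpos; apply. Qed.

Lemma positive_tset j t : 0 < t -> positive_tuple (tset j g t).
Proof. by move=> t0; apply/forallP => i; rewrite tnth_tset; case: ifP. Qed.

Lemma tset_id j : tset j g (tnth g j) = g.
Proof. by apply: eq_from_tnth => i; rewrite tnth_tset; case: eqP => [->|]. Qed.

Let mdet h : positive_tuple h -> model_det (P (colv h) xi) x n (colv h) xi.
Proof. by move=> /positive_colv h0; exact: mod. Qed.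

Let hyb h (h0 : positive_tuple h) := hybrid_det h0 xi0 (mdet h0).

(** As a function of t = gamma_j only the Gaussian factor of x_j varies, a scale kernel with m = 1;
    the noise and the other sources form the constant factor. *)
Let jointE j t z : 0 < t -> joint_det Phi xi (tset j g t) z = scale_kernel
  (fun z => noise_pdf xi (tsub z.1 (signal Phi z.2)) * expR (\sum_(i | i != j)
     (cdet + - 2^-1 * ln (tnth g i) - (0 + tnth z.2 i ^+ 2 / 2) / tnth g i)))
  (fun z => tnth z.2 j ^+ 2) 1 t z.
Proof.
move=> t0; rewrite /joint_det -prior_pdf_det ?positive_tset//.
rewrite /prior_pdf positive_tset// /scale_kernel -mulrA -expRD; congr (_ * expR _).
rewrite /prior_exponent (sum_tset j g t
  (fun i s => cdet + - 2^-1 * ln s - (0 + tnth z.2 i ^+ 2 / 2) / s)) addrC; congr (_ + _).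
rewrite [ln (2 * pi * t)]lnM ?posrE ?mulr_gt0 ?pi_gt0//.
by move: (ln (2 * pi)) (ln t) => a b; field; rewrite gt_eqF.
Qed.

Lemma score_g_integral j (phi : S -> R) (a eps : R) : measurable_fun setT phi ->
  (forall t, 0 < t -> L1 (Pset j t) (fun w => phi (y w, x w))) ->
  (forall t, 0 < t -> \int[Pset j t]_w phi (y w, x w) = a + eps * t) ->
  \int[P (colv g) xi]_w (phi (y w, x w) * scg (idx_g j) w) = eps.
Proof.
move=> mphi iphi Iphi.
have q0 (z : S) : 0 <= tnth z.2 j ^+ 2 by exact: sqr_ge0.
have mq : measurable_fun setT (fun z : S => tnth z.2 j ^+ 2).
  by apply: measurable_funX; apply: measurable_tnthf.
have my : measurable_fun setT (fun w => (y w, x w)).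
  apply: measurable_fun_pair => //.
  rewrite (_ : (fun w => _) = (fun w => tadd (n w) (signal Phi (x w)))).
    by apply: measurable_tadd => //; exact: measurable_signal.
  by apply/funext => w; rewrite observationE.
have pt t (t0 : 0 < t) := positive_tset j t0.
have := score_expectation (P := fun t => Pset j t) (f := fun t => joint_det Phi xi (tset j g t))
  q0 ler01 my mq (fun t t0 => measurable_joint_det Phi xi (pt t t0))
  (fun t t0 z => joint_det_ge0 Phi xi z (pt t t0)) (fun t t0 z => jointE j z t0)
  (fun t t0 => joint_det_law Phi (pt t t0) xi0 (mdet (pt t t0))) mphi (gj0 j) iphi Iphi.
rewrite tset_id => <-; apply: eq_Rintegral => w _; congr (_ * _).
by rewrite scE_g; field; rewrite gt_eqF.
Qed.

Local Notation theta := (fun w => param (colv (x w)) (colv g) xi).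
Local Notation Y := (fun w => y w).
Local Notation H := (information_matrix (P (colv g) xi) Y theta (joint_pdf_det Phi)).

Let models xi' (h0 : 0 < xi') :=
  hybrid_det gpos h0 (mod ((positive_colv g).2 gpos) h0).

Let g4 h (t : R) j : L1 (P h t) (fun=> tnth g j ^- 4). Proof. exact: L1_cst. Qed.

Lemma hybrid_information_det_exists :
  information_exists (P (colv g) xi) Y theta (joint_pdf_det Phi).
Proof. exact: (hybrid_information_exists models xi0 (g4 _ _) (@joint_pdf_detE R N L Phi)). Qed.

Lemma hybrid_information_detE : H = block_mx
  (block_mx (xi^-1 *: (Phi^T *m Phi) + invmx (diag_mx (colv g)^T)) 0
            0 (invmx (diag_mx (\row_i (2 * colv g i ord0 ^+ 2)))))
  0 0 (N%:R / (2 * xi ^+ 2))%:M.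
Proof.
rewrite [LHS](hybrid_informationE models xi0 (g4 _ _) (@joint_pdf_detE R N L Phi)).
rewrite !invmx_diag; last 2 first.
- by move=> i; rewrite !mxE gt_eqF// mulr_gt0// exprn_gt0.
- by move=> i; rewrite !mxE gt_eqF.
congr (block_mx (block_mx (_ + diag_mx _) 0 0 (diag_mx _)) 0 0 _).
  by apply/rowP => i; rewrite !mxE Rintegral_cst1.
apply/rowP => i; rewrite !mxE !Rintegral_cst1.
by field; rewrite gt_eqF.
Qed.

Lemma source_variance j h : positive_tuple h ->
  L1 (P (colv h) xi) (fun w => tnth (x w) j ^+ 2) /\
  \int[P (colv h) xi]_w tnth (x w) j ^+ 2 = tnth h j.
Proof.
move=> h0; have hj : tnth h j != 0 by rewrite gt_eqF//; move/forallP: h0; apply.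
have i2 : L1 (P (colv h) xi) (fun w => tnth (x w) j ^+ 2).
  have := L1Z (tnth h j) (L2_L1 (L2_source2 (hyb h0) j)).
  by congr L1; apply/funext => w; rewrite mulrCA mulfV ?mulr1.
split=> //; rewrite -[RHS](Rintegral_cst1 (P (colv h) xi)).
(* The factor 1 gives the shape of [source_second_moment] with r the identity. *)
have E : (fun w => tnth (x w) j ^+ 2 * (tnth h j / tnth h j)) = (fun w => tnth (x w) j ^+ 2).
  by apply/funext => w; rewrite mulfV// mulr1.
rewrite -E; apply: (source_second_moment (hyb h0) (j := j) (r := id)) => //.
  exact: L1_cst.
by rewrite [X in L1 _ X]E.
Qed.

Let mz : measurable_fun setT (fun z : S => (z.1, (z.2, g))).
Proof. by apply: measurable_fun_pair => //; exact: measurable_fun_pair. Qed.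

Let mscore i : measurable_fun setT (fun z : S =>
  score Phi (- 2^-1) 0 (colv z.1) (theta_of xi (z.1, (z.2, g))) i ord0).
Proof. exact: (measurableT_comp (measurable_score (- 2^-1) 0 xi Phi i) mz). Qed.

Lemma score_g_covariance i j : \int[P (colv g) xi]_w (scg i w * scg (idx_g j) w) = H i (idx_g j).
Proof.
have entry := information_matrix_entry models xi0 (@joint_pdf_detE R N L Phi).
have g4' h := g4 (colv h) xi.
move: i; apply: idx_ind => [i|i|].
- rewrite entry -[RHS](score_stein_x Phi (models xi0) (g4' g)).
  by apply: eq_Rintegral => w _; rewrite mulrC.
- have -> : H (idx_g i) (idx_g j) = (2 * tnth g i ^+ 2)^-1 * (i == j)%:R.
    rewrite hybrid_information_detE [LHS]block_mxEul [LHS]block_mxEdr invmx_diag; last first.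
      by move=> k; rewrite !mxE gt_eqF// mulr_gt0// exprn_gt0.
    by rewrite !mxE mulr_natr.
  have E : scg (idx_g i) =
      (fun w => - 2^-1 * (tnth g i)^-1 + 2^-1 * tnth g i ^- 2 * tnth (x w) i ^+ 2).
    by apply/funext => w; rewrite scE_g mul0r add0r (mulrC (tnth (x w) i ^+ 2)) mulrA.
  apply: (score_g_integral (phi := fun z => score Phi (- 2^-1) 0 (colv z.1)
    (theta_of xi (z.1, (z.2, g))) (idx_g i) ord0)
    (* When i differs from j the variance of x_i stays at gamma_i and belongs to the constant term;
       when i = j it is t and gives the slope. *)
    (a := - 2^-1 * (tnth g i)^-1 + 2^-1 * tnth g i ^- 2 * (tnth g i * (i != j)%:R))) => // t t0.
  + have [i2 _] := source_variance i (positive_tset j t0).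
    by rewrite [X in L1 _ X]E; apply: L1D; [exact: L1_cst|exact: L1Z].
  + have [i2 I2] := source_variance i (positive_tset j t0).
    rewrite [X in Rintegral _ _ X]E RintegralD//; [|exact: L1_cst|exact: L1Z].
    rewrite Rintegral_cst1 RintegralZl// I2 tnth_tset.
    by case: eqP => _ /=; field; rewrite gt_eqF.
- have -> : H idx_xi (idx_g j) = 0.
    by rewrite hybrid_information_detE [LHS]block_mxEdl mxE.
  have E h : scg idx_xi = sc Phi (- 2^-1) 0 xi n x (fun=> h) idx_xi.
    by apply/funext => w; rewrite !scE_xi.
  apply: (score_g_integral (phi := fun z => score Phi (- 2^-1) 0 (colv z.1)
    (theta_of xi (z.1, (z.2, g))) idx_xi ord0) (a := 0)) => // t t0.
  + rewrite [X in L1 _ X](E (tset j g t)); apply: L2_L1.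
    by apply: (L2_sc Phi (hyb (positive_tset j t0))) => k; exact: L1_cst.
  + rewrite [X in Rintegral _ _ X](E (tset j g t)) mul0r addr0.
    exact: (mean_sc_xi Phi (hyb (positive_tset j t0))).
Qed.

Lemma hybrid_bound_det (est : N.-tuple R -> 'cV[R]_(L + L + 1)) (b : 'cV[R]_(L + L + 1)) :
  (forall i, measurable_fun setT (fun u => est u i ord0)) ->
  (forall gam' xi', positive_vec gam' -> 0 < xi' ->
     let theta' := fun w => param (colv (x w)) gam' xi' in
     mean_error_exists (P gam' xi') Y theta' est /\
     mean_error (P gam' xi') Y theta' est = b) ->
  mse_exists (P (colv g) xi) Y theta est ->
  H \in unitmx ->
  mxge (mse_matrix (P (colv g) xi) Y theta est) (invmx H).
Proof.
move=> mest me mse.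
have g0 : positive_vec (colv g) by exact/positive_colv.
apply: (hybrid_bound models xi0 (g4 _ _) (@joint_pdf_detE R N L Phi) (b := b) mest _ mse).
- by move=> xi' h0; exact: me.
- exact: score_g_covariance.
move=> i j.
have errorE th w : error Y th est i w = th w i ord0 - est (y w) i ord0.
  by rewrite /error mxE [X in _ + X]mxE.
(* The parameter frozen at g differs from the one along the path only in component gamma_j, by
   gamma_j - t; this yields the slope -1 or 0, the mean error along the path being the constant
   b. *)
have thE t w : param (colv (x w)) (colv g) xi i ord0 =
    param (colv (x w)) (colv (tset j g t)) xi i ord0 + (i == idx_g j)%:R * (tnth g j - t).
  clear errorE; move: i; apply: idx_ind => [k|k|]; rewrite !paramE !eq_idx ?mul0r ?addr0//.
  by rewrite !mxE tnth_tset; case: eqP => [->|_]; rewrite ?mul1r ?subrKC// mul0r addr0.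
have pt t : 0 < t -> positive_vec (colv (tset j g t)).
  by move=> t0; apply/positive_colv; exact: positive_tset.
have E t : (fun w => param (colv (x w)) (colv g) xi i ord0 - est (y w) i ord0) =
   (fun w => error Y (fun w => param (colv (x w)) (colv (tset j g t)) xi) est i w +
    (i == idx_g j)%:R * (tnth g j - t)).
  by apply/funext => w; rewrite errorE (thE t) addrAC.
have e1 t : 0 < t -> L1 (Pset j t)
    (error Y (fun w => param (colv (x w)) (colv (tset j g t)) xi) est i).
  by move=> t0; have [/(_ i) + _] := me _ _ (pt _ t0) xi0.
rewrite (funext (errorE theta)).
apply: (score_g_integral (phi := fun z => theta_of xi (z.1, (z.2, g)) i ord0 - est z.1 i ord0)
   (a := b i ord0 + (i == idx_g j)%:R * tnth g j)) => [|t t0|t t0].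
- apply: measurable_funB; last by apply: (measurableT_comp (mest i)); exact: measurable_fst.
  exact: (measurableT_comp (measurable_theta_of xi i) mz).
- by rewrite [X in L1 _ X](E t); apply: L1D; [exact: e1|exact: L1_cst].
- rewrite [X in Rintegral _ _ X](E t) RintegralD//; [|exact: e1|exact: L1_cst].
  rewrite Rintegral_cst1 [X in X + _](_ : _ = b i ord0); first by ring.
  by have [_ <-] := me _ _ (pt _ t0) xi0; rewrite mxE unlock.
Qed.

End score_of_a_deterministic_scale.

(** * Random scales *)

Section random_scale.
Context {R : realType} {N L : nat} {d : measure_display} {Omega : measurableType d}.
Local Notation T := (N.-tuple R * (L.-tuple R * L.-tuple R))%type.
Local Notation lebLL := (prod_sigma_finite (@leb R L) (@leb R L)).
Variables (Phi : 'M[R]_(N, L)) (c0 c1 c2 xi : R).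
Hypotheses (c1N1 : c1 < - 1) (c20 : 0 < c2).
Variables (P : probability Omega R) (n : Omega -> N.-tuple R) (x g : Omega -> L.-tuple R).
Hypothesis model : hybrid_model c0 c1 c2 xi lebLL P n x g.
Implicit Types (z : T) (t : R).

Local Notation sc := (sc Phi c1 c2 xi n x g).
Local Notation dsc := (dsc Phi c1 c2 xi n x g).

Definition upd_g (j : 'I_L) z t : T := (z.1, (z.2.1, tset j z.2.2 t)).

Lemma slice_le_g j : slice_le (leb N \x lebLL)%E (@upd_g j).
Proof.
exact: (slice_le_prodr (leb N) (m2 := lebLL)
  (slice_le_prodr (leb L) (@slice_le_leb R L j))).
Qed.

(** Conjugacy: given x, the scale gamma_j is inverse gamma with shape -c1 - 1 and rate c2 + x_j^2 /
    2. The density vanishes on the whole line when another scale is not positive. *)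
Lemma hyb_pdf_slice_g j z : (forall t, hyb_pdf c0 c1 c2 Phi xi (upd_g j z t) = 0) \/
  exists kappa, forall t, hyb_pdf c0 c1 c2 Phi xi (upd_g j z t) =
    igslice (c2 + tnth z.2.1 j ^+ 2 / 2) (- c1 - 1) kappa t.
Proof.
have posE t : positive_tuple (tset j z.2.2 t) =
    (0 < t) && [forall (i | i != j), 0 < tnth z.2.2 i].
  apply/forallP/andP => [h|[t0 /forallP h] i].
    split; first by have := h j; rewrite tnth_tset eqxx.
    by apply/forallP => i; apply/implyP => ij; have := h i; rewrite tnth_tset (negbTE ij).
  by rewrite tnth_tset; case: eqVneq (h i).
case: (boolP [forall (i | i != j), 0 < tnth z.2.2 i]) posE => _ posE; last first.
  by left => t; rewrite /hyb_pdf /prior_pdf /= posE andbF mulr0.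
right; pose F i s := c0 + c1 * ln s - (c2 + tnth z.2.1 i ^+ 2 / 2) / s.
exists (- (N%:R / 2 * ln (2 * pi * xi)) -
   (\sum_k tnth (tsub z.1 (signal Phi z.2.1)) k ^+ 2) / (2 * xi) +
   (\sum_(i | i != j) F i (tnth z.2.2 i) + c0)) => t.
rewrite /hyb_pdf /prior_pdf /= posE andbT /igslice; case: ifP => _; last by rewrite mulr0.
rewrite /noise_pdf -expRD /prior_exponent /= (sum_tset j z.2.2 t F); congr expR.
rewrite -[in RHS]addrA -[in RHS]addrA; congr (_ + _); rewrite /F.
by move: (\sum_(i | _) _) (ln t) (_ / t) => u v w; ring.
Qed.

(** On each line phi is a Laurent polynomial in gamma_j with exponents from -2 to 1, and dphi its
    derivative. The coefficients may depend on the line in any way, so nothing is asked of the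
    estimator beyond measurability. *)
Lemma stein_g j (phi dphi : T -> R) :
  measurable_fun setT phi -> measurable_fun setT dphi ->
  (forall z, exists cm d0 d1 d2, forall t, 0 < t ->
    phi (upd_g j z t) = cm * t + d0 + d1 / t + d2 / t ^+ 2 /\
    dphi (upd_g j z t) = cm - d1 / t ^+ 2 - 2 * d2 / t ^+ 3) ->
  L1 P (fun w => dphi (sample n x g Phi w)) ->
  L1 P (fun w => phi (sample n x g Phi w) * sc (idx_g j) w) ->
  \int[P]_w (phi (sample n x g Phi w) * sc (idx_g j) w) =
  - \int[P]_w dphi (sample n x g Phi w).
Proof.
move=> mphi mdphi rat i1 i2; apply/eqP; rewrite -addr_eq0 addrC -RintegralD//; apply/eqP.
pose psi z := dphi z + phi z * score Phi c1 c2 (colv z.1) (theta_of xi z) (idx_g j) ord0.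
have mpsi : measurable_fun setT psi.
  by apply: measurable_funD => //; apply: measurable_funM => //; exact: measurable_score.
rewrite /Rintegral (expectation_slice0 (measurable_sample model Phi)
  (measurable_hyb_pdf c0 c1 c2 Phi xi) (hyb_pdf_ge0 c0 c1 c2 Phi xi) (sample_law model Phi)
  (slice_le_g (j := j)) mpsi)//; first exact: L1D.
move=> z; have [h|[kappa h]] := hyb_pdf_slice_g j z.
  by under eq_integral do rewrite h mulr0; rewrite integral0.
have [cm [d0 [d1 [d2 ratz]]]] := rat z.
have B0 : 0 < c2 + tnth z.2.1 j ^+ 2 / 2 by rewrite ltr_wpDr// divr_ge0 ?sqr_ge0.
have A0 : 0 < - c1 - 1 by rewrite subr_gt0 ltrNr.
rewrite -[RHS](igfun_slice_stein B0 kappa cm d0 d1 d2 A0).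
apply: eq_integral => t _; rewrite h /igslice; case: ifPn => t0; last by rewrite !mulr0.
have [phiE dphiE] := ratz t t0.
rewrite /psi phiE dphiE scoreE_g !paramE !mxE /= tnth_tset eqxx.
congr EFin; congr (_ * _); congr (_ + _ * _).
by ring.
Qed.

(** The rate on every line is at least c2 > 0, so [igfun_slice_moment4] with b = c2 gives a constant
    M valid on all lines. *)
Lemma L1_invg4 j : L1 P (fun w => tnth (g w) j ^- 4).
Proof.
have A0 : 0 < - c1 - 1 by rewrite subr_gt0 ltrNr.
have mgj : measurable_fun setT (fun w => tnth (g w) j).
  by apply: measurable_tnthf; exact: hybrid_measurable_g model.
apply: L1_ge0.
- by apply: measurable_funV; exact: measurable_funX.
- by move=> w; rewrite invr_ge0 exprn_even_ge0.
pose A := - c1 - 1; pose M := A * (A + 1) * (A + 2) * (A + 3) / c2 ^+ 4.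
have mzg : measurable_fun setT (fun z : T => tnth z.2.2 j ^- 4).
  by apply: measurable_funV; apply: measurable_funX; exact: measurable_scale_coord.
have M0 : 0 <= M.
  rewrite /M; clear M mzg; move: A (ltW A0 : 0 <= A) => a a0.
  by rewrite divr_ge0 ?(exprn_ge0 4 (ltW c20))// !mulr_ge0// addr_ge0.
apply: le_lt_trans (expectation_slice_le (measurable_sample model Phi)
  (measurable_hyb_pdf c0 c1 c2 Phi xi) (hyb_pdf_ge0 c0 c1 c2 Phi xi) (sample_law model Phi)
  (slice_le_g (j := j)) (psi := fun=> M) mzg (@measurable_cst _ _ _ _ _ _) _ _ _) _.
- by move=> z; rewrite invr_ge0 exprn_even_ge0.
- by [].
- move=> z /=; have [h|[kappa h]] := hyb_pdf_slice_g j z.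
    by under eq_integral do rewrite h mulr0; under [leRHS]eq_integral do rewrite h mulr0.
  under eq_integral do rewrite h tnth_tset eqxx; under [leRHS]eq_integral do rewrite h.
  have q0 : 0 <= tnth z.2.1 j ^+ 2 / 2 by rewrite divr_ge0 ?sqr_ge0.
  by apply: igfun_slice_moment4 => //; [rewrite ltr_wpDr|rewrite lerDl].
- by have /integrable_lty -> : L1 P (fun=> M) by exact: L1_cst.
Qed.

Let g4 := L1_invg4.
Let gN0 w j : tnth (g w) j != 0.
Proof. by rewrite gt_eqF//; move/forallP: (hybrid_positive model w); apply. Qed.

Lemma score_stein_g i j : \int[P]_w (sc i w * sc (idx_g j) w) =
  - \int[P]_w dsc (delta_mx (idx_g j) ord0) i w.
Proof.
refine (stein_g (j := j)
  (phi := fun z => score Phi c1 c2 (colv z.1) (theta_of xi z) i ord0)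
  (dphi := fun z => dscore Phi c1 c2 (colv z.1) (theta_of xi z) (delta_mx (idx_g j) ord0) i ord0)
  _ _ _ _ _).
- exact: measurable_score.
- exact: measurable_dscore.
- move=> z.
  have dE k : (delta_mx (idx_g j) ord0 : 'cV[R]_(L + L + 1)) k ord0 = (k == idx_g j)%:R.
    by rewrite mxE eqxx andbT.
  have dr k : dresid Phi (delta_mx (idx_g j) ord0) k = 0.
    by apply: big1 => l _; rewrite dE eq_idx mulr0.
  have rE t k : resid Phi (colv z.1) (theta_of xi (upd_g j z t)) k = resid Phi (colv z.1) (theta_of xi z) k.
    by rewrite /resid; congr (_ - _); apply: eq_bigr => l _; rewrite !paramE.
  have s0 l : \sum_k Phi k l * dresid Phi (delta_mx (idx_g j) ord0) k = 0.
    by apply: big1 => k _; rewrite dr mulr0.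
  have s1 t l : \sum_k Phi k l * resid Phi (colv z.1) (theta_of xi (upd_g j z t)) k =
      \sum_k Phi k l * resid Phi (colv z.1) (theta_of xi z) k.
    by apply: eq_bigr => k _; rewrite rE.
  have s2 t : \sum_k resid Phi (colv z.1) (theta_of xi (upd_g j z t)) k ^+ 2 =
      \sum_k resid Phi (colv z.1) (theta_of xi z) k ^+ 2.
    by apply: eq_bigr => k _; rewrite rE.
  have s3 t : \sum_k resid Phi (colv z.1) (theta_of xi (upd_g j z t)) k *
      dresid Phi (delta_mx (idx_g j) ord0) k = 0.
    by apply: big1 => k _; rewrite dr mulr0.
  move: i; apply: idx_ind => [i|i|].
  + pose r := (\sum_k Phi k i * resid Phi (colv z.1) (theta_of xi z) k) / xi.
    (* The quotient x_i / gamma_i is a 1/t term when i = j and a constant otherwise; the two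
       indicators cover both cases with one set of coefficients. *)
    exists 0, (r - (i != j)%:R * (tnth z.2.1 i / tnth z.2.2 i)), (- (i == j)%:R * tnth z.2.1 i), 0 => t t0.
    rewrite scoreE_x dscoreE_x !dE !eq_idx !paramE !mxE /= tnth_tset s0 s1.
    by case: (i == j); rewrite /r /=; split; ring.
  + pose D := (i == j)%:R : R; pose D' := (i != j)%:R : R.
    pose q := c2 + tnth z.2.1 i ^+ 2 / 2.
    exists 0, (D' * (c1 / tnth z.2.2 i + q / tnth z.2.2 i ^+ 2)), (D * c1), (D * q) => t t0.
    rewrite scoreE_g dscoreE_g !dE !eq_idx !paramE !mxE /= tnth_tset /D /D' /q.
    case: (i == j); rewrite /=; split; try ring.
    by move: (tnth z.2.1 i) t0 => u t0; clear D D' q; field; rewrite gt_eqF.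
  + exists 0, ((\sum_k resid Phi (colv z.1) (theta_of xi z) k ^+ 2) / (2 * xi ^+ 2) -
      N%:R / (2 * xi)), 0, 0 => t t0.
    split; first by rewrite scoreE_xi paramE_xi s2; move: (\sum_k _) => r; ring.
    rewrite dscoreE_xi [X in _ - X / _ = _]s3 dE eq_idx /=.
    by move: (\sum_k _) (theta_of _ _ _ _) => r a; ring.
- exact: (L1_dsc Phi model g4).
- exact: L2M_L1 (L2_sc Phi model g4 i) (L2_sc Phi model g4 (idx_g j)).
Qed.

Lemma error_stein_g (est : N.-tuple R -> 'cV[R]_(L + L + 1)) i j :
  (forall i, measurable_fun setT (fun u => est u i ord0)) ->
  L1 P (fun w => (param (colv (x w)) (colv (g w)) xi i ord0 -
    est (observation Phi (x w) (n w)) i ord0) * sc (idx_g j) w) ->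
  \int[P]_w ((param (colv (x w)) (colv (g w)) xi i ord0 -
    est (observation Phi (x w) (n w)) i ord0) * sc (idx_g j) w) = - (i == idx_g j)%:R.
Proof.
move=> mest i1; rewrite -[(i == _)%:R](Rintegral_cst1 P).
apply: (stein_g (j := j)
  (phi := fun z => theta_of xi z i ord0 - est z.1 i ord0) (dphi := fun=> (i == idx_g j)%:R)) => //.
- apply: measurable_funB; first exact: measurable_theta_of.
  by apply: (measurableT_comp (mest i)); exact: measurable_fst.
- move=> z.
  exists (i == idx_g j)%:R, ((i != idx_g j)%:R * theta_of xi z i ord0 - est z.1 i ord0), 0, 0 => t t0.
  rewrite /=; move: (est z.1 i ord0) => e; move: i {i1}; apply: idx_ind => [k|k|];
    rewrite !paramE !eq_idx /=; [split; ring| |split; ring].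
  rewrite !mxE tnth_tset; case: (k == j) => /=; split; ring.
- exact: L1_cst.
Qed.

(** Stein identity with a test function of gamma_j alone. The x_j^2 in the score is eliminated
    through the conditional variance, which adds 1/2 to c1 and leaves a relation between inverse
    moments of gamma_j. *)
Lemma scale_stein j (r dr : R -> R) (cm d0 d1 : R) :
  measurable_fun setT r -> measurable_fun setT dr ->
  (forall t, 0 < t -> r t = cm * t + d0 + d1 / t /\ dr t = cm - d1 / t ^+ 2) ->
  L1 P (fun w => dr (tnth (g w) j)) -> L1 P (fun w => r (tnth (g w) j) / tnth (g w) j) ->
  L1 P (fun w => r (tnth (g w) j) / tnth (g w) j ^+ 2) ->
  L1 P (fun w => tnth (x w) j ^+ 2 * (r (tnth (g w) j) / tnth (g w) j / tnth (g w) j)) ->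
  (c1 + 2^-1) * \int[P]_w (r (tnth (g w) j) / tnth (g w) j) +
    c2 * \int[P]_w (r (tnth (g w) j) / tnth (g w) j ^+ 2) =
  - \int[P]_w dr (tnth (g w) j).
Proof.
move=> mr mdr rE i1 i2 i3 i4.
have mj := @measurable_scale_coord R N L j.
have E : (fun w => r (tnth (g w) j) * sc (idx_g j) w) =
    (fun w => c1 * (r (tnth (g w) j) / tnth (g w) j) +
      (c2 * (r (tnth (g w) j) / tnth (g w) j ^+ 2) +
       2^-1 * (tnth (x w) j ^+ 2 * (r (tnth (g w) j) / tnth (g w) j / tnth (g w) j)))).
  by apply/funext => w; rewrite scE_g; move: (r _) => s; field.
have iE : L1 P (fun w => r (tnth (g w) j) * sc (idx_g j) w).
  by rewrite E; apply: L1D; [exact: L1Z|apply: L1D; exact: L1Z].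
rewrite -(stein_g (phi := fun z => r (tnth z.2.2 j)) (dphi := fun z => dr (tnth z.2.2 j))
  (measurableT_comp mr mj) (measurableT_comp mdr mj) _ i1 iE); last first.
  move=> z; exists cm, d0, d1, 0 => t t0; rewrite /= tnth_tset eqxx.
  by have [-> ->] := rE t t0; split; ring.
rewrite [X in _ = Rintegral _ _ X]E RintegralD//; [|exact: L1Z|by apply: L1D; exact: L1Z].
rewrite RintegralD//; [|exact: L1Z|exact: L1Z].
rewrite !RintegralZl// (source_second_moment model (r := fun s => r s / s))//; first by ring.
by apply: measurable_funM => //; exact: measurable_funV.
Qed.

(** The test functions t, 1 and 1/t in [scale_stein] give this and the next two moments in turn,
    without evaluating any Gamma function. *)
Lemma scale_moment1 j : c2 * (\int[P]_w (tnth (g w) j)^-1) = - c1 - 3 / 2.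
Proof.
have E0 : (fun w => tnth (g w) j / tnth (g w) j) = (fun=> 1).
  by apply/funext => w; rewrite mulfV.
have E1 : (fun w => tnth (g w) j / tnth (g w) j ^+ 2) = (fun w => (tnth (g w) j)^-1).
  by apply/funext => w; field.
have E2 : (fun w => tnth (x w) j ^+ 2 * (tnth (g w) j / tnth (g w) j / tnth (g w) j)) =
    (fun w => tnth (x w) j ^+ 2 * (tnth (g w) j)^-1).
  by apply/funext => w; rewrite mulfV// mul1r.
have := scale_stein (j := j) (r := id) (dr := fun=> 1) (cm := 1) (d0 := 0) (d1 := 0)
  (@measurable_id _ _ _) (@measurable_cst _ _ _ _ _ _).
rewrite E0 E1 E2 !Rintegral_cst1 mulr1 => h.
suff : c1 + 2^-1 + c2 * (\int[P]_w (tnth (g w) j)^-1) = - 1.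
  by move: (\int[P]_w _) => m h'; lra.
apply: h; [|exact: L1_cst|exact: L1_cst|exact: L2_L1 (L2_invg model g4 j)|exact: L2_L1 (L2_source2 model j)].
by move=> t t0; split; ring.
Qed.

Lemma scale_moment2 j : c2 * (\int[P]_w tnth (g w) j ^- 2) =
  (- c1 - 2^-1) * \int[P]_w (tnth (g w) j)^-1.
Proof.
have E0 : (fun w => 1 / tnth (g w) j) = (fun w => (tnth (g w) j)^-1).
  by apply/funext => w; rewrite div1r.
have E1 : (fun w => 1 / tnth (g w) j ^+ 2) = (fun w => tnth (g w) j ^- 2).
  by apply/funext => w; rewrite div1r.
have E2 : (fun w => tnth (x w) j ^+ 2 * (1 / tnth (g w) j / tnth (g w) j)) =
    (fun w => tnth (x w) j ^+ 2 * tnth (g w) j ^- 2).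
  by apply/funext => w; rewrite div1r -invfM.
have := scale_stein (j := j) (r := fun=> 1) (dr := fun=> 0) (cm := 0) (d0 := 1) (d1 := 0)
  (@measurable_cst _ _ _ _ _ _) (@measurable_cst _ _ _ _ _ _).
rewrite E0 E1 E2 Rintegral_cst1 oppr0 => h.
suff : (c1 + 2^-1) * (\int[P]_w (tnth (g w) j)^-1) + c2 * (\int[P]_w tnth (g w) j ^- 2) = 0.
  by move: (\int[P]_w _) (\int[P]_w _) => m1 m2 h'; lra.
apply: h; [|exact: L1_cst|exact: L2_L1 (L2_invg model g4 j)|exact: L2_L1 (L2_invg2 model g4 j)
  |exact: L2_L1 (L2_source2V model g4 j)].
by move=> t t0; split; ring.
Qed.

Lemma scale_moment3 j : c2 * (\int[P]_w tnth (g w) j ^- 3) =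
  (2^-1 - c1) * \int[P]_w tnth (g w) j ^- 2.
Proof.
have E0 : (fun w => (tnth (g w) j)^-1 / tnth (g w) j) = (fun w => tnth (g w) j ^- 2).
  by apply/funext => w; rewrite -invfM.
have E1 : (fun w => (tnth (g w) j)^-1 / tnth (g w) j ^+ 2) = (fun w => tnth (g w) j ^- 3).
  by apply/funext => w; rewrite -invfM -exprS.
have E2 : (fun w => tnth (x w) j ^+ 2 * ((tnth (g w) j)^-1 / tnth (g w) j / tnth (g w) j)) =
    (fun w => (tnth (x w) j ^+ 2 * tnth (g w) j ^- 2) * (tnth (g w) j)^-1).
  by apply/funext => w; rewrite -(invfM (tnth _ _)) mulrA.
have E3 : (fun w => - tnth (g w) j ^- 2) = (fun w => - 1 * tnth (g w) j ^- 2).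
  by apply/funext => w; rewrite mulN1r.
have i2 := L2_L1 (L2_invg2 model g4 j).
have mV : measurable_fun setT (fun t : R => - t ^- 2).
  by apply: measurable_funN; apply: measurable_funV; exact: measurable_funX.
have := scale_stein (j := j) (r := GRing.inv) (cm := 0) (d0 := 0) (d1 := 1)
  (@measurable_inv R) mV.
rewrite E0 E1 E2 E3 RintegralZl// => h.
suff : (c1 + 2^-1) * (\int[P]_w tnth (g w) j ^- 2) + c2 * (\int[P]_w tnth (g w) j ^- 3) =
    - (- 1 * \int[P]_w tnth (g w) j ^- 2).
  by move: (\int[P]_w _) (\int[P]_w _) => m1 m2 h'; lra.
apply: h; [|exact: L1Z|exact: i2|exact: L1_invg3 model g4 j|exact: L2M_L1 (L2_source2V model g4 j) (L2_invg model g4 j)].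
by move=> t t0; split; ring.
Qed.

End random_scale.

Section law_reassociation.
Context {R : realType} {d : measure_display} {Omega : measurableType d}.
Context {d1 d2 d3 : measure_display}.
Context {T1 : measurableType d1} {T2 : measurableType d2} {T3 : measurableType d3}.
Variables (P : probability Omega R) (U : Omega -> T1) (V : Omega -> T2) (W : Omega -> T3).
Variables (m1 : {sigma_finite_measure set T1 -> \bar R}).
Variables (m2 : {sigma_finite_measure set T2 -> \bar R}).
Variables (m3 : {sigma_finite_measure set T3 -> \bar R}).
Variable f : T1 * (T2 * T3) -> R.
Local Open Scope ereal_scope.

(** The slicing arguments group the variables as (y, (x, gamma)), the theorem as ((y, x), gamma);
    iterated Tonelli identifies the two triple integrals. *)
Lemma has_pdf_assoc : measurable_fun setT f -> (forall z, 0 <= f z)%R ->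
  has_pdf P (fun w => (U w, (V w, W w))) (m1 \x prod_sigma_finite m2 m3) f ->
  has_pdf P (fun w => (U w, V w, W w)) (m1 \x m2 \x m3)
    (fun z => f (z.1.1, (z.1.2, z.2))).
Proof.
move=> mf f0 h A mA.
pose r (z : T1 * (T2 * T3)) := (z.1, z.2.1, z.2.2).
pose r' (z : T1 * T2 * T3) := (z.1.1, (z.1.2, z.2)).
have mr : measurable_fun setT r.
  apply: measurable_fun_pair; last exact: measurableT_comp.
  by apply: measurable_fun_pair => //; exact: measurableT_comp.
have mr' : measurable_fun setT r'.
  apply: measurable_fun_pair; first exact: measurableT_comp.
  by apply: measurable_fun_pair => //; exact: measurableT_comp.
have mrA : measurable (r @^-1` A) by rewrite -[X in measurable X]setTI; exact: mr.
rewrite [LHS](h (r @^-1` A) mrA).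
pose F := (EFin \o f) \_ (r @^-1` A).
have mF : measurable_fun setT F.
  by apply/(measurable_restrictT _ _).1 => //; apply: measurable_funTS; exact/measurable_EFinP.
have F0 z : 0 <= F z by rewrite /F erestrict_ge0// => ? _; rewrite lee_fin.
rewrite integral_mkcond -/F [RHS]integral_mkcond.
have -> : \int[m1 \x m2 \x m3]_z ((fun z => (f (z.1.1, (z.1.2, z.2)))%:E) \_ A) z =
    \int[prod_sigma_finite m1 m2 \x m3]_z F (r' z).
  by apply: eq_integral => z _; rewrite /F /patch /r /r' /=; case: z => -[].
have mFr : measurable_fun setT (F \o r') by exact: measurableT_comp.
rewrite fubini_tonelli1// [RHS]fubini_tonelli1//.
rewrite [RHS](_ : _ = \int[m1 \x m2]_z fubini_F m3 (F \o r') z)//.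
rewrite [RHS]fubini_tonelli1; last 2 first.
- apply: (measurable_fun_fubini_tonelli_F (F \o r')) => // z; exact: F0.
- by move=> z; apply: integral_ge0 => t _; exact: F0.
apply: eq_integral => u _; rewrite /fubini_F.
rewrite [LHS](_ : _ = \int[m2 \x m3]_z F (u, z))// fubini_tonelli1//.
exact: measurableT_comp.
Qed.

End law_reassociation.

Section random_scale_model.
Context {R : realType} {N L : nat} {d : measure_display} {Omega : measurableType d}.
Local Notation lebLL := (prod_sigma_finite (@leb R L) (@leb R L)).
Variables (nu lam : R).
Hypotheses (nu0 : 0 < nu) (lam0 : 0 < lam).

Lemma prior_pdf_rand (v : L.-tuple R * L.-tuple R) : 0 < Gamma (nu / 2) ->
  prior_pdf (c0_rand nu lam) (c1_rand nu) (c2_rand nu lam) v =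
  source_pdf (colv v.2) (colv v.1) * hyper_pdf nu lam (colv v.2).
Proof.
move=> G0; rewrite /prior_pdf; case: ifPn => [vpos|]; last first.
  rewrite negb_forall => /existsP[i /negbTE vi].
  by rewrite /hyper_pdf (bigD1 i)//= /invgamma_pdf mxE vi mul0r mulr0.
rewrite source_hyper_pdfE//; last exact/positive_colv.
by congr expR; apply: eq_bigr => i _; rewrite !mxE.
Qed.

Lemma Gamma_ge0 (a : R) : 0 <= Gamma a.
Proof.
by apply: Rintegral_ge0 => t _; rewrite mulr_ge0 ?powR_ge0 ?expR_ge0.
Qed.

(** Positivity is read off the model: if [Gamma] were 0, its inverse would take the default value 0,
    the density of (x, gamma) would vanish since L > 0 makes the product nonempty, and the total
    mass would be 0. *)
Lemma model_rand_Gamma_gt0 (P : probability Omega R) (x g : Omega -> L.-tuple R)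
    (n : Omega -> N.-tuple R) xi : (0 < L)%N ->
  model_rand P x g n nu lam xi -> 0 < Gamma (nu / 2).
Proof.
case: L x g => // l x g _ [_ h _]; rewrite lt_neqAle Gamma_ge0 andbT eq_sym.
apply/negP => /eqP G0; have := h setT measurableT; rewrite preimage_setT probability_setT.
rewrite (_ : (fun z => _) = (fun=> 0%:E)); last first.
  apply/funext => z; rewrite /hyper_pdf big_ord_recl /invgamma_pdf G0 invr0.
  by case: ifP => _; rewrite !mul0r mulr0.
by rewrite integral0 => /eqP; rewrite onee_eq0.
Qed.

Lemma hybrid_rand (P : probability Omega R) (x g : {mfun Omega >-> L.-tuple R})
    (n : {mfun Omega >-> N.-tuple R}) xi : 0 < Gamma (nu / 2) ->
  (forall w, positive_vec (colv (g w))) -> 0 < xi -> model_rand P x g n nu lam xi ->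
  hybrid_model (c0_rand nu lam) (c1_rand nu) (c2_rand nu lam) xi lebLL P n x g.
Proof.
move=> G0 g0 xi0 [hn hx nx]; split => //.
- by move=> j; exact: (slice_le_prodl (leb L) (@slice_le_leb R L j)).
- by move=> w; exact/positive_colv.
have mxg : measurable_fun setT (fun w => (x w, g w)) by exact: measurable_fun_pair.
pose V : {mfun Omega >-> (L.-tuple R * L.-tuple R)%type} :=
  HB.pack (fun w => (x w, g w)) (isMeasurableFun.Build _ _ _ _ _ mxg).
apply: (@has_pdf_pair _ _ _ _ _ _ _ _ n V (leb N) lebLL).
- exact: measurable_noise_pdf.
- exact: measurable_prior_pdf.
- by move=> u; exact: noise_pdf_ge0.
- by move=> u; exact: prior_pdf_ge0.
- exact: noise_law_pdf.
- by rewrite (funext (fun v => prior_pdf_rand v G0)).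
- exact: nx.
Qed.

End random_scale_model.

Section random_scale_bound.
Context {R : realType} {N L : nat} {d : measure_display} {Omega : measurableType d}.
Variables (Phi : 'M[R]_(N, L)) (nu lam : R) (P : R -> probability Omega R).
Variables (x g : {mfun Omega >-> L.-tuple R}) (n : {mfun Omega >-> N.-tuple R}).
Hypotheses (nu0 : 0 < nu) (lam0 : 0 < lam) (G0 : 0 < Gamma (nu / 2)).
Hypothesis g0 : forall w, positive_vec (colv (g w)).
Hypothesis mod : forall xi, 0 < xi -> model_rand (P xi) x g n nu lam xi.
Variable xi : R.
Hypothesis xi0 : 0 < xi.

Local Notation p := (joint_pdf_rand nu lam Phi).
Local Notation Y := (fun w => observation Phi (x w) (n w)).
Local Notation theta t := (fun w => param (colv (x w)) (colv (g w)) t).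
Local Notation H := (information_matrix (P xi) Y (theta xi) p).

Let models xi' (h0 : 0 < xi') := hybrid_rand nu0 lam0 G0 g0 h0 (mod h0).

Let pE y t : positive_param t ->
  p y t = expR (loglik Phi (c0_rand nu lam) (c1_rand nu) (c2_rand nu lam) y t).
Proof. exact: joint_pdf_randE. Qed.

Let c1N1 : c1_rand nu < - 1.
Proof. by rewrite /c1_rand; have := nu0; lra. Qed.

Let c20 : 0 < c2_rand nu lam.
Proof. by rewrite divr_gt0// mulr_gt0. Qed.

Let g4 := L1_invg4 Phi c1N1 c20 (models xi0).

Lemma joint_pdf_rand_law :
  has_pdf (P xi) (fun w => (observation Phi (x w) (n w), x w, g w)) (leb N \x leb L \x leb L)%E
    (fun z => p (colv z.1.1) (param (colv z.1.2) (colv z.2) xi)).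
Proof.
have := has_pdf_assoc (measurable_hyb_pdf _ _ _ Phi xi) (hyb_pdf_ge0 _ _ _ Phi xi)
  (sample_law (models xi0) Phi).
congr has_pdf; apply/funext => z.
rewrite /hyb_pdf noise_pdf_signal// prior_pdf_rand//= mulrA /joint_pdf_rand.
by rewrite /param_x /param_gam /param_xi !col_mxKu !col_mxKd mxE eqxx.
Qed.

Lemma hybrid_information_rand_exists : information_exists (P xi) Y (theta xi) p.
Proof. exact: (hybrid_information_exists models xi0 g4 pE). Qed.

Lemma hybrid_information_randE : H = block_mx
  (block_mx (xi^-1 *: (Phi^T *m Phi) + lam%:M) 0
            0 (lam ^+ 2 * (nu + 2) * (nu + 7) / (2 * nu))%:M)
  0 0 (N%:R / (2 * xi ^+ 2))%:M.
Proof.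
rewrite [LHS](hybrid_informationE models xi0 g4 pE).
have nuN0 : nu != 0 by rewrite gt_eqF.
have lamN0 : lam != 0 by rewrite gt_eqF.
(* Here -c1 - 3/2 = nu / 2 and c2 = nu / (2 lam). *)
have m1 j : \int[P xi]_w (tnth (g w) j)^-1 = lam.
  have /mulfI : c2_rand nu lam != 0 by rewrite gt_eqF.
  apply; rewrite (scale_moment1 Phi c1N1 c20 (models xi0)).
  by rewrite /c1_rand /c2_rand; field; rewrite ?nuN0 ?lamN0.
have m2 j : \int[P xi]_w tnth (g w) j ^- 2 = lam ^+ 2 * (nu + 2) / nu.
  have /mulfI : c2_rand nu lam != 0 by rewrite gt_eqF.
  apply; rewrite (scale_moment2 Phi c1N1 c20 (models xi0)) m1.
  by rewrite /c1_rand /c2_rand; field; rewrite ?nuN0 ?lamN0.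
rewrite -!diag_const_mx; congr (block_mx (block_mx (_ + diag_mx _) 0 0 (diag_mx _)) 0 0 _).
  by apply/rowP => j; rewrite !mxE m1.
(* The coefficient of the second inverse moment becomes (c1 + 1) + 2 (1/2 - c1) = 2 - c1 = (nu + 7)
   / 2. *)
apply/rowP => j; rewrite !mxE -mulrA (scale_moment3 Phi c1N1 c20 (models xi0)) m2.
by rewrite /c1_rand; field.
Qed.

Lemma hybrid_bound_rand (est : N.-tuple R -> 'cV[R]_(L + L + 1)) (b : 'cV[R]_(L + L + 1)) :
  (forall i, measurable_fun setT (fun u => est u i ord0)) ->
  (forall xi', 0 < xi' -> mean_error_exists (P xi') Y (theta xi') est /\
    mean_error (P xi') Y (theta xi') est = b) ->
  mse_exists (P xi) Y (theta xi) est ->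
  H \in unitmx ->
  mxge (mse_matrix (P xi) Y (theta xi) est) (invmx H).
Proof.
move=> mest me mse.
apply: (hybrid_bound models xi0 g4 pE (b := b) mest me mse) => i j.
  (* The Stein identity differentiates score i in direction gamma_j, which is the transposed entry
     of the Hessian. *)
  rewrite [RHS](hybrid_information_sym models xi0 g4 pE).
  rewrite (information_matrix_entry models xi0 pE).
  exact: (score_stein_g Phi c1N1 c20 (models xi0)).
have E : error Y (theta xi) est i =
    (fun w => param (colv (x w)) (colv (g w)) xi i ord0 - est (observation Phi (x w) (n w)) i ord0).
  by apply/funext => w; rewrite /error mxE [X in _ + X]mxE.
have e2 : L2 (P xi) (error Y (theta xi) est i).
  split; last exact: mse.
  by have [/(_ i) /L1_measurable] := me _ xi0.
have := L2M_L1 e2 (L2_sc Phi (models xi0) g4 (idx_g j)).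
rewrite E; exact: (error_stein_g c1N1 c20 (models xi0) mest).
Qed.

End random_scale_bound.

Theorem proposition3 (R : realType) (N L : nat) (Phi : 'M[R]_(N, L))
    (N1 : (1 <= N)%N) (L1 : (1 <= L)%N) :
  (* (a) gamma deterministic *)
  (forall (d : measure_display) (Omega : measurableType d)
      (P : 'cV[R]_L -> R -> probability Omega R)
      (x : {mfun Omega >-> L.-tuple R}) (n : {mfun Omega >-> N.-tuple R})
      (y := fun w => observation Phi (x w) (n w))
      (theta := fun gam xi w => param (colv (x w)) gam xi)
      (p := joint_pdf_det Phi),
    (forall gam xi, positive_vec gam -> 0 < xi ->
       model_det (P gam xi) x n gam xi) ->
    forall (gam : 'cV[R]_L) (xi : R), positive_vec gam -> 0 < xi ->
    let H := information_matrix (P gam xi) y (theta gam xi) p in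
    [/\ has_pdf (P gam xi) (fun w => (y w, x w)) (leb N \x leb L)%E
          (fun z => p (colv z.1) (param (colv z.2) gam xi)),
        information_exists (P gam xi) y (theta gam xi) p,
        H = block_mx
              (block_mx (xi^-1 *: (Phi^T *m Phi) + invmx (diag_mx gam^T)) 0
                        0 (invmx (diag_mx (\row_i (2 * gam i ord0 ^+ 2)))))
              0
              0 (N%:R / (2 * xi ^+ 2))%:M
      & forall est : N.-tuple R -> 'cV[R]_(L + L + 1),
          (forall i, measurable_fun setT (fun u => est u i ord0)) ->
          (exists b, forall gam' xi', positive_vec gam' -> 0 < xi' ->
             mean_error_exists (P gam' xi') y (theta gam' xi') est /\
             mean_error (P gam' xi') y (theta gam' xi') est = b) ->
          mse_exists (P gam xi) y (theta gam xi) est ->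
          H \in unitmx ->
          mxge (mse_matrix (P gam xi) y (theta gam xi) est) (invmx H)]) /\
  (* (b) gamma random *)
  (forall (nu lam : R), 0 < nu -> 0 < lam ->
    forall (d : measure_display) (Omega : measurableType d)
      (P : R -> probability Omega R)
      (x g : {mfun Omega >-> L.-tuple R}) (n : {mfun Omega >-> N.-tuple R})
      (y := fun w => observation Phi (x w) (n w))
      (theta := fun xi w => param (colv (x w)) (colv (g w)) xi)
      (p := joint_pdf_rand nu lam Phi),
    (forall w, positive_vec (colv (g w))) ->
    (forall xi, 0 < xi -> model_rand (P xi) x g n nu lam xi) ->
    forall xi : R, 0 < xi ->
    let H := information_matrix (P xi) y (theta xi) p in
    [/\ has_pdf (P xi) (fun w => (y w, x w, g w)) (leb N \x leb L \x leb L)%E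
          (fun z => p (colv z.1.1) (param (colv z.1.2) (colv z.2) xi)),
        information_exists (P xi) y (theta xi) p,
        H = block_mx
              (block_mx (xi^-1 *: (Phi^T *m Phi) + lam%:M) 0
                        0 (lam ^+ 2 * (nu + 2) * (nu + 7) / (2 * nu))%:M)
              0
              0 (N%:R / (2 * xi ^+ 2))%:M
      & forall est : N.-tuple R -> 'cV[R]_(L + L + 1),
          (forall i, measurable_fun setT (fun u => est u i ord0)) ->
          (exists b, forall xi', 0 < xi' ->
             mean_error_exists (P xi') y (theta xi') est /\
             mean_error (P xi') y (theta xi') est = b) ->
          mse_exists (P xi) y (theta xi) est ->
          H \in unitmx ->
          mxge (mse_matrix (P xi) y (theta xi) est) (invmx H)]).
Proof.
split.
  move=> d Omega P x n y theta p mod gam xi; have [g ->] := colv_surj gam.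
  move=> g0 xi0 H; have gpos : positive_tuple g by exact/positive_colv.
  split.
  - rewrite (funext (fun z => joint_detE Phi g z xi0)).
    exact: joint_det_law (mod _ _ g0 xi0).
  - exact: hybrid_information_det_exists mod _ _ gpos xi0.
  - exact: (hybrid_information_detE _ mod gpos xi0).
  - move=> est mest [b me] mse Hu.
    exact: (hybrid_bound_det mod gpos xi0 mest me mse Hu).
move=> nu lam nu0 lam0 d Omega P x g n y theta p g0 mod xi xi0 H.
have G0 := model_rand_Gamma_gt0 L1 (mod _ xi0).
split.
- exact: (joint_pdf_rand_law Phi nu0 lam0 G0 g0 mod xi0).
- exact: (hybrid_information_rand_exists Phi nu0 lam0 G0 g0 mod xi0).
- exact: (hybrid_information_randE Phi nu0 lam0 G0 g0 mod xi0).
- move=> est mest [b me] mse Hu.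
  exact: (hybrid_bound_rand nu0 lam0 G0 g0 mod xi0 mest me mse Hu).
Qed.
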